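(* Let $T>0$, $c\in\sqrt{-1}\,\mathbb{R}$, and let $X_H(u,\theta)=c\cdot u+X_{H_c}(u,\theta)$ where $X_{H_c}:\mathbb{R}^{2n}\times S^1\to\mathbb{R}^{2n}$ is $C^1$ and compactly supported. For $u\in L^2_1([0,T]\times S^1,\mathbb{R}^{2n})$ put $$E(u)=\frac12\int_0^T\int_0^{2\pi}|u_t|^2+|u_\theta-X_H(u,\theta)|^2\,d\theta\,dt.$$ Assume $c\notin\sqrt{-1}\,\mathbb{Z}$. Then: (i) given a sequence $u_i$ with $E(u_i)<C$, the $u_i$ are uniformly $L^2_1$ bounded and thus weakly precompact; (ii) given a sequence $u_i$ converging weakly in $L^2_1$ to $u_\infty$, we have $E(u_\infty)\le\liminf E(u_i)$; (iii) if moreover $\lim E(u_i)=E(u_\infty)$, the $u_i$ converge strongly in $L^2_1$ to $u_\infty$. Finally, if $c\in\sqrt{-1}\,\mathbb{Z}$, the same conclusions hold if we furthermore assume $\|u_i(0,\cdot)\|_{L^2(S^1)}<C'$ for all $i$.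
   Context: $S^1$ is the circle of length $2\pi$ with coordinate $\theta$; $[0,T]\times S^1$ has coordinates $(t,\theta)$. $\mathbb{R}^{2n}$ is identified with $\mathbb{C}^n$, so $c\cdot u$ is complex scalar multiplication. $L^2_1$ is the Sobolev space of maps with one derivative in $L^2$. *)

(* Defs.v *)
From HB Require Import structures.
From mathcomp Require Import all_boot all_order all_algebra.
From mathcomp Require Import all_classical all_reals all_analysis.
From mathcomp Require Import complex.

Set Implicit Arguments.
Unset Strict Implicit.
Unset Printing Implicit Defensive.

Import Order.TTheory GRing.Theory Num.Theory.
Import numFieldNormedType.Exports.

Local Open Scope classical_set_scope.
Local Open Scope ring_scope.

(* On a finite-dimensional V this is the usual notion of a C^k map: existence
   and continuity of all iterated directional derivatives up to order k. *)
Fixpoint Ck (R : realType) (V W : normedModType R) (k : nat) (f : V -> W)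
    : Prop :=
  continuous f /\
  if k is k'.+1 then
    forall v : V, (forall z, derivable f z v) /\ Ck k' (fun z => 'D_v f z)
  else True.

Definition Cinfty (R : realType) (V W : normedModType R) (f : V -> W) : Prop :=
  forall k, Ck k f.

(* A map on X x S^1 is given by a map on X x R that is 2pi-periodic in its
   second argument; up to null sets, S^1 is the interval [0, 2pi]. *)
Definition periodic2 (R : realType) (X Y : Type) (f : X * R -> Y) : Prop :=
  forall x th, f (x, th + 2 * pi) = f (x, th).

Section Euclidean.
Variables (R : realType) (n : nat).

(* R^2n = 'rV[R]_(n + n) is identified with C^n by (x, y) |-> x + i y. *)
Definition cplx_scale (c : R[i]) (u : 'rV[R]_(n + n)) : 'rV[R]_(n + n) :=
  row_mx (complex.Re c *: lsubmx u - complex.Im c *: rsubmx u)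
         (complex.Im c *: lsubmx u + complex.Re c *: rsubmx u).

Definition edot (u v : 'rV[R]_(n + n)) : R := \sum_j u ord0 j * v ord0 j.

(* The canonical norm of 'rV is the sup norm, hence this definition. *)
Definition esqnorm (u : 'rV[R]_(n + n)) : R := edot u u.

Definition hvf (c : R[i]) (Xc : 'rV[R]_(n + n) * R -> 'rV[R]_(n + n))
    (z : 'rV[R]_(n + n) * R) : 'rV[R]_(n + n) :=
  cplx_scale c z.1 + Xc z.

Definition compactly_supported (Xc : 'rV[R]_(n + n) * R -> 'rV[R]_(n + n))
    : Prop :=
  exists K : set 'rV[R]_(n + n),
    compact K /\ forall x th, ~ K x -> Xc (x, th) = 0.

Definition L2 d (X : measurableType d) (mu : set X -> \bar R) (D : set X)
    (f : X -> 'rV[R]_(n + n)) : Prop :=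
  (forall j, measurable_fun D (fun x => f x ord0 j)) /\
  (\int[mu]_(x in D) (esqnorm (f x))%:E < +oo)%E.

Definition L2norm d (X : measurableType d) (mu : set X -> \bar R) (D : set X)
    (f : X -> 'rV[R]_(n + n)) : \bar R :=
  ((\int[mu]_(x in D) (esqnorm (f x))%:E) `^ 2^-1)%E.

End Euclidean.

Definition circle (R : realType) : set R := `[0, 2 * pi].

Definition area (R : realType) :
    {measure set (measurableTypeR R * measurableTypeR R) -> \bar R} :=
  (@lebesgue_measure R \x @lebesgue_measure R)%E.

Definition e_t (R : realType) : R * R := (1, 0).
Definition e_th (R : realType) : R * R := (0, 1).

Section Sobolev.
Variables (R : realType) (T : R) (n : nat).

Definition cylinder : set (R * R) := `[0, T] `*` @circle R.

Definition test_fun (phi : R * R -> R) : Prop :=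
  [/\ Cinfty phi, periodic2 phi &
      exists a b : R, [/\ 0 < a, b < T &
        forall t th, ~ (a <= t <= b) -> phi (t, th) = 0]].

Definition weak_deriv (v : R * R) (f g : R * R -> 'rV[R]_(n + n)) : Prop :=
  forall phi, test_fun phi -> forall j,
    \int[@area R]_(z in cylinder) (f z ord0 j * 'D_v phi z) =
    - \int[@area R]_(z in cylinder) (g z ord0 j * phi z).

(* Elements come with representatives of their weak derivatives, which are
   determined a.e. by the underlying map. *)
Record L21 := MkL21 {
  L21val :> R * R -> 'rV[R]_(n + n);
  L21dt : R * R -> 'rV[R]_(n + n);
  L21dth : R * R -> 'rV[R]_(n + n);
  L21val_L2 : L2 (@area R) cylinder L21val;
  L21dt_L2 : L2 (@area R) cylinder L21dt;
  L21dth_L2 : L2 (@area R) cylinder L21dth;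
  L21dt_weak : weak_deriv (@e_t R) L21val L21dt;
  L21dth_weak : weak_deriv (@e_th R) L21val L21dth
}.

(* The L^2_1 norm of a map f with first derivatives ft and fth. *)
Definition L21norm_of (f ft fth : R * R -> 'rV[R]_(n + n)) : \bar R :=
  ((\int[@area R]_(z in cylinder)
      (esqnorm (f z) + esqnorm (ft z) + esqnorm (fth z))%:E) `^ 2^-1)%E.

Definition L21norm (u : L21) : \bar R := L21norm_of u (L21dt u) (L21dth u).

Definition L21dist (u v : L21) : \bar R :=
  L21norm_of (fun z => u z - v z) (fun z => L21dt u z - L21dt v z)
             (fun z => L21dth u z - L21dth v z).

Definition L21dot (u v : L21) : R :=
  \int[@area R]_(z in cylinder)
    (edot (u z) (v z) + edot (L21dt u z) (L21dt v z)
     + edot (L21dth u z) (L21dth v z)).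

Definition weakly_converges (u : nat -> L21) (w : L21) : Prop :=
  forall v : L21, (fun i => L21dot (u i) v) @ \oo --> L21dot w v.

Definition strongly_converges (u : nat -> L21) (w : L21) : Prop :=
  (fun i => L21dist (u i) w) @ \oo --> 0%E.

Definition uniformly_bounded (u : nat -> L21) : Prop :=
  exists K : R, forall i, (L21norm (u i) <= K%:E)%E.

Definition weakly_precompact (A : set L21) : Prop :=
  forall u : nat -> L21, (forall i, A (u i)) ->
    exists s : nat -> nat, {homo s : i j / (i < j)%N} /\
      exists w : L21, weakly_converges (u \o s) w.

(* g is the trace u(0, .), i.e. the value at u of the closure of the
   restriction map to t = 0 defined on maps smooth up to the boundary. *)
Definition trace0 (u : L21) (g : R -> 'rV[R]_(n + n)) : Prop :=
  L2 (@lebesgue_measure R) (@circle R) g /\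
  exists v : nat -> R * R -> 'rV[R]_(n + n),
    [/\ forall k, Cinfty (v k) /\ periodic2 (v k),
        (fun k => L21norm_of (fun z => v k z - u z)
                    (fun z => 'D_(@e_t R) (v k) z - L21dt u z)
                    (fun z => 'D_(@e_th R) (v k) z - L21dth u z))
          @ \oo --> 0%E &
        (fun k => L2norm (@lebesgue_measure R) (@circle R)
                    (fun th => v k (0, th) - g th)) @ \oo --> 0%E].

Definition trace0_norm_lt (u : L21) (C : R) : Prop :=
  exists g, trace0 u g /\
    (L2norm (@lebesgue_measure R) (@circle R) g < C%:E)%E.

Definition energy (X : 'rV[R]_(n + n) * R -> 'rV[R]_(n + n)) (u : L21)
    : \bar R :=
  ((2^-1)%:E * \int[@area R]_(z in cylinder)
     (esqnorm (L21dt u z) + esqnorm (L21dth u z - X (u z, z.2)))%:E)%E.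

End Sobolev.

(* Main.v *)
(* Write c = i kappa. When kappa is not an integer, d/dth - c is invertible on
   periodic functions: rotating by exp(-i kappa th) turns u_th - c u into a
   derivative, and periodicity together with exp(-2 pi i kappa) <> 1 bounds the
   initial value. As X_H - c u is bounded, the energy then controls the L^2 norm
   of u, hence the whole L^2_1 norm. When kappa is an integer, the L^2 norm is
   instead controlled by the trace at t = 0 and u_t, by the fundamental theorem of
   calculus along smooth approximations. Boundedness gives weak compactness.

   A weakly convergent sequence of bounded energy converges strongly in L^2
   (Rellich): a weakly differentiable f is recovered from f and f_t by kernels
   acting on t only, and from f and f_th by kernels acting on th only, and a
   composition of the two kinds turns weak convergence into strong convergence.
   Thus c u + X_{H_c}(u) converges strongly, u_t and u_th - X_H(u) converge
   weakly, and the energy, being half their squared norm, is weakly lower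
   semicontinuous; convergence of the norms forces strong convergence. *)

Require Import Defs.
From HB Require Import structures.
From mathcomp Require Import all_boot all_order all_algebra.
From mathcomp Require Import all_classical all_reals all_analysis.
From mathcomp Require Import complex.
From mathcomp Require Import ring lra.
From mathcomp Require Import measurable_realfun.

Set Implicit Arguments.
Unset Strict Implicit.
Unset Printing Implicit Defensive.

Import Order.TTheory GRing.Theory Num.Theory.
Import numFieldNormedType.Exports.

Local Open Scope classical_set_scope.
Local Open Scope ring_scope.

(** * Weak compactness in semi-inner product spaces *)

(** Elements of L^2_1 are honest functions, not classes, so the inner product is only positive
    semidefinite. The Hilbert space arguments are therefore run for a semi-inner product on a vector
    space of functions, restricted to a predicate such as square integrability. Weak convergence is
    tested only against elements of L^2_1, whereas the energy pairs u_t and u_theta - X_H(u) with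
    arbitrary L^2 maps; vectors that almost represent an L^2 functional on the weakly differentiable
    maps bridge this gap. A kernel acting in one variable is not compact on the cylinder, because
    the other variable is a mere parameter; hence the need for kernels of both kinds. The L^2_1
    bound used on a weakly convergent sequence comes from its energy: (ii) is argued by
    contradiction along a subsequence with energies at most some C < E(u_infty), and in (iii) the
    energies are eventually bounded. Both conclusions are then read off the exact identity E(u_i) =
    E(u_infty) + A_i + N_i / 2, where A_i tends to 0 and N_i is the squared distance between the
    pairs (u_t, u_theta - X_H(u)). *)

Lemma cvgr_fmap_unique (R : realType) (T : Type) (G : set_system T)
  {PG : ProperFilter G} (f : T -> R) (a b : R) :
  f @ G --> a -> f @ G --> b -> a = b.
Proof. by move=> fa fb; exact: (@norm_cvg_unique _ _ (f @ G) _ a b fa fb). Qed.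

Lemma cvgr_le_cst (R : realType) (T : Type) (G : set_system T)
  {PG : ProperFilter G} (f : T -> R) (a b : R) :
  f @ G --> a -> (forall i, f i <= b) -> a <= b.
Proof.
move=> fa fb; rewrite -(cvg_lim (@Rhausdorff R) fa); apply: limr_le.
  by apply/cvg_ex; exists a.
exact: nearW.
Qed.

Section SemiInner.
Variables (R : realType) (V : lmodType R) (P : V -> Prop) (B : V -> V -> R).
Hypothesis PD : forall x y, P x -> P y -> P (x + y).
Hypothesis PZ : forall a x, P x -> P (a *: x).
Hypothesis BC : forall x y, B x y = B y x.
Hypothesis BDl : forall x y z, P x -> P y -> P z -> B (x + y) z = B x z + B y z.
Hypothesis BZl : forall a x z, P x -> P z -> B (a *: x) z = a * B x z.
Hypothesis B_ge0 : forall x, P x -> 0 <= B x x.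

Lemma semi_closedB x y : P x -> P y -> P (x - y).
Proof. by move=> Px Py; rewrite -scaleN1r; apply: PD => //; exact: PZ. Qed.

Lemma semi_innerBl x y z : P x -> P y -> P z -> B (x - y) z = B x z - B y z.
Proof.
by move=> Px Py Pz; rewrite -scaleN1r BDl// ?BZl ?mulN1r//; exact: PZ.
Qed.

Lemma semi_inner_normB x y : P x -> P y ->
  B (x - y) (x - y) = B x x - 2 * B x y + B y y.
Proof.
move=> Px Py; have Pxy := semi_closedB Px Py.
by rewrite semi_innerBl// ![B _ (x - y)]BC !semi_innerBl// (BC y x); lra.
Qed.

(** The optimal choice is [t = p / q]. When [q = 0] the left side is linear in [t], so a nonzero [p]
    would push it above [e]. *)
Lemma discriminant_le (p q e : R) : 0 <= q -> 0 <= e ->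
  (forall t, 2 * t * p - t ^+ 2 * q <= e) -> p ^+ 2 <= e * q.
Proof.
move=> q0 e0 H.
have [q1|q1] := eqVneq q 0; last first.
  have qp : 0 < q by rewrite lt_neqAle eq_sym q1.
  have := H (p / q); have -> : 2 * (p / q) * p - (p / q) ^+ 2 * q = p ^+ 2 / q.
    by field.
  by rewrite ler_pdivrMr.
subst q; rewrite mulr0.
have [p0|p0] := eqVneq p 0; first by rewrite p0 expr0n.
have := H ((e + 1) / (2 * p)).
have -> : 2 * ((e + 1) / (2 * p)) * p - ((e + 1) / (2 * p)) ^+ 2 * 0 = e + 1.
  by field.
lra.
Qed.

Lemma semi_inner_CS x y : P x -> P y -> B x y ^+ 2 <= B x x * B y y.
Proof.
move=> Px Py; apply: discriminant_le; [exact: B_ge0|exact: B_ge0|move=> t].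
have := B_ge0 (semi_closedB Px (PZ t Py)).
rewrite semi_inner_normB//; last exact: PZ.
rewrite (BC x) !BZl// ?[B y (t *: y)]BC ?BZl//; last exact: PZ.
by rewrite (BC y x) => h; nra.
Qed.

(* Minimise B x x - 2 l x over S; at an almost minimiser the first variation is
   almost zero. *)
Lemma approx_riesz (S : V -> Prop) (l : V -> R) (M : R) :
  S 0 -> (forall x y, S x -> S y -> S (x + y)) ->
  (forall a x, S x -> S (a *: x)) -> (forall x, S x -> P x) ->
  (forall x y, S x -> S y -> l (x + y) = l x + l y) ->
  (forall a x, S x -> l (a *: x) = a * l x) ->
  (forall x, S x -> l x ^+ 2 <= M * B x x) ->
  exists p : nat -> V, (forall k, S (p k)) /\
    forall k x, S x -> (B (p k) x - l x) ^+ 2 <= k.+1%:R^-1 * B x x.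
Proof.
move=> S0 SD SZ SP lD lZ lM.
have M0 : exists2 M', 0 <= M' & forall x, S x -> l x ^+ 2 <= M' * B x x.
  exists (Num.max M 0); first by rewrite le_max lexx orbT.
  move=> x Sx; apply: (le_trans (lM _ Sx)); apply: ler_wpM2r.
    by apply: B_ge0; exact: SP.
  by rewrite le_max lexx.
have {lM M0}[M' M0 lM] := M0.
pose J x := B x x - 2 * l x.
pose A := [set J x | x in S].
(* By AM-GM, [2 * l x] is at most twice the square root of [M' * B x x], hence at most
   [B x x + M']. *)
have JM x : S x -> - M' <= J x.
  move=> Sx; rewrite /J.
  have := lM _ Sx; have := B_ge0 (SP _ Sx); set b := B x x; set c := l x.
  move=> b0 cb; have [c0|c0] := leP c 0; first lra.
  have [?|?] := leP (2 * c) (b + M'); first lra.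
  have : (b + M') ^+ 2 < (2 * c) ^+ 2 by rewrite ltr_pXn2r// ?nnegrE; lra.
  have := sqr_ge0 (b - M'); nra.
have hinfA : has_inf A.
  split; first by exists (J 0), 0.
  by exists (- M') => _ [x Sx <-]; exact: JM.
have exk (k : nat) : exists x, S x /\ J x < inf A + k.+1%:R^-1.
  have k0 : 0 < k.+1%:R^-1 :> R by rewrite invr_gt0 ltr0n.
  by have [_ [x Sx <-] xlt] := inf_adherent k0 hinfA; exists x.
have [p pP] := choice exk.
exists p; split=> [k|k x Sx]; first by have [] := pP k.
have [Spk Jpk] := pP k.
apply: discriminant_le; [exact/B_ge0/SP|by rewrite invr_ge0|move=> t].
have Stx : S (p k - t *: x) by rewrite -scaleNr; apply: SD => //; exact: SZ.
have : inf A <= J (p k - t *: x) by apply: ge_inf; [exact: hinfA.2|exists (p k - t *: x)].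
have Px := SP _ Sx; have Ppk := SP _ Spk.
rewrite /J semi_inner_normB//; last exact: PZ.
have -> : l (p k - t *: x) = l (p k) - t * l x.
  by rewrite -[- (t *: x)]scaleNr lD ?lZ ?mulNr//; exact: SZ.
rewrite (BC (p k) (t *: x)) !BZl// ?[B x (t *: x)]BC ?BZl//; last exact: PZ.
move: Jpk; rewrite /J (BC x (p k)).
move: (k.+1%:R^-1) (inf A) (B x x) (B (p k) x) (B (p k) (p k)) (l x) (l (p k)).
by move=> e i bxx bpx bpp lx lp h1 h2; lra.
Qed.

(** Completeness is asked only from here on. [approx_riesz] yields representers up to a small error
    on any subspace, and is used below on subspaces that may be incomplete. *)
Hypothesis complete : forall u : nat -> V, (forall i, P (u i)) ->
  (forall e : R, 0 < e -> exists N, forall i j, (N <= i)%N -> (N <= j)%N ->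
     B (u i - u j) (u i - u j) <= e) ->
  exists2 w, P w & forall e : R, 0 < e -> exists N, forall i, (N <= i)%N ->
     B (u i - w) (u i - w) <= e.

Lemma sqr_le_norm (a b : R) : 0 <= b -> a ^+ 2 <= b ^+ 2 -> `|a| <= b.
Proof.
by move=> b0 ab; rewrite -(ger0_norm b0) -ler_sqr ?nnegrE// !real_normK ?num_real.
Qed.

(** The almost representers [p k] are Cauchy. Testing [p i] and [p j] on their difference, of
    squared norm [b], gives [b ^+ 2 <= 4 * q * b] with [q = N.+1%:R^-1], whence the factor 4
    below. *)
Lemma riesz (l : V -> R) (M : R) : P 0 ->
  (forall x y, P x -> P y -> l (x + y) = l x + l y) ->
  (forall a x, P x -> l (a *: x) = a * l x) ->
  (forall x, P x -> l x ^+ 2 <= M * B x x) ->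
  exists2 w, P w & forall x, P x -> B w x = l x.
Proof.
move=> P0 lD lZ lM.
have [p [Sp pP]] := approx_riesz P0 PD PZ (fun _ h => h) lD lZ lM.
have [] := complete Sp.
  move=> e e0; have [N Ne] : exists N : nat, 4 * N.+1%:R^-1 <= e.
    exists (Num.truncn (4 / e)); rewrite ler_pdivrMr ?ltr0n// mulrC -ler_pdivrMr//.
    exact/ltW/truncnS_gt.
  exists N => i j Ni Nj; apply: le_trans Ne.
  have Pij := semi_closedB (Sp i) (Sp j).
  have Hk k : (N <= k)%N -> (B (p k) (p i - p j) - l (p i - p j)) ^+ 2 <=
      N.+1%:R^-1 * B (p i - p j) (p i - p j).
    move=> Nk; apply: (le_trans (pP _ _ Pij)); apply: ler_wpM2r; first exact: B_ge0.
    by rewrite lef_pV2 ?posrE ?ltr0n// ler_nat.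
  have := Hk _ Ni; have := Hk _ Nj.
  have -> : B (p i) (p i - p j) = B (p j) (p i - p j) + B (p i - p j) (p i - p j).
    by rewrite (semi_innerBl (Sp i) (Sp j) Pij); ring.
  have := B_ge0 Pij.
  set b := B (p i - p j) (p i - p j); set c := l _; set d := B _ _.
  have : 0 < N.+1%:R^-1 :> R by rewrite invr_gt0 ltr0n.
  set q := N.+1%:R^-1 => q0 b0 h1 h2 {Pij Ni Nj Hk}.
  have [->|bn] := eqVneq b 0; first lra.
  have bp : 0 < b by rewrite lt_neqAle eq_sym bn.
  rewrite -(ler_pM2r bp).
  have := sqr_ge0 ((d + b - c) + (d - c)); nra.
move=> w Pw wP; exists w => // x Px.
apply/eqP; rewrite -subr_eq0 -normr_le0; apply/ler_addgt0Pl => e e0; rewrite addr0.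
(* The form may vanish on nonzero vectors. On these the estimate for [p k] is exact, and
   Cauchy-Schwarz shows that [w] pairs with [x] as [p 0] does. *)
have [b0|b0] := eqVneq (B x x) 0.
  have h k : B (p k) x = l x.
    have := pP k _ Px; rewrite b0 mulr0 => h; apply/eqP; rewrite -subr_eq0.
    by rewrite -sqrf_eq0 eq_le h sqr_ge0.
  rewrite -(h 0%N) -normrN opprB -semi_innerBl//.
  rewrite (_ : B _ x = 0) ?normr0; first exact: ltW.
  apply/eqP; rewrite -sqrf_eq0 eq_le sqr_ge0 andbT.
  by rewrite (le_trans (semi_inner_CS _ Px))// ?b0 ?mulr0//; exact: semi_closedB.
have bp : 0 < B x x by rewrite lt_neqAle eq_sym b0 B_ge0.
pose d := (e / 2) ^+ 2 / B x x.
have d0 : 0 < d by rewrite divr_gt0// exprn_gt0// divr_gt0.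
have [N1 h1] := wP _ d0.
have [N2 h2] : exists N : nat, N.+1%:R^-1 <= d.
  exists (Num.truncn d^-1); rewrite -[leRHS]invrK lef_pV2 ?posrE ?invr_gt0//.
  exact/ltW/truncnS_gt.
pose k := maxn N1 N2.
have l1 : `|B (p k) x - l x| <= e / 2.
  apply: sqr_le_norm; first by rewrite divr_ge0// ltW.
  apply: (le_trans (pP k _ Px)); rewrite -ler_pdivlMr//; apply: le_trans h2.
  by rewrite lef_pV2 ?posrE ?ltr0n// ler_nat ltnS leq_maxr.
have l2 : `|B (p k) x - B w x| <= e / 2.
  rewrite -semi_innerBl//; apply: sqr_le_norm; first by rewrite divr_ge0// ltW.
  apply: (le_trans (semi_inner_CS (semi_closedB (Sp k) Pw) Px)).
  by rewrite -ler_pdivlMr//; apply: h1; rewrite leq_maxl.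
have -> : B w x - l x = (B (p k) x - l x) - (B (p k) x - B w x) by ring.
by rewrite (le_trans (ler_normB _ _))// [leRHS](splitr e) lerD.
Qed.

(** An ultrafilter finer than [\oo] yields the limits of [B (u i) v] for all [v] at once, and Riesz
    turns them into [w]. A subsequence is then chosen so as to converge against the countably many
    [u j] only, hence against the subspace [S] of good test vectors, which contains them. A general
    [v] is replaced by an almost orthogonal projection to [S], with an error that is uniform over
    the sequence. *)
Lemma weak_seq_compact (u : nat -> V) (M : R) : P 0 ->
  (forall i, P (u i)) -> (forall i, B (u i) (u i) <= M) ->
  exists s : nat -> nat, {homo s : i j / (i < j)%N} /\
    exists2 w, P w & forall v, P v ->
      (fun i => B (u (s i)) v) @ \oo --> B w v.
Proof.
move=> P0 Pu uM.
have M0 : 0 <= M := le_trans (B_ge0 (Pu 0%N)) (uM 0%N).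
have [G [UG ooG]] := @ultraFilterLemma nat \oo _.
have PG : ProperFilter G by exact: ultra_proper.
have ub v i : P v -> B (u i) v ^+ 2 <= M * B v v.
  move=> Pv; apply: (le_trans (semi_inner_CS (Pu i) Pv)).
  by apply: ler_wpM2r => //; exact: B_ge0.
have lim_ex v : exists l : R, P v -> (fun i => B (u i) v) @ G --> l.
  have [Pv|nPv] := pselect (P v); last by exists 0.
  pose b := M * B v v + 1.
  have GI : G [set i | `[- b, b]%classic (B (u i) v)].
    apply: filterS (@filterT _ G _) => i _ /=.
    rewrite in_itv/= -ler_norml; apply: sqr_le_norm.
      by rewrite addr_ge0// mulr_ge0// B_ge0.
    apply: (le_trans (ub v i Pv)); rewrite /b.
    have : 0 <= M * B v v by rewrite mulr_ge0// B_ge0.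
    nra.
  have UI : UltraFilter ((fun i => B (u i) v) @ G).
    split; first exact: fmap_proper_filter.
    move=> F FF GF; apply/seteqP; split => // A FA.
    have [//|GA] := in_ultra_setVsetC ((fun i => B (u i) v) @^-1` A) UG.
    have := GF (~` A) GA => FnA.
    have F0 := filterI FA FnA; rewrite setICr in F0.
    by case: (@filter_not_empty _ F _ (F0 _)).
  have := @segment_compact R (- b) b; rewrite compact_ultra => /(_ _ UI GI).
  by move=> [l [_ hl]]; exists l.
have [l lP] := choice lim_ex.
have hcvg v (Pv : P v) := lP v Pv.
have lD x y : P x -> P y -> l (x + y) = l x + l y.
  move=> Px Py; apply: (@cvgr_fmap_unique _ _ G _ (fun i => B (u i) (x + y))) => //.
    by apply: hcvg; exact: PD.
  have -> : (fun i => B (u i) (x + y)) = (fun i => B (u i) x + B (u i) y).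
    by apply/funext => i; rewrite BC BDl// !(BC (u i)).
  by apply: cvgD; exact: hcvg.
have lZ a x : P x -> l (a *: x) = a * l x.
  move=> Px; apply: (@cvgr_fmap_unique _ _ G _ (fun i => B (u i) (a *: x))) => //.
    by apply: hcvg; exact: PZ.
  have -> : (fun i => B (u i) (a *: x)) = (fun i => a * B (u i) x).
    by apply/funext => i; rewrite BC BZl// BC.
  by apply: cvgM; [exact: cvg_cst|exact: hcvg].
have lM x : P x -> l x ^+ 2 <= M * B x x.
  move=> Px; have c2 : (fun i => B (u i) x ^+ 2) @ G --> l x ^+ 2.
    by apply: cvgM; exact: hcvg.
  by apply: (cvgr_le_cst c2) => i; exact: ub.
have [w Pw wP] := riesz P0 lD lZ lM.
(* Along the ultrafilter, finitely many closeness conditions and [n < m] hold simultaneously for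
   some [m]. *)
have step (i n : nat) : exists m : nat, (n < m)%N /\
    forall j, (j <= i)%N -> `|B (u m) (u j) - l (u j)| < i.+1%:R^-1.
  have H k : G [set m | forall j, (j < k)%N -> `|B (u m) (u j) - l (u j)| < i.+1%:R^-1].
    elim: k => [|k IH]; first exact: filterS (@filterT _ G _).
    have : \forall m \near G, `|l (u k) - B (u m) (u k)| < i.+1%:R^-1.
      by move: (hcvg _ (Pu k)) => /cvgr_dist_lt; apply; rewrite invr_gt0.
    apply: filterS2 IH => m IH /= hk j; rewrite ltnS leq_eqVlt => /orP[/eqP ->|].
      by rewrite distrC.
    exact: IH.
  have G2 : G [set m | (n < m)%N] by apply: ooG; exists n.+1.
  have [m [h1 h2]] := filter_ex (filterI (H i.+1) G2).
  by exists m; split=> // j ji; exact: h1.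
have step' (q : nat * nat) : exists m : nat, (q.2 < m)%N /\
    forall j, (j <= q.1)%N -> `|B (u m) (u j) - l (u j)| < q.1.+1%:R^-1.
  exact: step.
have [f fP] := choice step'.
pose s := fix s i := match i with 0%N => f (0%N, 0%N) | i'.+1 => f (i'.+1, s i') end.
have sP i j : (j <= i)%N -> `|B (u (s i)) (u j) - l (u j)| < i.+1%:R^-1.
  by case: i => [|i] ji; apply: (fP (_, _)).2.
have smono i : (s i < s i.+1)%N by exact: (fP (i.+1, s i)).1.
exists s; split; first by apply: homo_ltn => //; exact: ltn_trans.
exists w => // v Pv.
pose S x := P x /\ (fun i => B (u (s i)) x) @ \oo --> B w x.
have S0 : S 0.
  split=> //; have z y : P y -> B y 0 = 0.
    by move=> Py; rewrite BC -(scale0r 0) BZl// mul0r.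
  by rewrite z// (_ : (fun _ => _) = cst 0); [exact: cvg_cst|apply/funext => i; rewrite z].
have SD x y : S x -> S y -> S (x + y).
  move=> [Px xc] [Py yc]; split; first exact: PD.
  rewrite BC BDl// !(BC _ w).
  have -> : (fun i => B (u (s i)) (x + y)) = (fun i => B (u (s i)) x + B (u (s i)) y).
    by apply/funext => i; rewrite BC BDl// !(BC (u _)).
  exact: cvgD.
have SZ a x : S x -> S (a *: x).
  move=> [Px xc]; split; first exact: PZ.
  rewrite BC BZl// (BC _ w).
  have -> : (fun i => B (u (s i)) (a *: x)) = (fun i => a * B (u (s i)) x).
    by apply/funext => i; rewrite BC BZl// BC.
  by apply: cvgM => //; exact: cvg_cst.
have Su j : S (u j).
  split=> //; rewrite wP//; apply/cvgrPdist_lt => e e0.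
  exists (maxn j (Num.truncn e^-1)) => // i /=; rewrite geq_max => /andP[ji ei].
  rewrite distrC (lt_le_trans (sP i j ji))// -[leRHS]invrK lef_pV2 ?posrE ?invr_gt0//.
  apply: (le_trans (ltW (truncnS_gt _))); by rewrite ler_nat ltnS.
(* This is [approx_riesz] for the functional [B v] on [S]: the difference [p k - v] is almost
   orthogonal to [S], in particular to every [u i]. *)
have [p [Sp pP]] : exists p : nat -> V, (forall k, S (p k)) /\
    forall k x, S x -> (B (p k) x - B v x) ^+ 2 <= k.+1%:R^-1 * B x x.
  apply: (@approx_riesz S (B v) (B v v)) => //.
  - by move=> x [].
  - by move=> x y [Px _] [Py _]; rewrite BC BDl// !(BC _ v).
  - by move=> a x [Px _]; rewrite BC BZl// BC.
  - by move=> x [Px _]; exact: semi_inner_CS.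
have Pp k : P (p k) by have [] := Sp k.
have bnd k i : (B (u i) (p k - v)) ^+ 2 <= k.+1%:R^-1 * M.
  rewrite BC semi_innerBl//; apply: (le_trans (pP _ _ (Su i))).
  by apply: ler_wpM2l.
have bndw k : (B w (p k - v)) ^+ 2 <= k.+1%:R^-1 * M.
  have Pkv := semi_closedB (Pp k) Pv.
  rewrite wP//; have c2 : (fun i => B (u i) (p k - v) ^+ 2) @ G --> l (p k - v) ^+ 2.
    by apply: cvgM; exact: hcvg.
  by apply: (cvgr_le_cst c2) => i; exact: bnd.
apply/cvgrPdist_le => e e0.
have [k hk] : exists k : nat, k.+1%:R^-1 * M <= (e / 3) ^+ 2.
  exists (Num.truncn (M / (e / 3) ^+ 2)); rewrite mulrC ler_pdivrMr ?ltr0n//.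
  rewrite mulrC -ler_pdivrMr; last by rewrite exprn_gt0// divr_gt0.
  exact/ltW/truncnS_gt.
have e3 : 0 <= e / 3 by rewrite divr_ge0// ltW.
have c1 : `|B w (p k - v)| <= e / 3.
  by apply: sqr_le_norm => //; exact: le_trans hk.
have e3' : 0 < e / 3 by rewrite divr_gt0.
have [_ /cvgrPdist_le/(_ _ e3')] := Sp k.
apply: filterS => i hi.
have c2 : `|B (u (s i)) (p k - v)| <= e / 3.
  by apply: sqr_le_norm => //; exact: le_trans hk.
have E x : P x -> B x (p k - v) = B x (p k) - B x v.
  by move=> Px; rewrite BC semi_innerBl// !(BC _ x).
have -> : B w v - B (u (s i)) v = (B w (p k) - B (u (s i)) (p k)) -
   B w (p k - v) + B (u (s i)) (p k - v) by rewrite !E//; ring.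
apply: (le_trans (ler_normD _ _)); have -> : e = e / 3 + e / 3 + e / 3 by field.
by rewrite lerD// (le_trans (ler_normB _ _))// lerD.
Qed.

End SemiInner.

(** * Square-integrable functions *)

Section RealIntegral.
Context d (X : measurableType d) (R : realType).
Variable mu : {measure set X -> \bar R}.
Implicit Types f g : X -> R.

Local Notation intble f := (mu.-integrable setT (EFin \o f)).

Lemma EFin_Rintegral f : intble f ->
  (\int[mu]_x (f x)%:E)%E = (\int[mu]_x f x)%:E.
Proof. by move=> fi; rewrite fineK//; exact: integrable_fin_num. Qed.

Lemma intble_measurable f : intble f -> measurable_fun setT f.
Proof. by move=> /measurable_int/measurable_EFinP. Qed.

Lemma ge0_intble f : measurable_fun setT f -> (forall x, 0 <= f x) ->
  (\int[mu]_x (f x)%:E < +oo)%E -> intble f.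
Proof.
move=> mf f0 foo; apply/integrableP; split; first exact/measurable_EFinP.
by under eq_integral do rewrite /= ger0_norm//.
Qed.

Lemma Rintegral_ae f g : measurable_fun setT f -> measurable_fun setT g ->
  {ae mu, forall x, f x = g x} -> \int[mu]_x f x = \int[mu]_x g x.
Proof.
move=> mf mg fg; rewrite /Rintegral (ae_eq_integral (EFin \o g))//.
- exact/measurable_EFinP.
- exact/measurable_EFinP.
- by apply: filterS fg => x /= -> _.
Qed.

Lemma intble_dom f g : measurable_fun setT f -> intble g ->
  (forall x, `|f x| <= g x) -> intble f.
Proof.
move=> mf ig fg; apply: le_integrable ig => //; first exact/measurable_EFinP.
by move=> x _ /=; rewrite lee_fin (le_trans (fg x))// ler_norm.
Qed.

Lemma intble_ae f g : measurable_fun setT f -> intble g ->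
  {ae mu, forall x, f x = g x} -> intble f.
Proof.
move=> mf ig fg; apply/integrableP; split; first exact/measurable_EFinP.
have /integrableP[mg goo] := ig.
rewrite (ge0_ae_eq_integral (g := fun x => `|(g x)%:E|%E))//.
- by do 2 apply: measurableT_comp => //; exact/measurable_EFinP.
- exact: measurableT_comp.
- by apply: filterS fg => x /= -> _.
Qed.

Lemma intbleD f g : intble f -> intble g -> intble (fun x => f x + g x).
Proof. by move=> fi gi; exact: (integrableD measurableT fi gi). Qed.

Lemma intbleB f g : intble f -> intble g -> intble (fun x => f x - g x).
Proof. by move=> fi gi; exact: (integrableB measurableT fi gi). Qed.

Lemma intbleZ a f : intble f -> intble (fun x => a * f x).
Proof. by move=> fi; exact: (integrableZl measurableT a fi). Qed.

Lemma Rintegral_dct (f_ : nat -> X -> R) f g :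
  (forall n, measurable_fun setT (f_ n)) -> measurable_fun setT f -> intble g ->
  {ae mu, forall x, (fun n => f_ n x) @ \oo --> f x} ->
  {ae mu, forall x n, `|f_ n x| <= g x} ->
  (fun n => \int[mu]_x f_ n x) @ \oo --> \int[mu]_x f x.
Proof.
move=> mf_ mf ig fc fg.
have [|||||/= h1 _ h3] := @dominated_convergence _ _ _ mu setT measurableT
   (fun n => EFin \o f_ n) (EFin \o f) (EFin \o g).
- by move=> n; exact/measurable_EFinP.
- exact/measurable_EFinP.
- by apply: filterS fc => x /= h _; apply/cvg_EFin; [exact: nearW|exact: h].
- exact: ig.
- by apply: filterS fg => x h n _ /=; rewrite lee_fin.
by apply: fine_cvg; rewrite -EFin_Rintegral//; exact: h3.
Qed.

End RealIntegral.

Notation intble mu f := (integrable mu setT (EFin \o f)).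

Section SquareIntegrable.
Context d (X : measurableType d) (R : realType).
Variable mu : {measure set X -> \bar R}.
Hypothesis mu_fin : (mu setT < +oo)%E.
Implicit Types f g h : X -> R.

Definition sqint f := measurable_fun setT f /\ intble mu (fun x => f x ^+ 2).

Definition ip f g := \int[mu]_x (f x * g x).

Lemma intble_cst (a : R) : intble mu (fun=> a).
Proof.
apply: measurable_bounded_integrable => //.
by exists `|a|; split => // M aM x _ /=; exact: ltW.
Qed.

Lemma bounded_intble f (M : R) : measurable_fun setT f ->
  (forall x, `|f x| <= M) -> intble mu f.
Proof. by move=> mf fM; apply: (intble_dom mf (intble_cst M)). Qed.

Lemma sqintM f g : sqint f -> sqint g -> intble mu (fun x => f x * g x).
Proof.
move=> [mf fi] [mg gi]; apply: intble_dom (intbleD fi gi) _.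
  exact: measurable_funM.
move=> x; rewrite normrM.
rewrite -[f x ^+ 2]real_normK ?num_real// -[g x ^+ 2]real_normK ?num_real//.
have := sqr_ge0 (`|f x| - `|g x|).
have := normr_ge0 (f x); have := normr_ge0 (g x).
move: `|f x| `|g x| => a b; nra.
Qed.

Lemma sqint_bounded f (M : R) : measurable_fun setT f ->
  (forall x, `|f x| <= M) -> sqint f.
Proof.
move=> mf fM; split=> //; apply: (@bounded_intble _ (M ^+ 2)).
  exact: measurable_funX.
by move=> x; rewrite normrX ler_sqr ?nnegrE//; exact: le_trans (fM x).
Qed.

Lemma sqint_cst (a : R) : sqint (fun=> a).
Proof. exact: (@sqint_bounded _ `|a|). Qed.

Lemma sqint_intble f : sqint f -> intble mu f.
Proof.
move=> sf; have := sqintM sf (sqint_cst 1).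
by apply: eq_integrable => // x _ /=; rewrite mulr1.
Qed.

Lemma sqintD f g : sqint f -> sqint g -> sqint (f + g).
Proof.
move=> sf sg; have [mf fi] := sf; have [mg gi] := sg.
have fg := intbleZ 2 (sqintM sf sg).
split; first exact: measurable_funD.
have := intbleD (intbleD fi gi) fg.
by apply: eq_integrable => // x _ /=; congr EFin; rewrite !fctE; ring.
Qed.

Lemma sqintZ a f : sqint f -> sqint (a *: f).
Proof.
move=> [mf fi]; split; first exact: measurable_funM.
have := intbleZ (a ^+ 2) fi.
by apply: eq_integrable => // x _ /=; congr EFin; rewrite !fctE exprMn.
Qed.

Lemma sqintB f g : sqint f -> sqint g -> sqint (f - g).
Proof. by move=> sf sg; rewrite -scaleN1r; apply/sqintD/sqintZ. Qed.

Lemma sqint_dom f g : measurable_fun setT f -> sqint g ->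
  (forall x, `|f x| <= `|g x|) -> sqint f.
Proof.
move=> mf [mg gi] fg; split => //; apply: intble_dom gi _.
  exact: measurable_funX.
by move=> x; rewrite normrX -[leRHS]real_normK ?num_real// ler_sqr ?nnegrE.
Qed.

Lemma sqint_norm f : sqint f -> sqint (fun x => `|f x|).
Proof.
move=> sf; apply: (sqint_dom _ sf); last by move=> x; rewrite normr_id.
by apply: measurableT_comp => //; exact: sf.1.
Qed.

Lemma ipC f g : ip f g = ip g f.
Proof. by apply: eq_Rintegral => x _; rewrite mulrC. Qed.

Lemma ipDl f g h : sqint f -> sqint g -> sqint h ->
  ip (f + g) h = ip f h + ip g h.
Proof.
move=> sf sg sh; rewrite /ip -RintegralD//; [|exact: sqintM|exact: sqintM].
by apply: eq_Rintegral => x _; rewrite !fctE mulrDl.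
Qed.

Lemma ipZl a f h : sqint f -> sqint h -> ip (a *: f) h = a * ip f h.
Proof.
move=> sf sh; rewrite /ip -RintegralZl//; last exact: sqintM.
by apply: eq_Rintegral => x _; rewrite !fctE mulrA.
Qed.

Lemma ip_ge0 f : sqint f -> 0 <= ip f f.
Proof. by move=> sf; apply: Rintegral_ge0 => x _; rewrite -expr2 sqr_ge0. Qed.

Lemma ipBl f g h : sqint f -> sqint g -> sqint h ->
  ip (f - g) h = ip f h - ip g h.
Proof. exact: (semi_innerBl sqintZ ipDl ipZl). Qed.

Lemma ip_CS f g : sqint f -> sqint g -> ip f g ^+ 2 <= ip f f * ip g g.
Proof. exact: (semi_inner_CS sqintD sqintZ ipC ipDl ipZl ip_ge0). Qed.

Lemma ipE f : sqint f ->
  (\int[mu]_x ((f x) ^+ 2)%:E)%E = (ip f f)%:E.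
Proof.
by move=> [mf fi]; rewrite EFin_Rintegral.
Qed.

Lemma ip_ae f f' g g' : measurable_fun setT f -> measurable_fun setT f' ->
  measurable_fun setT g -> measurable_fun setT g' ->
  {ae mu, forall x, f x = f' x} -> {ae mu, forall x, g x = g' x} ->
  ip f g = ip f' g'.
Proof.
move=> mf mf' mg mg' ff' gg'; apply: Rintegral_ae; try exact: measurable_funM.
by apply: filterS2 ff' gg' => x -> ->.
Qed.

Lemma sqint_ae f g : measurable_fun setT f -> sqint g ->
  {ae mu, forall x, f x = g x} -> sqint f.
Proof.
move=> mf [mg gi] fg; split=> //; apply: intble_ae gi _.
  exact: measurable_funX.
by apply: filterS fg => x ->.
Qed.

(** Below [q] is [2 ^+ k], so that increments of squared L^2 norm at most [4^-1 ^+ k] get L^1 norms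
    bounded by a convergent geometric series. *)
Lemma abs_amgm (q a : R) : 0 < q -> `|a| <= q * a ^+ 2 + q^-1.
Proof.
move=> q0; rewrite -[a ^+ 2]real_normK ?num_real//.
have qi : 0 < q^-1 by rewrite invr_gt0.
have qq : q * q^-1 = 1 by rewrite mulfV// gt_eqF.
have := sqr_ge0 (q * `|a| - 1); have := normr_ge0 a.
move: `|a| => b b0 h; rewrite -(ler_pM2l q0).
rewrite mulrDr qq; nra.
Qed.

Lemma limn_einf_le (u : nat -> \bar R) (l : \bar R) N :
  (forall k, (N <= k)%N -> (u k <= l)%E) -> (limn_einf u <= l)%E.
Proof.
move=> ul; rewrite limn_einf_lim; apply: lime_le; first exact: is_cvg_einfs.
exists N => // k /= Nk; apply: le_trans (ul _ Nk).
by apply: ereal_inf_lbound; exists k => //=.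
Qed.

(* A rapidly Cauchy subsequence converges a.e. since the series of its
   increments is dominated in L^1; Fatou's lemma identifies the limit. *)
Lemma sqint_complete (u : nat -> X -> R) : (forall i, sqint (u i)) ->
  (forall e : R, 0 < e -> exists N, forall i j, (N <= i)%N -> (N <= j)%N ->
     ip (u i - u j) (u i - u j) <= e) ->
  exists2 w, sqint w & forall e : R, 0 < e -> exists N, forall i, (N <= i)%N ->
     ip (u i - w) (u i - w) <= e.
Proof.
move=> su uC.
have NC (k : nat) : exists N : nat, forall i j, (N <= i)%N -> (N <= j)%N ->
    ip (u i - u j) (u i - u j) <= 4^-1 ^+ k.
  by apply: uC; rewrite exprn_gt0.
have [N NP] := choice NC.
(* Cumulating the [N j + 1] gives increasing indices with both [N k <= m k] and [k <= m k]. *)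
pose m k := (\sum_(j < k.+1) (N j + 1))%N.
have mS k : m k.+1 = (m k + (N k.+1 + 1))%N by rewrite /m big_ord_recr.
have mN k : (N k <= m k)%N.
  by rewrite /m big_ord_recr/= addnA addn1 (leq_trans (leq_addl _ _) (leqnSn _)).
have mk k : (k <= m k)%N by elim: k => // k IH; rewrite mS addn1 addnS ltnS (leq_trans IH)// leq_addr.
have mm k l : (k <= l)%N -> (m k <= m l)%N.
  move=> /subnK <-; elim: (l - k)%N => // i IH.
  by rewrite addSn mS (leq_trans IH)// leq_addr.
pose D k := u (m k.+1) - u (m k).
have sD k : sqint (D k) by exact: sqintB.
have mD k : measurable_fun setT (D k) by have [] := sD k.
have D2 k : ip (D k) (D k) <= 4^-1 ^+ k.
  by apply: NP => //; rewrite (leq_trans (mN k))// mm.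
pose K := fine (mu setT).
have K0 : 0 <= K by exact: fine_ge0.
have muK : mu setT = K%:E by rewrite fineK// ge0_fin_numE.
have D1 k : (\int[mu]_x `|D k x|%:E <= ((1 + K) / 2 ^+ k)%:E)%E.
  have iD := intble_dom (mD k) (sqint_intble (sqint_norm (sD k))) (fun=> lexx _).
  rewrite (EFin_Rintegral (sqint_intble (sqint_norm (sD k)))) lee_fin.
  have q0 : 0 < 2 ^+ k :> R by rewrite exprn_gt0.
  have i2 : intble mu (fun x => 2 ^+ k * (D k x) ^+ 2 + (2 ^+ k)^-1).
    apply: intbleD (intble_cst _); apply: intbleZ; exact: (sD k).2.
  apply: (@le_trans _ _ (\int[mu]_x (2 ^+ k * (D k x) ^+ 2 + (2 ^+ k)^-1))).
    apply: le_Rintegral => //; first exact: sqint_intble (sqint_norm (sD k)).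
    by move=> x _; exact: abs_amgm.
  rewrite RintegralD//; [|by apply: intbleZ; exact: (sD k).2|exact: intble_cst].
  rewrite RintegralZl//; last exact: (sD k).2.
  rewrite Rintegral_cst// -/K.
  have -> : \int[mu]_x D k x ^+ 2 = ip (D k) (D k).
    by apply: eq_Rintegral => x _; rewrite expr2.
  have h := D2 k; rewrite mulrDl mul1r; apply: lerD; last by rewrite mulrC.
  rewrite -ler_pdivlMl// (le_trans h)//.
  by rewrite -invfM -exprMn exprVn (_ : 2 * 2 = 4 :> R)//; ring.
pose g x : \bar R := (\sum_(0 <= k <oo) `|D k x|%:E)%E.
have mabsD k : measurable_fun setT (fun x => `|D k x|%:E).
  by apply/measurable_EFinP; apply: measurableT_comp => //; exact: mD.
have goo : (\int[mu]_x g x < +oo)%E.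
  rewrite integral_nneseries//.
  apply: (@le_lt_trans _ _ (\sum_(0 <= k <oo) ((2 * (1 + K)) / (2 ^ (k + 1))%:R)%:E)%E).
    apply: lee_nneseries => [k *|k *]; first exact: integral_ge0.
    apply: (le_trans (D1 k)).
    rewrite lee_fin addn1 expnS natrM natrX invfM mulrACA divff// mul1r //.
  have /cvg_lim -> // := @cvg_geometric_eseries_half R (2 * (1 + K)) 0%N.
  by rewrite ltry.
have gfin : {ae mu, forall x, g x \is a fin_num}.
  have : mu.-integrable setT g.
    apply/integrableP; split; first exact: ge0_emeasurable_sum.
    by under eq_integral do rewrite gee0_abs ?nneseries_ge0//.
  by move=> /(integrable_ae measurableT); apply: filterS => x; apply.
have ucvg : {ae mu, forall x, cvgn (fun k => u (m k) x)}.
  apply: filterS gfin => x gx.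
  have c1 : cvgn (series (fun k => `|D k x|)).
    apply: nondecreasing_is_cvgn.
      apply/nondecreasing_seqP => k; rewrite !seriesEnat/= big_nat_recr//=.
      by rewrite lerDl.
    exists (fine (g x)) => _ [k _ <-].
    rewrite -lee_fin fineK//.
    by rewrite seriesEnat/= -sumEFin; apply: nneseries_lim_ge => // *.
  have : cvgn (series (telescope (fun k => u (m k) x))).
    by apply: normed_cvg; exact: c1.
  move=> h; have -> : (fun k => u (m k) x) =
      (fun k => u (m 0%N) x + series (telescope (fun k => u (m k) x)) k).
    by apply/funext => k; rewrite (eq_sum_telescope (fun k => u (m k) x) k).
  by apply: is_cvgD => //; exact: is_cvg_cst.
(* The upper limit is measurable on the whole space, including the null set where the subsequence
   does not converge; [fine] gives a real value there. *)
pose w x := fine (limn_esup (fun k => (u (m k) x)%:E)).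
have mu_ k : measurable_fun setT (u k) by have [] := su k.
have mw : measurable_fun setT w.
  apply: measurableT_comp => //; apply: measurable_fun_limn_esup => k.
  exact/measurable_EFinP.
have uw : {ae mu, forall x, (fun k => u (m k) x) @ \oo --> w x}.
  apply: filterS ucvg => x /cvg_ex[/= l ul].
  rewrite /w; have -> : limn_esup (fun k => (u (m k) x)%:E) = l%:E.
    by apply: (cvg_limn_einf_sup _).2; apply/cvg_EFin => //; exact: nearW.
  exact: ul.
have key i e : (forall j, (i <= j)%N -> ip (u i - u j) (u i - u j) <= e) ->
    sqint (u i - w) /\ ip (u i - w) (u i - w) <= e.
  move=> he.
  have muw : measurable_fun setT (fun x => u i x - w x) by exact: measurable_funB.
  have mu2 j : measurable_fun setT (fun x => ((u i x - u j x) ^+ 2)%:E).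
    by apply/measurable_EFinP; apply: measurable_funX; exact: measurable_funB.
  have F : (\int[mu]_x ((u i x - w x) ^+ 2)%:E <= e%:E)%E.
    rewrite (ge0_ae_eq_integral
      (g := fun x => limn_einf (fun k => ((u i x - u (m k) x) ^+ 2)%:E)))//.
    - apply: le_trans.
        apply: (@fatou _ _ _ mu setT measurableT (fun k x => ((u i x - u (m k) x) ^+ 2)%:E)) => //.
          by move=> k x _; rewrite lee_fin sqr_ge0.
      apply: (@limn_einf_le _ _ i) => k ik.
      have ->: (\int[mu]_x ((u i x - u (m k) x) ^+ 2)%:E)%E =
          (ip (u i - u (m k)) (u i - u (m k)))%:E.
        by rewrite -ipE//; exact: sqintB.
      by rewrite lee_fin he// (leq_trans ik).
    - by apply/measurable_EFinP; exact: measurable_funX.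
    - have -> : (fun x => limn_einf (fun k => ((u i x - u (m k) x) ^+ 2)%:E)) =
          (fun x => - limn_esup (fun k => (- (u i x - u (m k) x) ^+ 2)%:E))%E.
        by apply/funext => x; rewrite -limn_einfN; congr limn_einf; apply/funext => k /=; rewrite opprK.
      apply: measurableT_comp => //; apply: measurable_fun_limn_esup => k.
      apply/measurable_EFinP; apply: measurableT_comp => //.
      by apply: measurable_funX; exact: measurable_funB.
    - by move=> x _; rewrite lee_fin sqr_ge0.
    - move=> x _; rewrite limn_einf_lim; apply: lime_ge; first exact: is_cvg_einfs.
      by apply: nearW => k; apply: le_ereal_inf_tmp => _ [j _ <-]; rewrite lee_fin sqr_ge0.
    - apply: filterS uw => x ux _ /=; apply/esym; apply: (cvg_limn_einf_sup _).1.
      apply/cvg_EFin; first exact: nearW.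
      by apply: cvgM; apply: cvgB => //; exact: cvg_cst.
  have s1 : sqint (u i - w).
    split; first exact: muw.
    apply: ge0_intble; first exact: measurable_funX.
      by move=> x; exact: sqr_ge0.
    by apply: le_lt_trans F _; rewrite ltry.
  by split=> //; rewrite -lee_fin -ipE.
exists w.
  have [N1 h1] := uC _ ltr01.
  have [] := key N1 1 (fun j hj => h1 _ _ (leqnn _) hj) => s1 _.
  rewrite (_ : w = u N1 - (u N1 - w)); first exact: sqintB.
  by rewrite opprB addrC subrK.
move=> e e0; have [N1 h1] := uC _ e0; exists N1 => i Ni.
by have [] := key i e (fun j hj => h1 _ _ Ni (leq_trans Ni hj)).
Qed.

End SquareIntegrable.

(** * Product measures and integral operators *)

Section IteratedIntegrals.
Context d1 d2 (X : measurableType d1) (Y : measurableType d2) (R : realType).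
Variables (mu : {sigma_finite_measure set X -> \bar R})
          (nu : {sigma_finite_measure set Y -> \bar R}).
Implicit Types f : X * Y -> R.

(** Tonelli makes the integrals of the positive and negative parts measurable in [x]. Composing with
    the measurable [fine] covers also the points where the section is not integrable and the value
    is a default. *)
Lemma measurable_Rintegral_snd f : measurable_fun setT f ->
  measurable_fun setT (fun x => \int[nu]_y f (x, y)).
Proof.
move=> mf; apply: measurableT_comp => //.
have mF : measurable_fun setT (EFin \o f) by exact/measurable_EFinP.
have -> : (fun x => \int[nu]_y (f (x, y))%:E)%E =
  (fun x => \int[nu]_y ((EFin \o f)^\+ (x, y)) - \int[nu]_y ((EFin \o f)^\- (x, y)))%E.
  apply/funext => x; rewrite [LHS]integralE.
  by congr (_ - _)%E; apply: eq_integral => ? _; rewrite ?funeposE ?funenegE.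
apply: emeasurable_funB.
- exact: (@measurable_fun_fubini_tonelli_F _ _ _ _ _ nu _ (measurable_funepos mF)
    (fun z => funepos_ge0 _ z)).
- exact: (@measurable_fun_fubini_tonelli_F _ _ _ _ _ nu _ (measurable_funeneg mF)
    (fun z => funeneg_ge0 _ z)).
Qed.

Lemma measurable_Rintegral_fst f : measurable_fun setT f ->
  measurable_fun setT (fun y => \int[mu]_x f (x, y)).
Proof.
move=> mf; apply: measurableT_comp => //.
have mF : measurable_fun setT (EFin \o f) by exact/measurable_EFinP.
have -> : (fun y => \int[mu]_x (f (x, y))%:E)%E =
  (fun y => \int[mu]_x ((EFin \o f)^\+ (x, y)) - \int[mu]_x ((EFin \o f)^\- (x, y)))%E.
  apply/funext => x; rewrite [LHS]integralE.
  by congr (_ - _)%E; apply: eq_integral => ? _; rewrite ?funeposE ?funenegE.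
apply: emeasurable_funB.
- exact: (@measurable_fun_fubini_tonelli_G _ _ _ _ _ mu _ (measurable_funepos mF)
    (fun z => funepos_ge0 _ z)).
- exact: (@measurable_fun_fubini_tonelli_G _ _ _ _ _ mu _ (measurable_funeneg mF)
    (fun z => funeneg_ge0 _ z)).
Qed.

Lemma intble_section_snd f : intble (mu \x nu)%E f ->
  {ae mu, forall x, intble nu (fun y => f (x, y))}.
Proof. by move=> fi; have := ae_integrable1 fi. Qed.

Lemma intble_section_fst f : intble (mu \x nu)%E f ->
  {ae nu, forall y, intble mu (fun x => f (x, y))}.
Proof. by move=> fi; have := ae_integrable2 fi. Qed.

Lemma RFubini_snd f : intble (mu \x nu)%E f ->
  \int[(mu \x nu)%E]_z f z = \int[mu]_x \int[nu]_y f (x, y).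
Proof.
move=> fi; rewrite /Rintegral -integral12_prod_meas1//; congr fine.
have mf := intble_measurable fi.
apply: ae_eq_integral => //.
- exact: (measurable_fubini_F fi).
- by apply/measurable_EFinP; exact: measurable_Rintegral_snd.
- by apply: filterS (intble_section_snd fi) => x h _; rewrite /fubini_F EFin_Rintegral.
Qed.

Lemma RFubini_fst f : intble (mu \x nu)%E f ->
  \int[(mu \x nu)%E]_z f z = \int[nu]_y \int[mu]_x f (x, y).
Proof.
move=> fi; rewrite /Rintegral -integral21_prod_meas1//; congr fine.
have mf := intble_measurable fi.
apply: ae_eq_integral => //.
- exact: (measurable_fubini_G fi).
- by apply/measurable_EFinP; exact: measurable_Rintegral_fst.
- by apply: filterS (intble_section_fst fi) => x h _; rewrite /fubini_G EFin_Rintegral.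
Qed.

Lemma intble_Rintegral_snd f : intble (mu \x nu)%E f ->
  intble mu (fun x => \int[nu]_y f (x, y)).
Proof.
move=> fi; have mf := intble_measurable fi.
have := integrable_fubini_F fi => /integrableP[mF Foo].
apply/integrableP; split; first by apply/measurable_EFinP; exact: measurable_Rintegral_snd.
rewrite (ge0_ae_eq_integral (g := fun x => `|fubini_F nu (EFin \o f) x|%E))//.
- apply/measurable_EFinP; apply: measurableT_comp => //.
  exact: measurable_Rintegral_snd.
- exact: measurableT_comp.
- apply: filterS (intble_section_snd fi) => x h _.
  by rewrite /fubini_F/= EFin_Rintegral.
Qed.

(** The measures of the sections of a null set integrate to 0, so almost all of them vanish. *)
Lemma ae_prod_section (Q : X * Y -> Prop) : {ae (mu \x nu)%E, forall z, Q z} ->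
  {ae mu, forall x, {ae nu, forall y, Q (x, y)}}.
Proof.
move=> [N [mN N0 QN]].
have : ae_eq mu setT (nu \o xsection N) (cst 0%E).
  apply/ae_eq_integral_abs => //; first exact: measurable_fun_xsection.
  rewrite -[RHS]N0; apply: eq_integral => x _ /=.
  by rewrite gee0_abs.
apply: filterS => x /(_ I)/= Nx; exists (xsection N x); split => //.
  exact: measurable_xsection.
by move=> y Qy; rewrite /xsection/= inE; exact: QN.
Qed.

Lemma ae_prod_section_fst (Q : X * Y -> Prop) : {ae (mu \x nu)%E, forall z, Q z} ->
  {ae nu, forall y, {ae mu, forall x, Q (x, y)}}.
Proof.
move=> [N [mN N0 QN]].
have : ae_eq nu setT (mu \o ysection N) (cst 0%E).
  apply/ae_eq_integral_abs => //; first exact: measurable_fun_ysection.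
  rewrite -[RHS]N0; have -> : (mu \x nu)%E N = (mu \x^ nu)%E N.
    by apply: product_measure_unique => // A B mA mB /=; rewrite product_measure2E.
  by apply: eq_integral => x _ /=; rewrite gee0_abs.
apply: filterS => x /(_ I)/= Nx; exists (ysection N x); split => //.
  exact: measurable_ysection.
by move=> y Qy; rewrite /ysection/= inE; exact: QN.
Qed.

Lemma ae_prod_fst (Q : X -> Prop) : {ae mu, forall x, Q x} ->
  {ae (mu \x nu)%E, forall z, Q z.1}.
Proof.
move=> [N [mN N0 QN]]; exists (N `*` setT); split.
- exact: measurableX.
- by rewrite /= product_measure1E//; move: N0 => /= ->; rewrite mul0e.
- by move=> [x y] /= Qx; split => //; exact: QN.
Qed.

Lemma ae_prod_snd (Q : Y -> Prop) : {ae nu, forall y, Q y} ->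
  {ae (mu \x nu)%E, forall z, Q z.2}.
Proof.
move=> [N [mN N0 QN]]; exists (setT `*` N); split.
- exact: measurableX.
- by rewrite /= product_measure1E//; move: N0 => /= ->; rewrite mule0.
- by move=> [x y] /= Qx; split => //; exact: QN.
Qed.

End IteratedIntegrals.

Definition pswap (A B : Type) (z : A * B) : B * A := (z.2, z.1).

Lemma measurable_pswap d1 d2 (X : measurableType d1) (Y : measurableType d2) :
  measurable_fun setT (@pswap X Y).
Proof. exact: measurable_fun_pair measurable_snd measurable_fst. Qed.

Section Swap.
Context d1 d2 (X : measurableType d1) (Y : measurableType d2) (R : realType).
Variables (mu : {sigma_finite_measure set X -> \bar R})
          (nu : {sigma_finite_measure set Y -> \bar R}).
Implicit Types f g : X * Y -> R.

Lemma measurable_fun_swap (f : X * Y -> R) : measurable_fun setT f ->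
  measurable_fun setT (f \o @pswap Y X).
Proof. by move=> mf; apply: measurableT_comp => //; exact: measurable_pswap. Qed.

Lemma ge0_integral_swap (f : X * Y -> \bar R) : measurable_fun setT f ->
  (forall z, (0 <= f z)%E) ->
  (\int[(nu \x mu)]_z f (pswap z) = \int[(mu \x nu)]_z f z)%E.
Proof.
move=> mf f0; rewrite (fubini_tonelli1 (fun z => f (pswap z)))//.
  by rewrite (fubini_tonelli2 f).
by apply: measurableT_comp => //; exact: measurable_pswap.
Qed.

Lemma integral_swap (f : X * Y -> \bar R) : measurable_fun setT f ->
  (\int[(nu \x mu)]_z f (pswap z) = \int[(mu \x nu)]_z f z)%E.
Proof.
move=> mf; rewrite integralE [RHS]integralE; congr (_ - _)%E.
- rewrite -(ge0_integral_swap (measurable_funepos mf))//.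
  by apply: eq_integral => z _; rewrite !funeposE.
- rewrite -(ge0_integral_swap (measurable_funeneg mf))//.
  by apply: eq_integral => z _; rewrite !funenegE.
Qed.

Lemma Rintegral_swap f : measurable_fun setT f ->
  \int[(nu \x mu)%E]_z f (pswap z) = \int[(mu \x nu)%E]_z f z.
Proof.
by move=> mf; rewrite /Rintegral (integral_swap (f := EFin \o f))//; exact/measurable_EFinP.
Qed.

Lemma intble_swap f : intble (mu \x nu)%E f ->
  intble (nu \x mu)%E (f \o @pswap Y X).
Proof.
move=> fi; have mf := intble_measurable fi.
apply/integrableP; split; first by apply/measurable_EFinP; exact: measurable_fun_swap.
rewrite (ge0_integral_swap (f := fun z => `|(f z)%:E|%E))//.
- by have /integrableP[] := fi.
- by apply: measurableT_comp => //; exact/measurable_EFinP.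
Qed.

Lemma intble_Rintegral_fst f : intble (mu \x nu)%E f ->
  intble nu (fun y => \int[mu]_x f (x, y)).
Proof. by move=> /intble_swap/intble_Rintegral_snd. Qed.

Lemma sqint_swap f : sqint (mu \x nu)%E f -> sqint (nu \x mu)%E (f \o @pswap Y X).
Proof.
by move=> [mf fi]; split; [exact: measurable_fun_swap|exact: (intble_swap fi)].
Qed.

Lemma ae_swap (Q : X * Y -> Prop) : {ae (mu \x nu)%E, forall z, Q z} ->
  {ae (nu \x mu)%E, forall z, Q (pswap z)}.
Proof.
move=> [N [mN N0 QN]]; exists (@pswap Y X @^-1` N); split.
- by rewrite -[X in measurable X]setTI; exact: measurable_pswap.
- have mN' : measurable (@pswap Y X @^-1` N).
    by rewrite -[X in measurable X]setTI; exact: measurable_pswap.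
  rewrite -N0 -[LHS](congr1 _ (setIT _)) -[RHS](congr1 _ (setIT _)).
  rewrite -(integral_indic _ measurableT mN') -(integral_indic _ measurableT mN).
  rewrite -(ge0_integral_swap (f := fun z => (\1_N z)%:E))//.
  apply/measurable_EFinP; exact: measurable_indic.
- by move=> [x y] /= h; exact: QN.
Qed.

End Swap.

Lemma indic_norm_le1 (X : Type) (R : realType) (A : set X) (x : X) :
  `|\1_A x| <= 1 :> R.
Proof. by rewrite indicE; case: (_ \in _); rewrite ?normr1 ?normr0. Qed.

Lemma ae_le_forall_nat d (X : measurableType d) (R : realType)
    (mu : {measure set X -> \bar R}) (Q : nat -> X -> Prop) :
  (forall n, {ae mu, forall x, Q n x}) -> {ae mu, forall x, forall n, Q n x}.
Proof. by move=> h; apply/ae_foralln. Qed.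

Section FiniteProduct.
Context d1 d2 (X : measurableType d1) (Y : measurableType d2) (R : realType).
Variables (mu : {finite_measure set X -> \bar R})
          (nu : {finite_measure set Y -> \bar R}).

Lemma fin_setT : (mu setT < +oo)%E.
Proof. by rewrite -ge0_fin_numE ?fin_num_measure. Qed.

Lemma prod_fin : ((mu \x nu)%E setT < +oo)%E.
Proof.
rewrite -setXTT product_measure1E//; apply: lte_mul_pinfty => //.
  by rewrite fin_num_measure.
by rewrite -ge0_fin_numE ?fin_num_measure.
Qed.

Lemma sqint_fst (f : X -> R) : sqint mu f -> sqint (mu \x nu)%E (fun z => f z.1).
Proof.
move=> [mf fi]; have mf1 : measurable_fun setT (fun z : X * Y => f z.1).
  by apply: measurableT_comp => //; exact: measurable_fst.
split=> //; apply: ge0_intble.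
- exact: measurable_funX.
- by move=> z; exact: sqr_ge0.
rewrite (fubini_tonelli2 (fun z => (f z.1 ^+ 2)%:E))//=; last 2 first.
- by apply/measurable_EFinP; exact: measurable_funX.
- by move=> z; rewrite lee_fin sqr_ge0.
rewrite /fubini_G/= EFin_Rintegral// integral_cst//.
apply: lte_mul_pinfty => //; last by rewrite -ge0_fin_numE ?fin_num_measure.
by rewrite lee_fin Rintegral_ge0// => x _; exact: sqr_ge0.
Qed.

Lemma ae_sqint_section_fst (f : X * Y -> R) : sqint (mu \x nu)%E f ->
  {ae nu, forall y, sqint mu (fun x => f (x, y))}.
Proof.
move=> [mf fi]; apply: filterS (intble_section_fst fi) => y h; split => //.
exact: measurable_fun_pair1.
Qed.

End FiniteProduct.

Lemma sqint_snd d1 d2 (X : measurableType d1) (Y : measurableType d2) (R : realType)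
  (mu : {finite_measure set X -> \bar R}) (nu : {finite_measure set Y -> \bar R})
  (f : Y -> R) : sqint nu f -> sqint (mu \x nu)%E (fun z => f z.2).
Proof. by move=> /(sqint_fst mu)/sqint_swap. Qed.

Section KernelOperator.
Context d1 d2 (X : measurableType d1) (Y : measurableType d2) (R : realType).
Variables (mu : {finite_measure set X -> \bar R})
          (nu : {finite_measure set Y -> \bar R}).
Local Notation P := (mu \x nu)%E.

Definition bounded_kernel (k : X * X -> R) :=
  measurable_fun setT k /\ exists M : R, forall z, `|k z| <= M.

Definition kerop (k : X * X -> R) (c : X * Y -> R) (z : X * Y) : R :=
  \int[mu]_x (k (z.1, x) * c (x, z.2)).

Definition ktr (k : X * X -> R) (z : X * X) : R := k (z.2, z.1).

Lemma ktrP k : bounded_kernel k -> bounded_kernel (ktr k).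
Proof.
move=> [mk [M kM]]; split; last by exists M => z; exact: kM.
by apply: measurableT_comp => //; exact: measurable_pswap.
Qed.

Lemma measurable_kerop_integrand k (c : X * Y -> R) : bounded_kernel k ->
  measurable_fun setT c ->
  measurable_fun setT (fun w : (X * Y) * X => k (w.1.1, w.2) * c (w.2, w.1.2)).
Proof.
move=> [mk _] mc; apply: measurable_funM.
  apply: measurableT_comp => //; apply: measurable_fun_pair => //.
  by apply: measurableT_comp => //; exact: measurable_fst.
apply: measurableT_comp => //; apply: measurable_fun_pair => //.
by apply: measurableT_comp => //; exact: measurable_snd.
Qed.

Lemma measurable_kerop k c : bounded_kernel k -> measurable_fun setT c ->
  measurable_fun setT (kerop k c).
Proof.
move=> kb mc.
exact: (measurable_Rintegral_snd mu (measurable_kerop_integrand kb mc)).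
Qed.

(** Cauchy-Schwarz on each line of constant [y] bounds the squared value by [M ^+ 2 * m] times the
    integral of [c ^+ 2] over that line; this bound is constant in the first variable, whose total
    mass is finite. *)
Lemma sqint_kerop k c : bounded_kernel k -> sqint P c -> sqint P (kerop k c).
Proof.
move=> kb [mc ci]; have [mk [M kM]] := kb; have mK := measurable_kerop kb mc.
have Fm := fin_setT mu.
split=> //; apply: ge0_intble; first exact: measurable_funX.
  by move=> z; exact: sqr_ge0.
pose m := fine (mu setT); have m0 : 0 <= m by exact: fine_ge0.
have muE : mu setT = m%:E by rewrite fineK// fin_num_measure.
(* The added 1 keeps [C] positive, so that [C] times an infinite line integral is infinite and the
   pointwise bound also holds on the exceptional lines. *)
pose C := M ^+ 2 * m + 1.
have C0 : 0 < C by rewrite ltr_pwDr// mulr_ge0// sqr_ge0.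
have mc2 : measurable_fun setT (fun z => (c z ^+ 2)%:E).
  by apply/measurable_EFinP; exact: measurable_funX.
have c20 z : (0 <= (c z ^+ 2)%:E)%E by rewrite lee_fin sqr_ge0.
have mG := @measurable_fun_fubini_tonelli_G _ _ _ _ _ mu _ mc2 c20.
have mG2 : measurable_fun setT (fun z : X * Y => fubini_G mu (fun z => (c z ^+ 2)%:E) z.2).
  by apply: measurableT_comp => //; exact: measurable_snd.
have G0 y : (0 <= fubini_G mu (fun z => (c z ^+ 2)%:E) y)%E.
  by apply: integral_ge0 => x _; rewrite lee_fin sqr_ge0.
apply: (@le_lt_trans _ _ (\int[P]_z (C%:E * fubini_G mu (fun z => (c z ^+ 2)%:E) z.2))%E).
  apply: ge0_le_integral => //.
  - by move=> z _; rewrite lee_fin sqr_ge0.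
  - by apply/measurable_EFinP; exact: measurable_funX.
  - exact: measurable_funeM.
  move=> [x y] _ /=.
  have [fin|nfin] := pselect ((fubini_G mu (fun z => (c z ^+ 2)%:E) y < +oo)%E); last first.
    have -> : fubini_G mu (fun z => (c z ^+ 2)%:E) y = +oo%E.
      by apply/eqP; rewrite eq_le leey/= leNgt; exact/negP.
    by rewrite gt0_muley ?lte_fin// leey.
  have mcy : measurable_fun setT (fun x => c (x, y)) by exact: measurable_fun_pair1.
  have scy : sqint mu (fun x => c (x, y)).
    split=> //; apply: ge0_intble => //; first exact: measurable_funX.
    by move=> x'; exact: sqr_ge0.
  have skx : sqint mu (fun x' => k (x, x')).
    apply: (@sqint_bounded _ _ _ _ Fm _ M); last by [].
    exact: measurable_fun_pair2.
  rewrite /fubini_G (ipE scy) lee_fin.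
  apply: (le_trans (ip_CS skx scy)); apply: ler_wpM2r; first exact: ip_ge0.
  rewrite /C; apply: (@le_trans _ _ (\int[mu]_x (M ^+ 2))); last first.
    by rewrite Rintegral_cst// -/m lerDl.
  apply: le_Rintegral => //; first exact: sqintM.
    exact: intble_cst.
  move=> x' _; rewrite -expr2 -[leLHS]real_normK ?num_real// ler_sqr ?nnegrE//.
  exact: le_trans (kM (x, x')).
rewrite ge0_integralZl//; last by rewrite lee_fin ltW.
apply: lte_mul_pinfty; rewrite ?lee_fin ?ltW//.
rewrite (fubini_tonelli1 (fun z : X * Y => fubini_G mu (fun z => (c z ^+ 2)%:E) z.2))//.
rewrite /fubini_F/= -(fubini_tonelli2 _ mc2); last by move=> z; rewrite lee_fin sqr_ge0.
rewrite EFin_Rintegral// integral_cst//.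
by rewrite lte_mul_pinfty// lee_fin Rintegral_ge0// => z _; exact: sqr_ge0.
Qed.

(** Fubini on almost every line of constant [y]: the product of the two sections, as a function of
    two independent points, is integrable because both are square integrable for a finite
    measure. *)
Lemma kerop_adjoint k d c : bounded_kernel k -> sqint P d -> sqint P c ->
  ip P d (kerop k c) = ip P (kerop (ktr k) d) c.
Proof.
move=> kb sd sc; have kb' := ktrP kb.
have sK := sqint_kerop kb sc; have sK' := sqint_kerop kb' sd.
rewrite /ip (RFubini_fst (sqintM sd sK)) (RFubini_fst (sqintM sK' sc)).
have Fm := fin_setT mu.
have mdK : measurable_fun setT (fun z => d z * kerop k c z).
  by apply: measurable_funM; [exact: sd.1|exact: sK.1].
have mKc : measurable_fun setT (fun z => kerop (ktr k) d z * c z).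
  by apply: measurable_funM; [exact: sK'.1|exact: sc.1].
apply: Rintegral_ae; [exact: measurable_Rintegral_fst mdK|exact: measurable_Rintegral_fst mKc|].
apply: filterS2 (ae_sqint_section_fst sd) (ae_sqint_section_fst sc) => y sdy scy.
pose F (w : X * X) := k w * (d (w.1, y) * c (w.2, y)).
have iF : intble (mu \x mu)%E F.
  have [mk [M kM]] := kb.
  have i1 := sqintM (sqint_fst mu sdy) (sqint_snd mu scy).
  have m1 := intble_measurable i1.
  apply: (@intble_dom _ _ _ _ _ (fun w => M * `|d (w.1, y) * c (w.2, y)|)).
  - exact: measurable_funM.
  - by apply: intbleZ; exact: integrable_norm.
  - by move=> w; rewrite normrM ler_wpM2r.
transitivity (\int[(mu \x mu)%E]_w F w).
  rewrite (RFubini_snd iF); apply: eq_Rintegral => x _.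
  rewrite /kerop/= -RintegralZl//.
    by apply: eq_Rintegral => x' _; rewrite /F/=; ring.
  apply: sqintM scy; have [mk [M kM]] := kb.
  by apply: (@sqint_bounded _ _ _ _ Fm _ M) => //; exact: measurable_fun_pair2.
rewrite (RFubini_fst iF); apply: eq_Rintegral => x _.
rewrite /kerop/= -RintegralZr//.
  by apply: eq_Rintegral => x' _; rewrite /F/ktr/=; ring.
apply: sqintM sdy; have [mk [M kM]] := kb'.
by apply: (@sqint_bounded _ _ _ _ Fm _ M) => //; exact: measurable_fun_pair2.
Qed.

End KernelOperator.

(** * A Rellich lemma for product kernels *)

Section Uniqueness.
Variable R : realType.
Local Notation mR := (measurableTypeR R).

Lemma Rintegral_indic d (Z : measurableType d) (P : {measure set Z -> \bar R})
  (w : Z -> R) (D : set Z) : \int[P]_(z in D) w z = \int[P]_z (w z * \1_D z).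
Proof.
rewrite Rintegral_mkcond; apply: eq_Rintegral => z _.
by rewrite patchE indicE; case: ifP; rewrite ?mulr1 ?mulr0.
Qed.

(** The sets over whose preimage [w] integrates to 0 form a Dynkin system: complements use the
    vanishing total integral, countable disjoint unions use the integrability of [w]. *)
Lemma null_on_generated d d' (Z : measurableType d) (Z' : measurableType d')
  (P : {measure set Z -> \bar R}) (w : Z -> R) (g : Z -> Z') (G : set (set Z')) :
  intble P w -> measurable_fun setT g -> @measurable _ Z' = <<s G >> ->
  setI_closed G -> \int[P]_z w z = 0 ->
  (forall A, G A -> \int[P]_z (w z * \1_A (g z)) = 0) ->
  forall A, measurable A -> \int[P]_z (w z * \1_A (g z)) = 0.
Proof.
move=> iw mg GE GI wT wG A mA.
have E B : \int[P]_z (w z * \1_B (g z)) = \int[P]_(z in g @^-1` B) w z.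
  rewrite [RHS]Rintegral_indic; apply: eq_Rintegral => z _; rewrite !indicE.
  suff -> : (z \in g @^-1` B) = (g z \in B) by [].
  by apply/idP/idP; rewrite !inE.
have mpre B : measurable B -> measurable (g @^-1` B).
  by move=> mB; rewrite -[X in measurable X]setTI; exact: mg.
suff : forall S, <<s G >> S -> \int[P]_(z in g @^-1` S) w z = 0.
  by rewrite E; apply; rewrite -GE.
apply: (dynkin_induction (P := fun S => \int[P]_(z in g @^-1` S) w z = 0)) => //.
- by move=> B GB; rewrite -E; exact: wG.
- move=> S mS S0.
  have mS' := mpre _ mS; have mCS' : measurable (g @^-1` (~` S)) by exact/mpre/measurableC.
  move: wT; rewrite -{1}(setUv (g @^-1` S)) Rintegral_setU//.
  + by rewrite S0 add0r.
  + by rewrite setUv.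
  + by apply/disj_setPS => z [].
- move=> F mF tF F0; rewrite preimage_bigcup /Rintegral integral_bigcup//.
  + rewrite eseries0//= => i _ _.
    have iF : P.-integrable (g @^-1` F i) (EFin \o w).
      by apply: integrableS iw => //; exact: mpre.
    have := F0 i; rewrite /Rintegral => h.
    have fi := integrable_fin_num (mpre _ (mF i)) iF.
    by rewrite -[LHS](fineK fi) h.
  + apply/trivIsetP => i j _ _ ij; move/trivIsetP : tF => /(_ i j I I ij) h.
    by rewrite -preimage_setI h preimage_set0.
  + by move=> k; exact: mpre.
  + apply: integrableS iw => //; apply: bigcup_measurable => k _; exact: mpre.
Qed.

(** Open half-lines form a pi-system generating the Borel sets. The whole line is added so that
    total integrals and rectangles with one free side fall under the same hypothesis. *)
Definition rays : set (set R) :=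
  [set A | A = setT \/ exists x, A = `]x, +oo[%classic].

Lemma rays_setI : setI_closed rays.
Proof.
move=> A B [->|[x ->]] [->|[y ->]].
- by left; rewrite setTI.
- by right; exists y; rewrite setTI.
- by right; exists x; rewrite setIT.
right; exists (Num.max x y); apply/seteqP; split=> z /=; rewrite !in_itv/= !andbT gt_max.
  by move=> [-> ->].
by move=> /andP.
Qed.

Lemma rays_gen : @measurable _ mR = <<s rays >>.
Proof.
have := RGenOInfty.measurableE R; rewrite /measurable/= => ->.
apply/seteqP; split => A.
  apply: smallest_sub; first exact: smallest_sigma_algebra.
  by move=> B [x ->]; apply: sub_sigma_algebra; right; exists x.
apply: smallest_sub; first exact: smallest_sigma_algebra.
move=> B [->|[x ->]]; last by apply: sub_sigma_algebra; exists x.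
have := @sigma_algebraCD _ setT (@RGenOInfty.G R) set0
  (@sigma_algebra0 _ setT (@RGenOInfty.G R)).
by rewrite setD0.
Qed.

Lemma measurable_ray A : rays A -> measurable (A : set mR).
Proof. by move=> rA; rewrite rays_gen; exact: sub_sigma_algebra. Qed.

Lemma raysT : rays setT. Proof. by left. Qed.

Variables (mu nu : {finite_measure set mR -> \bar R}).
Local Notation P := (mu \x nu)%E.

(** The generator argument is applied three times: to one side of the rectangle, to the other side,
    and to rectangles as generators of the product sigma-algebra. *)
Lemma rect_null (w : mR * mR -> R) : intble P w ->
  (forall A B, rays A -> rays B -> \int[P]_z (w z * (\1_A z.1 * \1_B z.2)) = 0) ->
  {ae P, forall z, w z = 0}.
Proof.
move=> iw wr; have mw := intble_measurable iw.
have mi1 (A : set mR) : measurable A -> measurable_fun setT (fun z : mR * mR => \1_A z.1 : R).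
  by move=> mA; apply: measurableT_comp; [exact: measurable_indic|exact: measurable_fst].
have mi2 (A : set mR) : measurable A -> measurable_fun setT (fun z : mR * mR => \1_A z.2 : R).
  by move=> mA; apply: measurableT_comp; [exact: measurable_indic|exact: measurable_snd].
have im (f : mR * mR -> R) : measurable_fun setT f -> (forall z, `|f z| <= 1) ->
    intble P (fun z => w z * f z).
  move=> mf f1; apply: (@intble_dom _ _ _ _ _ (fun z => `|w z|)).
  - exact: measurable_funM.
  - exact: integrable_norm.
  - by move=> z; rewrite normrM ler_piMr.
have s1 A B : measurable A -> rays B -> \int[P]_z (w z * \1_B z.2 * \1_A z.1) = 0.
  move=> mA rB; move: A mA.
  apply: (@null_on_generated _ _ _ _ P _ fst rays) => //.
  - by apply: im => [|z]; [by apply: mi2; exact: measurable_ray|exact: indic_norm_le1].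
  - exact: rays_gen.
  - exact: rays_setI.
  - rewrite -[RHS](wr setT B raysT rB); apply: eq_Rintegral => z _.
    by rewrite indicT/= mul1r.
  - move=> A rA; rewrite -[RHS](wr A B rA rB); apply: eq_Rintegral => z _; ring.
have s2 A B : measurable A -> measurable B -> \int[P]_z (w z * \1_A z.1 * \1_B z.2) = 0.
  move=> mA mB; move: B mB.
  apply: (@null_on_generated _ _ _ _ P _ snd rays) => //.
  - by apply: im => [|z]; [exact: mi1|exact: indic_norm_le1].
  - exact: rays_gen.
  - exact: rays_setI.
  - rewrite -[RHS](s1 A setT mA raysT); apply: eq_Rintegral => z _.
    by rewrite indicT/= mulr1.
  - move=> B rB; rewrite -[RHS](s1 A B mA rB); apply: eq_Rintegral => z _; ring.
have s3 E : measurable E -> \int[P]_z (w z * \1_E z) = 0.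
  move: E; apply: (@null_on_generated _ _ _ _ P _ id
     [set A `*` B | A in measurable & B in measurable]) => //.
  - exact: measurable_prod_measurableType.
  - move=> C C' [A mA [B mB CE]] [A' mA' [B' mB' CE']]; rewrite -CE -CE' -setXI.
    by exists (A `&` A'); [exact: measurableI|exists (B `&` B') => //; exact: measurableI].
  - rewrite -[RHS](s2 setT setT measurableT measurableT); apply: eq_Rintegral => z _.
    by rewrite !indicT/= !mulr1.
  - move=> C [A mA [B mB CE]]; rewrite -CE -[RHS](s2 A B mA mB); apply: eq_Rintegral => z _.
    rewrite -mulrA; congr (_ * _); rewrite !indicE in_setX.
    by case: (_ \in _); rewrite /= ?mul1r ?mul0r.
have : ae_eq P setT (EFin \o w) (EFin \o cst 0).
  apply: integral_ae_eq => //; first exact/measurable_EFinP/measurable_cst.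
  move=> E _ mE; rewrite [RHS]integral0_eq//.
  have iE : P.-integrable E (EFin \o w) by exact: integrableS iw.
  have := s3 E mE; rewrite -Rintegral_indic /Rintegral => h.
  by rewrite -[LHS](fineK (integrable_fin_num mE iE)) h.
by apply: filterS => z /(_ I) [].
Qed.

(** This is what dominated convergence needs in order to replace indicators of rays by functions of
    [E] in a pairing with an integrable function. *)
Definition ray_dense (m : {finite_measure set mR -> \bar R}) (E : (R -> R) -> Prop) :=
  forall A, rays A -> exists e : nat -> R -> R,
    [/\ forall i, E (e i), forall i, measurable_fun setT (e i : mR -> R),
        forall i x, `|e i x| <= 1 &
        {ae m, forall x, (fun i => e i x) @ \oo --> (\1_A x : R)}].

Lemma tensor_null (E F : (R -> R) -> Prop) (w : mR * mR -> R) : intble P w ->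
  ray_dense mu E -> ray_dense nu F ->
  (forall e f, E e -> F f -> \int[P]_z (w z * (e z.1 * f z.2)) = 0) ->
  {ae P, forall z, w z = 0}.
Proof.
move=> iw dE dF H; have mw := intble_measurable iw.
apply: rect_null => // A B rA rB.
have [e [Ee me e1 eA]] := dE _ rA; have [f [Ff mf f1 fB]] := dF _ rB.
have c : (fun n => \int[P]_z (w z * (e n z.1 * f n z.2))) @ \oo -->
    \int[P]_z (w z * (\1_A z.1 * \1_B z.2)).
  apply: (@Rintegral_dct _ _ _ _ _ _ (fun z => `|w z|)).
  - move=> n; apply: measurable_funM => //; apply: measurable_funM.
      by apply: measurableT_comp => //; exact: measurable_fst.
    by apply: measurableT_comp => //; exact: measurable_snd.
  - apply: measurable_funM => //; apply: measurable_funM.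
      apply: measurableT_comp; [by apply: measurable_indic; exact: measurable_ray|exact: measurable_fst].
    apply: measurableT_comp; [by apply: measurable_indic; exact: measurable_ray|exact: measurable_snd].
  - exact: integrable_norm.
  - apply: filterS2 (ae_prod_fst nu eA) (ae_prod_snd mu fB) => z h1 h2.
    by apply: cvgM; [exact: cvg_cst|exact: cvgM].
  - apply: aeW => z n; rewrite !normrM ler_piMr//.
    by rewrite -[leRHS]mul1r ler_pM.
apply: (cvgr_fmap_unique c).
rewrite (_ : (fun n => _) = cst 0); first exact: cvg_cst.
by apply/funext => n; exact: H.
Qed.

End Uniqueness.

(** * From weak to strong convergence by kernels in both variables *)

Section Rellich.
Context d1 d2 (X : measurableType d1) (Y : measurableType d2) (R : realType).
Variables (mu : {finite_measure set X -> \bar R})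
          (nu : {finite_measure set Y -> \bar R}).
Local Notation P := (mu \x nu)%E.

Definition kerop2 (l : Y * Y -> R) (c : X * Y -> R) (z : X * Y) : R :=
  \int[nu]_y (l (z.2, y) * c (z.1, y)).

Lemma sqint_kerop2 l c : bounded_kernel l -> sqint P c -> sqint P (kerop2 l c).
Proof. by move=> bl /sqint_swap/(sqint_kerop bl)/sqint_swap. Qed.

Lemma ip_bounded (f g : X * Y -> R) (b : R) : sqint P f -> measurable_fun setT g ->
  (forall z, `|g z| <= b) -> ip P f g ^+ 2 <= ip P f f * (b ^+ 2 * fine (P setT)).
Proof.
move=> sf mg gb; have PF := prod_fin mu nu.
have sg : sqint P g := sqint_bounded PF mg gb.
apply: (le_trans (ip_CS sf sg)); apply: ler_wpM2l; first exact: ip_ge0.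
rewrite -Rintegral_cst//; apply: le_Rintegral => //; first exact: sqintM.
  exact: intble_cst.
move=> z _; rewrite -expr2 -[leLHS]real_normK ?num_real// ler_sqr ?nnegrE//.
exact: le_trans (gb z).
Qed.

Lemma sqr_cvg0 (s t : nat -> R) : (forall i, s i ^+ 2 <= t i) ->
  t @ \oo --> 0 -> s @ \oo --> 0.
Proof.
move=> st /cvgrPdist_lt t0; apply/cvgrPdist_lt => e e0.
have e20 : 0 < e ^+ 2 by rewrite exprn_gt0.
apply: filterS (t0 _ e20) => i /=; rewrite !sub0r !normrN => h.
have : `|s i| ^+ 2 < e ^+ 2.
  by rewrite real_normK ?num_real//; apply: le_lt_trans h; exact/(le_trans (st i))/ler_norm.
by rewrite ltr_sqr ?nnegrE// ltW.
Qed.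

Variables (l1 l2 : Y * Y -> R).
Hypotheses (bl1 : bounded_kernel l1) (bl2 : bounded_kernel l2).
Variables (d b : nat -> X * Y -> R) (M : R).
Hypotheses (sd : forall i, sqint P (d i)) (sb : forall i, sqint P (b i)).
Hypotheses (dM : forall i, ip P (d i) (d i) <= M) (bM : forall i, ip P (b i) (b i) <= M).
Hypotheses (d0 : forall g, sqint P g -> (fun i => ip P (d i) g) @ \oo --> 0).
Hypotheses (b0 : forall g, sqint P g -> (fun i => ip P (b i) g) @ \oo --> 0).
Hypotheses (drep : forall i, {ae P, forall z, d i z = kerop2 l1 (d i) z + kerop2 l2 (b i) z}).

(** Inserting the representation of [d i] in the second variable turns the value of
    [kerop mu k (d i)] at almost every point into pairings of [d i] and [b i] with fixed
    square-integrable functions. These tend to 0 by weak convergence and are uniformly bounded, so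
    dominated convergence applies. *)
Lemma kerop_strong_cvg k : bounded_kernel k ->
  (fun i => ip P (kerop mu k (d i)) (kerop mu k (d i))) @ \oo --> 0.
Proof.
move=> bk; have [mk [Mk kM]] := bk; have [ml1 [N1 l1M]] := bl1.
have [ml2 [N2 l2M]] := bl2; have PF := prod_fin mu nu.
(* The joint kernel of the operator with kernel [k] in the first variable composed with the one with
   kernel [l] in the second. *)
pose g (l : Y * Y -> R) (z w : X * Y) := k (z.1, w.1) * l (z.2, w.2).
have mg l z : measurable_fun setT l -> measurable_fun setT (g l z).
  move=> ml; apply: measurable_funM.
    by apply: (measurableT_comp (measurable_fun_pair2 _ mk)) => //; exact: measurable_fst.
  by apply: (measurableT_comp (measurable_fun_pair2 _ ml)) => //; exact: measurable_snd.
have gN l z w N : (forall v, `|l v| <= N) -> `|g l z w| <= Mk * N.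
  by move=> lN; rewrite normrM ler_pM.
have sg l z : bounded_kernel l -> sqint P (g l z).
  move=> [ml [N lN]]; apply: (@sqint_bounded _ _ _ _ PF _ (Mk * N)); first exact: mg.
  by move=> w; exact: gN.
pose G i z := ip P (d i) (g l1 z) + ip P (b i) (g l2 z).
have key l c x y : bounded_kernel l -> sqint P c ->
    intble mu (fun x' => k (x, x') * kerop2 l c (x', y)) /\
    \int[mu]_x' (k (x, x') * kerop2 l c (x', y)) = ip P c (g l (x, y)).
  move=> bl sc; have iF := sqintM sc (sg l (x, y) bl).
  have [ml [N lN]] := bl.
  have E : {ae mu, forall x', k (x, x') * kerop2 l c (x', y) =
      \int[nu]_y' (c (x', y') * g l (x, y) (x', y'))}.
    have swc := ae_sqint_section_fst (sqint_swap sc).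
    apply: filterS swc => x' scx; rewrite /kerop2/= -RintegralZl//.
      by apply: eq_Rintegral => y' _; rewrite /g/=; ring.
    apply: sqintM scx; apply: (@sqint_bounded _ _ _ _ (fin_setT nu) _ N) => //.
    exact: measurable_fun_pair2.
  have m1 : measurable_fun setT (fun x' => k (x, x') * kerop2 l c (x', y)).
    apply: measurable_funM; first exact: measurable_fun_pair2.
    by apply: measurable_fun_pair1; have [] := sqint_kerop2 bl sc.
  have i2 := intble_Rintegral_snd iF.
  split; first exact: intble_ae i2 E.
  rewrite /ip (RFubini_snd iF); apply: Rintegral_ae => //.
  exact: intble_measurable i2.
have KG i : {ae P, forall z, kerop mu k (d i) z = G i z}.
  have := ae_prod_snd mu (ae_prod_section_fst (drep i)).
  apply: filterS => -[x y] /= hy.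
  have [j1 e1] := key l1 (d i) x y bl1 (sd i).
  have [j2 e2] := key l2 (b i) x y bl2 (sb i).
  rewrite /G -e1 -e2 -RintegralD//; apply: Rintegral_ae.
  - apply: measurable_funM; first exact: measurable_fun_pair2.
    by apply: measurable_fun_pair1; have [] := sd i.
  - by apply: measurable_funD; [exact: intble_measurable j1|exact: intble_measurable j2].
  - by apply: filterS hy => x' /= ->; rewrite mulrDr.
have Gcvg z : (fun i => G i z) @ \oo --> 0.
  rewrite -[0]addr0; apply: cvgD; [apply: d0|apply: b0]; exact: sg.
(* From [(p + q) ^+ 2 <= 2 * (p ^+ 2 + q ^+ 2)] and [ip_bounded] for each of the two pairings. *)
pose C := 2 * (M * ((Mk * N1) ^+ 2 * fine (P setT)) + M * ((Mk * N2) ^+ 2 * fine (P setT))).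
have GC i z : `|G i z ^+ 2| <= C.
  have h1 := ip_bounded (sd i) (mg l1 z ml1) (fun w => gN l1 z w N1 l1M).
  have h2 := ip_bounded (sb i) (mg l2 z ml2) (fun w => gN l2 z w N2 l2M).
  have f0 : 0 <= fine (P setT) by exact: fine_ge0.
  have h1' := le_trans h1 (ler_wpM2r (mulr_ge0 (sqr_ge0 (Mk * N1)) f0) (dM i)).
  have h2' := le_trans h2 (ler_wpM2r (mulr_ge0 (sqr_ge0 (Mk * N2)) f0) (bM i)).
  rewrite ger0_norm ?sqr_ge0// /C /G; move: h1' h2' => {h1 h2}.
  move: (ip P (d i) _) (ip P (b i) _) (M * _) (M * _) => p q A B pA qB.
  have := sqr_ge0 (p - q); nra.
have sK i : sqint P (kerop mu k (d i)) by exact: sqint_kerop.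
have -> : 0 = \int[P]_z (0 : R) by rewrite Rintegral_cst// mul0r.
apply: (@Rintegral_dct _ _ _ _ _ _ (fun=> C)).
- by move=> n; apply: measurable_funM; exact: (sK n).1.
- exact: measurable_cst.
- exact: intble_cst.
- apply: filterS (ae_le_forall_nat KG) => z h.
  rewrite (_ : (fun n => _) = (fun n => G n z * G n z)); last by apply/funext => n; rewrite h.
  by rewrite -[0](mul0r 0); exact: cvgM.
- by apply: filterS (ae_le_forall_nat KG) => z h n; rewrite h -expr2.
Qed.

Variables (k1 k2 : X * X -> R) (a : nat -> X * Y -> R).
Hypotheses (bk1 : bounded_kernel k1) (bk2 : bounded_kernel k2).
Hypotheses (sa : forall i, sqint P (a i)) (aM : forall i, ip P (a i) (a i) <= M).
Hypotheses (drep1 : forall i, {ae P, forall z, d i z = kerop mu k1 (d i) z + kerop mu k2 (a i) z}).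

(* Since d = K1 d + K2 a, ||d||^2 = <K1^T d, d> + <K2^T d, a>, and an operator
   acting in the x-direction alone maps d to a strongly null sequence because
   d is controlled in the y-direction. *)
Lemma rellich : (fun i => ip P (d i) (d i)) @ \oo --> 0.
Proof.
have E i : ip P (d i) (d i) = ip P (kerop mu (ktr k1) (d i)) (d i) +
    ip P (kerop mu (ktr k2) (d i)) (a i).
  rewrite -!kerop_adjoint//.
  have s1 := sqint_kerop bk1 (sd i); have s2 := sqint_kerop bk2 (sa i).
  rewrite (ipC _ (d i) (kerop mu k1 _)) (ipC _ (d i) (kerop mu k2 _)).
  rewrite -(ipDl s1 s2 (sd i)).
  apply: ip_ae; [exact: (sd i).1|exact: (sqintD s1 s2).1|exact: (sd i).1|exact: (sd i).1| |].
    exact: drep1.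
  exact: aeW.
rewrite (funext E) -[0]addr0; apply: cvgD.
- apply: (@sqr_cvg0 _ (fun i => ip P (kerop mu (ktr k1) (d i)) (kerop mu (ktr k1) (d i)) * M)).
    move=> i; apply: (le_trans (ip_CS (sqint_kerop (ktrP bk1) (sd i)) (sd i))).
    by apply: ler_wpM2l => //; apply/ip_ge0/sqint_kerop => //; exact: ktrP.
  rewrite -[0](mul0r M); apply: cvgM; [exact/kerop_strong_cvg/ktrP|exact: cvg_cst].
- apply: (@sqr_cvg0 _ (fun i => ip P (kerop mu (ktr k2) (d i)) (kerop mu (ktr k2) (d i)) * M)).
    move=> i; apply: (le_trans (ip_CS (sqint_kerop (ktrP bk2) (sd i)) (sa i))).
    by apply: ler_wpM2l => //; apply/ip_ge0/sqint_kerop => //; exact: ktrP.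
  rewrite -[0](mul0r M); apply: cvgM; [exact/kerop_strong_cvg/ktrP|exact: cvg_cst].
Qed.

End Rellich.

(** * Smooth test functions *)

Section SmoothFunctions.
Variable R : realType.
Implicit Types (f g : R -> R) (S : (R -> R) -> Prop).

Definition is_deriv f f' := forall x : R, is_derive x (1 : R) f (f' x).

Definition deriv_closed S := forall f, S f -> exists2 f', S f' & is_deriv f f'.

(** Smoothness as membership in some class stable under differentiation. A closure property is then
    proved by exhibiting a larger stable class rather than by induction on the order. *)
Definition smooth f := exists2 S, S f & deriv_closed S.

Inductive alg S : (R -> R) -> Prop :=
| alg_gen f : S f -> alg S f
| alg_add f g : alg S f -> alg S g -> alg S (fun x => f x + g x)
| alg_mul f g : alg S f -> alg S g -> alg S (fun x => f x * g x).

Lemma is_derive_cast (V W : normedModType R) (h : V -> W) x v (a b : W) :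
  is_derive x v h a -> a = b -> is_derive x v h b.
Proof. by move=> ? <-. Qed.

Lemma is_derivD f g f' g' : is_deriv f f' -> is_deriv g g' ->
  is_deriv (fun x => f x + g x) (fun x => f' x + g' x).
Proof. by move=> df dg x; have := df x; have := dg x => ? ?; exact: is_deriveD. Qed.

Lemma is_derivM f g f' g' : is_deriv f f' -> is_deriv g g' ->
  is_deriv (fun x => f x * g x) (fun x => f x * g' x + f' x * g x).
Proof.
move=> df dg x; have h := @is_deriveM R R f g x 1 _ _ (df x) (dg x).
by apply: (is_derive_cast h); rewrite /GRing.scale/= [g x * _]mulrC.
Qed.

Lemma is_deriv_comp f g f' g' : is_deriv f f' -> is_deriv g g' ->
  is_deriv (fun x => g (f x)) (fun x => g' (f x) * f' x).
Proof.
move=> df dg x; have [dfx vf] := df x; have [dgx vg] := dg (f x).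
have dc : derivable (g \o f) x 1.
  by apply/derivable1_diffP/differentiable_comp; exact/derivable1_diffP.
split => //; rewrite -derive1E (derive1_comp dfx dgx) !derive1E vf.
by congr (_ * _); exact: vg.
Qed.

Lemma is_deriv_cst (a : R) : is_deriv (fun=> a) (fun=> 0).
Proof. by move=> x; exact: is_derive_cst. Qed.

Lemma is_deriv_continuous f f' : is_deriv f f' -> continuous f.
Proof.
by move=> df x; apply/differentiable_continuous/derivable1_diffP; have [] := df x.
Qed.

Lemma alg_deriv_closed S :
  (forall f, S f -> exists2 f', alg S f' & is_deriv f f') -> deriv_closed (alg S).
Proof.
move=> SS f; elim=> {f} [f Sf|f g Af [f' Af' df] Ag [g' Ag' dg]|f g Af [f' Af' df] Ag [g' Ag' dg]].
- exact: SS.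
- by exists (fun x => f' x + g' x); [exact: alg_add|exact: is_derivD].
- exists (fun x => f x * g' x + f' x * g x); last exact: is_derivM.
  by apply: alg_add; exact: alg_mul.
Qed.

Lemma smooth_deriv f : smooth f -> exists2 f', smooth f' & is_deriv f f'.
Proof. by move=> [S Sf SS]; have [f' Sf' df] := SS _ Sf; exists f' => //; exists S. Qed.

Lemma smooth_continuous f : smooth f -> continuous f.
Proof. by move=> /smooth_deriv[f' _]; exact: is_deriv_continuous. Qed.

Lemma smooth_primitive f f' : is_deriv f f' -> smooth f' -> smooth f.
Proof.
move=> df [S Sf' SS]; exists (fun g => S g \/ g = f); first by right.
move=> g [/SS[g' Sg' dg]|->]; first by exists g' => //; left.
by exists f' => //; left.
Qed.

Lemma smooth_cst (a : R) : smooth (fun=> a).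
Proof.
exists (fun f => exists b : R, f = fun=> b); first by exists a.
by move=> _ [b ->]; exists (fun=> 0); [exists 0|exact: is_deriv_cst].
Qed.

Lemma smooth_algU f g S1 S2 : S1 f -> S2 g -> deriv_closed S1 -> deriv_closed S2 ->
  deriv_closed (alg (fun h => S1 h \/ S2 h)).
Proof.
move=> _ _ SS1 SS2; apply: alg_deriv_closed => h [/SS1|/SS2] [h' Sh' dh].
  by exists h' => //; apply: alg_gen; left.
by exists h' => //; apply: alg_gen; right.
Qed.

Lemma smoothD f g : smooth f -> smooth g -> smooth (fun x => f x + g x).
Proof.
move=> [S1 Sf SS1] [S2 Sg SS2]; exists (alg (fun h => S1 h \/ S2 h)).
  by apply: alg_add; apply: alg_gen; [left|right].
exact: smooth_algU Sf Sg SS1 SS2.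
Qed.

Lemma smoothM f g : smooth f -> smooth g -> smooth (fun x => f x * g x).
Proof.
move=> [S1 Sf SS1] [S2 Sg SS2]; exists (alg (fun h => S1 h \/ S2 h)).
  by apply: alg_mul; apply: alg_gen; [left|right].
exact: smooth_algU Sf Sg SS1 SS2.
Qed.

Lemma smoothZ (a : R) f : smooth f -> smooth (fun x => a * f x).
Proof. by apply: smoothM; exact: smooth_cst. Qed.

Lemma smoothB f g : smooth f -> smooth g -> smooth (fun x => f x - g x).
Proof.
move=> sf sg; rewrite (_ : (fun x => _) = fun x => f x + -1 * g x).
  by apply: smoothD => //; exact: smoothZ.
by apply/funext => x; rewrite mulN1r.
Qed.

(** The chain rule stays inside the algebra generated by [S1] and the composites of members of [S2]
    with [f]. *)
Lemma smooth_comp f g : smooth f -> smooth g -> smooth (fun x => g (f x)).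
Proof.
move=> [S1 Sf SS1] [S2 Sg SS2].
exists (alg (fun h => S1 h \/ exists2 k, S2 k & h = fun x => k (f x))).
  by apply: alg_gen; right; exists g.
apply: alg_deriv_closed => h [/SS1[h' Sh' dh]|[k /SS2[k' Sk' dk] ->]].
  by exists h' => //; apply: alg_gen; left.
have [f' Sf' df] := SS1 _ Sf.
exists (fun x => k' (f x) * f' x); last exact: is_deriv_comp.
by apply: alg_mul; apply: alg_gen; [right; exists k'|left].
Qed.

Lemma smooth_id : smooth (fun x => x).
Proof.
apply: (@smooth_primitive _ (fun=> 1)); last exact: smooth_cst.
by move=> x; exact: is_derive_id.
Qed.

Lemma smooth_sin : smooth (@sin R).
Proof.
exists (fun f => [\/ f = @sin R, f = @cos R, f = (fun x => - sin x) | f = fun x => - cos x]).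
  by constructor 1.
have dN f f' : is_deriv f f' -> is_deriv (fun x => - f x) (fun x => - f' x).
  by move=> df x; have := df x => ?; exact: is_deriveN.
move=> _ [->|->|->|->].
- by exists (@cos R); [constructor 2|move=> x; exact: is_derive_sin].
- by exists (fun x => - sin x); [constructor 3|move=> x; exact: is_derive_cos].
- exists (fun x => - cos x); first by constructor 4.
  by apply: dN => x; exact: is_derive_sin.
- exists (@sin R); first by constructor 1.
  have -> : @sin R = fun x => - - sin x by apply/funext => x; rewrite opprK.
  by apply: dN => x; exact: is_derive_cos.
Qed.

(** For [k = 0] this is the standard flat function exp(-1/x), cut off at 0. The powers of [x^-1] are
    present because differentiation produces them. *)
Definition bump_der (k : nat) (x : R) : R :=
  if 0 < x then x^-1 ^+ k * expR (- x^-1) else 0.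

Definition bump := bump_der 0.

(** With y = 1/x this is the exponential inequality e^y >= y^(k+2) / (k+2)!. A quadratic bound is
    what makes the difference quotient at 0 tend to 0. *)
Lemma bump_der_small k (x : R) : `|bump_der k x| <= (k.+2)`!%:R * x ^+ 2.
Proof.
rewrite /bump_der; case: ifPn => [x0|_]; last first.
  by rewrite normr0 mulr_ge0// sqr_ge0.
rewrite ger0_norm; last by rewrite mulr_ge0 ?expR_ge0// exprn_ge0// invr_ge0 ltW.
have [y y0 ->] : exists2 y, 0 < y & x = y^-1.
  by exists x^-1; rewrite ?invrK ?invr_gt0.
rewrite invrK expRN exprVn ler_pdivlMr ?exprn_gt0// mulrAC -exprD addn2.
rewrite ler_pdivrMr ?expR_gt0// mulrC -ler_pdivrMr ?ltr0n ?fact_gt0//.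
have := expR_ge1Dxn k.+1 (ltW y0); apply: le_trans.
by rewrite lerDr.
Qed.

Lemma is_deriv_bump_der k : is_deriv (bump_der k)
  (fun x => - k%:R * bump_der k.+1 x + bump_der k.+2 x).
Proof.
move=> x; have [x0|x0|x0] := ltgtP x 0.
- rewrite [X in is_derive _ _ _ X](_ : _ = 0); last first.
    by rewrite /bump_der [0 < x]ltNge (ltW x0)/= mulr0 addr0.
  apply: (@near_eq_is_derive _ _ _ (fun=> 0)).
  near=> y; rewrite /bump_der; case: ifPn => //; rewrite ltNge ltW//.
  by near: y; exact: lt_nbhsl.
- have xn : x != 0 by rewrite gt_eqF.
  have di : is_derive x 1 (fun x : R => x^-1) (- x^-1 ^+ 2).
    have h := @is_deriveV R id x 1 1 xn (is_derive_id x 1); apply: (is_derive_cast h).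
    by rewrite /GRing.scale/= mulr1 exprVn.
  have dX := @is_deriveX R R (fun x => x^-1) k x 1 _ di.
  have fX : (fun x : R => x^-1) ^+ k = fun x => x^-1 ^+ k.
    apply/funext => y; elim: (k) => [|n IH]; first by rewrite !expr0.
    by rewrite !exprS -IH.
  rewrite fX in dX.
  have dN := @is_deriveN R R R (fun x => x^-1) x 1 _ di.
  have dE : is_derive x 1 (fun x => expR (- x^-1)) (expR (- x^-1) * - (- x^-1 ^+ 2)).
    have [d1 v1] := dN; have [d2 v2] := is_derive_expR (- x^-1).
    have dc : derivable (expR \o (fun x => - x^-1)) x 1.
      by apply/derivable1_diffP/differentiable_comp; exact/derivable1_diffP.
    split=> //; rewrite -derive1E (derive1_comp d1 d2) !derive1E v1.
    by congr (_ * _); exact: v2.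
  have h := @is_deriveM R R _ _ x 1 _ _ dX dE.
  have nf : \near x, (fun x => x^-1 ^+ k * expR (- x^-1)) x = bump_der k x.
    near=> y; rewrite /bump_der; case: ifPn => //; rewrite -leNgt leNgt => /negP; case.
    by near: y; exact: lt_nbhsr.
  have h2 : is_derive x (1 : R) (bump_der k) _ := near_eq_is_derive nf h.
  apply: (is_derive_cast h2).
  rewrite /bump_der x0 /GRing.scale/= opprK {fX}.
  case: k dX h nf h2 => [|k] _ _ _ _; first by rewrite /= !expr0; ring.
  by rewrite /= !exprS; ring.
- rewrite x0 [X in is_derive _ _ _ X](_ : _ = 0); last first.
    by rewrite /bump_der ltxx mulr0 addr0.
  suff h : (fun h => h^-1 *: (bump_der k (h *: 1 + 0) - bump_der k 0)) @ 0^' --> (0 : R).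
    split; first by apply/cvg_ex; exists 0.
    exact: cvg_lim h.
  apply/cvgrPdist_le => e e0.
  pose C : R := (k.+2)`!%:R; have C0 : 0 < C by rewrite ltr0n fact_gt0.
  near=> h; have hn : h != 0 by near: h; exact: nbhs_dnbhs_neq.
  rewrite sub0r normrN addr0 [bump_der k 0]/bump_der ltxx subr0.
  rewrite [h *: 1]mulr1 normrZ normfV ler_pdivrMl ?normr_gt0//.
  apply: (le_trans (bump_der_small k h)); rewrite -/C.
  rewrite -[h ^+ 2]real_normK ?num_real// expr2 mulrCA ler_wpM2l//.
  rewrite -ler_pdivlMl// mulrC; near: h; apply: dnbhs0_le.
  by rewrite divr_gt0.
Unshelve. all: by end_near.
Qed.

Lemma smooth_bump : smooth bump.
Proof.
exists (alg (fun f => (exists k, f = bump_der k) \/ exists a : R, f = fun=> a)).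
  by apply: alg_gen; left; exists 0%N.
apply: alg_deriv_closed => f [[k ->]|[a ->]]; last first.
  by exists (fun=> 0); [apply: alg_gen; right; exists 0|exact: is_deriv_cst].
exists (fun x => - k%:R * bump_der k.+1 x + bump_der k.+2 x); last exact: is_deriv_bump_der.
apply: alg_add; last by apply: alg_gen; left; exists k.+2.
by apply: alg_mul; apply: alg_gen; [right; exists (- k%:R)|left; exists k.+1].
Qed.

Lemma bump_le0 x : x <= 0 -> bump x = 0.
Proof. by rewrite leNgt /bump /bump_der => /negbTE ->. Qed.

Lemma bump_gt0 x : 0 < x -> 0 < bump x.
Proof. by move=> x0; rewrite /bump /bump_der x0 expr0 mul1r expR_gt0. Qed.

Lemma bump_ge0 x : 0 <= bump x.
Proof. by case: (leP x 0) => [/bump_le0 ->//|/bump_gt0/ltW]. Qed.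

Lemma bump_norm x : `|bump x| <= 1.
Proof.
rewrite ger0_norm ?bump_ge0// /bump /bump_der; case: ifPn => // x0.
by rewrite expr0 mul1r expR_le1 oppr_le0 invr_ge0 ltW.
Qed.

(** The argument of [bump] tends to infinity, and 1 - exp(-1/y) <= 1/y. *)
Lemma bump_cvg (p : nat -> R) (l : R) : 0 < l -> p @ \oo --> l ->
  (fun m => bump (m.+1%:R * p m)) @ \oo --> (1 : R).
Proof.
move=> l0 pl; apply/cvgrPdist_le => e e0.
have l2 : 0 < l / 2 by rewrite divr_gt0.
have near_p : \forall m \near \oo, l / 2 <= p m.
  have := @cvgr_ge R nat \oo _ p l pl (l / 2); apply.
  by rewrite ltr_pdivrMr// ltr_pMr// ltr1n.
near=> m; have pm : l / 2 <= p m by near: m.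
have pm0 : 0 < m.+1%:R * p m by rewrite mulr_gt0 ?ltr0n// (lt_le_trans _ pm).
have b1 : bump (m.+1%:R * p m) <= 1 by rewrite -[leLHS]ger0_norm ?bump_ge0// bump_norm.
rewrite ger0_norm ?subr_ge0//.
rewrite /bump /bump_der pm0 expr0 mul1r.
suff : (m.+1%:R * p m)^-1 <= e.
  move=> h; rewrite lerBlDl -lerBlDr; apply: le_trans (expR_ge1Dx _).
  by rewrite lerD2l lerN2.
rewrite invf_ple ?posrE//.
have m1 : e^-1 * (l / 2)^-1 <= m.+1%:R.
  near: m; exists (Num.truncn (e^-1 * (l / 2)^-1)) => // m /= mm.
  by apply: (le_trans (ltW (truncnS_gt _))); rewrite ler_nat ltnS.
have -> : e^-1 = e^-1 * (l / 2)^-1 * (l / 2) by rewrite mulfVK// gt_eqF.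
apply: ler_pM => //; last exact: ltW.
by rewrite mulr_ge0// invr_ge0 ltW.
Unshelve. all: by end_near.
Qed.

End SmoothFunctions.

(** * Lebesgue measure on an interval and antiderivatives *)

Section IntervalMeasure.
Variable R : realType.
Local Notation mR := (measurableTypeR R).
Local Notation leb := (@lebesgue_measure R).

Lemma lebesgue_cc_fin (L : R) : (leb `[0%R, L]%classic < +oo)%E.
Proof. by rewrite lebesgue_measure_itv/=; case: ifPn => // _; rewrite -EFinB ltry. Qed.

Lemma measurable_cc (L : R) : measurable (`[0, L]%classic : set mR).
Proof. exact: measurable_itv. Qed.

(* Sealed behind an opaque existence proof: unfolding this measure during
   canonical structure inference makes unification diverge. *)
Lemma lam_exists (L : R) : {m : {finite_measure set mR -> \bar R} |
  forall A, m A = leb (A `&` `[0, L]%classic)}.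
Proof.
exists (@mfrestr _ mR R `[0, L]%classic leb (measurable_cc L) (lebesgue_cc_fin L)).
by [].
Qed.

Definition lam (L : R) : {finite_measure set mR -> \bar R} := sval (lam_exists L).

Lemma lamE (L : R) (A : set R) : lam L A = leb (A `&` `[0, L]%classic).
Proof. exact: (svalP (lam_exists L)). Qed.

Lemma ae_lam (L : R) : {ae lam L, forall x : mR, 0 < (x : R) < L}.
Proof.
exists (~` `]0, L[%classic); split.
- by apply: measurableC; exact: measurable_itv.
- rewrite lamE; apply: countable_lebesgue_measure0.
  apply: (@sub_countable _ _ _ [set 0; L]).
    apply: subset_card_le => x /=; rewrite !in_itv/= => -[h /andP[h1 h2]].
    move/negP: h; rewrite negb_and -!leNgt => /orP[h|h]; [left|right];
      by apply/eqP; rewrite eq_le ?h ?h1 ?h2.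
  exact/finite_set_countable/finite_set2.
- by move=> x /= h h'; apply: h; move: h'; rewrite in_itv.
Qed.

Lemma ae_lam_cc (L : R) : {ae lam L, forall x : mR, (x : R) \in `[0, L]}.
Proof. by apply: filterS (ae_lam L) => x /andP[/ltW h /ltW h']; rewrite in_itv/= h. Qed.

Lemma integral_lam (L : R) (f : R -> \bar R) : measurable_fun setT (f : mR -> \bar R) ->
  (\int[lam L]_x f x = \int[leb]_(x in [set` `[0%R, L]%R]) f x)%E.
Proof.
move=> mf; have mI : measurable (`[0, L]%classic : set mR) by exact: measurable_itv.
transitivity (\int[lam L]_(x in [set` `[0%R, L]%R]) f x)%E.
  rewrite [RHS]integral_mkcond; apply: ae_eq_integral => //.
    by apply/(measurable_restrictT _ mI); exact: measurable_funTS.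
  by apply: filterS (ae_lam_cc L) => x xI _ /=; rewrite patchE mem_set.
apply: eq_measure_integral => A mA AI.
by rewrite -[RHS](congr1 leb (setIidl AI)); exact: lamE.
Qed.

Lemma Rintegral_lam (L : R) (f : R -> R) : measurable_fun setT (f : mR -> R) ->
  \int[lam L]_x f x = \int[leb]_(x in `[0, L]) f x.
Proof. by move=> mf; rewrite /Rintegral integral_lam//; exact/measurable_EFinP. Qed.

Lemma continuous_intble_cc (f : R -> R) (a b : R) : continuous f ->
  leb.-integrable `[a, b] (EFin \o f).
Proof.
move=> cf; apply: continuous_compact_integrable; first exact: segment_compact.
exact: continuous_subspaceT.
Qed.

Lemma continuous_measurable (f : R -> R) : continuous f ->
  measurable_fun setT (f : mR -> R).
Proof. exact: continuous_measurable_fun. Qed.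

Lemma FTC2_primitive (f F : R -> R) (a b : R) : a <= b -> continuous f ->
  is_deriv F f -> \int[leb]_(x in `[a, b]) f x = F b - F a.
Proof.
rewrite le_eqVlt => /orP[/eqP ->|ab] cf dF.
  by rewrite set_itv1 Rintegral_set1 subrr.
have cF := is_deriv_continuous dF.
rewrite /Rintegral (@continuous_FTC2 _ f F)//.
- exact: continuous_subspaceT.
- split.
  + by move=> x _; have [] := dF x.
  + by apply: cvg_at_right_filter; exact: cF.
  + by apply: cvg_at_left_filter; exact: cF.
- by move=> x _; rewrite derive1E; have [] := dF x.
Qed.

Lemma exists_primitive (f : R -> R) : continuous f ->
  exists2 F, is_deriv F f & F 0 = 0.
Proof.
move=> cf.
pose F (x : R) : R := if 0 <= x then \int[leb]_(t in `[0, x]) f t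
                      else - \int[leb]_(t in `[x, 0]) f t.
have FE (c y : R) : c < 0 -> c <= y ->
    F y = \int[leb]_(t in `[c, y]) f t - \int[leb]_(t in `[c, 0]) f t.
  move=> c0 cy; rewrite /F; case: (leP 0 y) => y0.
    have := @Rintegral_itvB R f (BLeft c) (BRight y) 0 (continuous_intble_cc c y cf).
    rewrite !bnd_simp => /(_ (ltW c0) y0) ->.
    rewrite Rintegral_itv_obnd_cbnd//.
    apply: integrableS (continuous_intble_cc 0 y cf) => //.
    by move=> t; rewrite /= !in_itv/= => /andP[/ltW -> ->].
  have := @Rintegral_itvB R f (BLeft c) (BRight 0) y (continuous_intble_cc c 0 cf).
  rewrite !bnd_simp => /(_ cy (ltW y0)) h.
  rewrite -opprB h Rintegral_itv_obnd_cbnd//.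
  apply: integrableS (continuous_intble_cc y 0 cf) => //.
  by move=> t; rewrite /= !in_itv/= => /andP[/ltW -> ->].
exists F; last by rewrite /F lexx set_itv1 Rintegral_set1.
(* A base point to the left of both [x] and 0 gives a single formula for [F] near [x], whatever the
   sign of [x], to which the fundamental theorem applies. *)
move=> x; pose c := Num.min x 0 - 1.
have c0 : c < 0 by rewrite /c ltrBlDr add0r gt_min ltr01 orbT.
have cx : c < x by rewrite /c ltrBlDr gt_min ltrDl ltr01.
have x1 : x < x + 1 by rewrite ltrDl.
have [dG vG] := @continuous_FTC1_closed R f c x (x + 1) x1
  (continuous_intble_cc c (x + 1) cf) cx (cf x).
have h : is_derive x (1 : R) (fun y : R => \int[leb]_(t in `[c, y]) f t) (f x).
  by split; [exact: dG|rewrite -derive1E vG].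
have h2 := @is_deriveB R R R _ _ x 1 _ _ h (is_derive_cst (\int[leb]_(t in `[c, 0]) f t) x 1).
rewrite subr0 in h2; apply: near_eq_is_derive h2.
near=> y; rewrite (FE c)//.
by apply/ltW; near: y; exact: lt_nbhsr.
Unshelve. all: by end_near.
Qed.

End IntervalMeasure.

(** * One-variable test functions: antiderivatives and density *)

Section TestClasses.
Variable R : realType.
Local Notation mR := (measurableTypeR R).
Local Notation leb := (@lebesgue_measure R).
Implicit Types e f : R -> R.

Definition tbump (T : R) e := smooth e /\ exists a b : R,
  [/\ 0 < a, b < T & forall t, ~ (a <= t <= b) -> e t = 0].

Definition pbump e := smooth e /\ forall x, e (x + 2 * pi) = e x.

(* Every e in E agrees, up to the multiple of chi with the same integral, with
   the derivative of an element of E vanishing at L. *)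
Definition has_primitives (L : R) (E : (R -> R) -> Prop) (chi : R -> R) :=
  forall e, E e -> exists2 a, E a &
    is_deriv a (fun x => e x - (\int[lam L]_s e s) * chi x) /\ a L = 0.

Lemma smooth_measurable e : smooth e -> measurable_fun setT (e : mR -> R).
Proof. by move=> /smooth_continuous/continuous_measurable. Qed.

(** Subtracting the multiple of [chi] with equal integral makes the antiderivative that starts at 0
    return to 0 at [L]. *)
Lemma smooth_primitive_sub (L : R) e chi : 0 <= L -> smooth e -> smooth chi ->
  \int[lam L]_s chi s = 1 ->
  exists a, [/\ smooth a,
    is_deriv a (fun x => e x - (\int[lam L]_s e s) * chi x), a 0 = 0 & a L = 0].
Proof.
move=> L0 se sc c1; pose c := \int[lam L]_s e s.
have sf : smooth (fun x => e x - c * chi x) by apply: smoothB => //; exact: smoothZ.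
have [F dF F0] := exists_primitive (smooth_continuous sf).
exists F; split => //; first exact: smooth_primitive dF sf.
have := FTC2_primitive L0 (smooth_continuous sf) dF; rewrite F0 subr0 => <-.
rewrite RintegralB//; last 2 first.
- exact/continuous_intble_cc/smooth_continuous.
- exact/continuous_intble_cc/smooth_continuous/smoothZ.
rewrite RintegralZl//; last exact/continuous_intble_cc/smooth_continuous.
rewrite -!Rintegral_lam ?c1 ?mulr1 ?subrr//; exact: smooth_measurable.
Qed.

(** To the left of both supports the antiderivative keeps its value [F 0 = 0], and to their right
    its value [F T = 0], so its support stays inside the open interval. *)
Lemma has_primitives_tbump (T : R) chi : 0 < T -> tbump T chi ->
  \int[lam T]_s chi s = 1 -> has_primitives T (tbump T) chi.
Proof.
move=> T0 [sc [p [q [p0 qT cpq]]]] c1 e [se [a [b [a0 bT eab]]]].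
have [F [sF dF F0 FT]] := smooth_primitive_sub (ltW T0) se sc c1.
exists F => //; split => //.
pose c := \int[lam T]_s e s.
have cf : continuous (fun x => e x - c * chi x).
  by apply: smooth_continuous; apply: smoothB => //; exact: smoothZ.
pose l := Num.min (Num.min a p) (T / 2); pose r := Num.max (Num.max b q) (T / 2).
have T2 : 0 < T / 2 by rewrite divr_gt0.
have T2T : T / 2 < T by rewrite ltr_pdivrMr// ltr_pMr// ltr1n.
exists l, r; split.
- by rewrite /l !lt_min a0 p0.
- by rewrite /r !gt_max bT qT.
move=> t; have [tl _|lt] := ltP t l.
  have tT : t < T by rewrite (lt_trans tl)// /l gt_min T2T orbT.
  have [t0|t0] := leP 0 t.
    have := FTC2_primitive t0 cf dF; rewrite F0 subr0 => <-.
    rewrite (@eq_Rintegral _ _ _ _ _ (fun=> 0)) ?Rintegral_cst ?mul0r//.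
    move=> x; rewrite inE/= in_itv/= => /andP[_ xt].
    have xl := le_lt_trans xt tl; move: xl; rewrite /l !lt_min => /andP[/andP[xa xp] _].
    rewrite eab ?cpq ?mulr0 ?subrr//; apply/negP; rewrite negb_and -!ltNge ?xa ?xp//.
  have := FTC2_primitive (ltW t0) cf dF; rewrite F0 sub0r => /eqP; rewrite -eqr_oppLR => /eqP <-.
  rewrite (@eq_Rintegral _ _ _ _ _ (fun=> 0)) ?Rintegral_cst ?mul0r ?oppr0//.
  move=> x; rewrite inE/= in_itv/= => /andP[_ x0].
  rewrite eab ?cpq ?mulr0 ?subrr//; apply/negP; rewrite negb_and -!ltNge.
    by rewrite (le_lt_trans x0).
  by rewrite (le_lt_trans x0).
move=> /= /negP; rewrite -ltNge => rt.
have [tT|tT] := leP t T.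
  have := FTC2_primitive tT cf dF; rewrite FT sub0r => /eqP; rewrite -eqr_oppLR => /eqP <-.
  rewrite (@eq_Rintegral _ _ _ _ _ (fun=> 0)) ?Rintegral_cst ?mul0r ?oppr0//.
  move=> x; rewrite inE/= in_itv/= => /andP[tx _].
  have xl := lt_le_trans rt tx; move: xl; rewrite /r !gt_max => /andP[/andP[xa xp] _].
  by rewrite eab ?cpq ?mulr0 ?subrr//; apply/negP; rewrite negb_and -!ltNge ?xa ?xp ?orbT.
have := FTC2_primitive (ltW tT) cf dF; rewrite FT subr0 => <-.
rewrite (@eq_Rintegral _ _ _ _ _ (fun=> 0)) ?Rintegral_cst ?mul0r//.
move=> x; rewrite inE/= in_itv/= => /andP[tx _].
rewrite eab ?cpq ?mulr0 ?subrr//; apply/negP; rewrite negb_and -!ltNge.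
  by rewrite (lt_le_trans qT)// orbT.
by rewrite (lt_le_trans bT)// orbT.
Qed.

Lemma pi2_gt0 : 0 < 2 * pi :> R.
Proof. by rewrite mulr_gt0// pi_gt0. Qed.

Lemma Rintegral_lam_cst (L a : R) : 0 < L -> \int[lam L]_x a = a * L.
Proof.
move=> L0; rewrite Rintegral_lam//; rewrite Rintegral_cst//.
have := lebesgue_measure_itv `[0, L]; rewrite /= lte_fin L0 -EFinB subr0 => h.
by rewrite (congr1 fine h).
Qed.

Lemma pbump_cst (a : R) : pbump (fun=> a).
Proof. by split => //; exact: smooth_cst. Qed.

(** With a constant [chi] the corrected function stays periodic. The increment of its antiderivative
    over one period is therefore constant, and it vanishes at 0. *)
Lemma has_primitives_pbump : has_primitives (2 * pi) pbump (fun=> (2 * pi)^-1).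
Proof.
move=> e [se pe]; have p0 := pi2_gt0.
have c1 : \int[lam (2 * pi)]_s (2 * pi)^-1 = 1 :> R.
  by rewrite Rintegral_lam_cst// mulVf// gt_eqF.
have [F [sF dF F0 FL]] := smooth_primitive_sub (ltW p0) se (smooth_cst (2 * pi)^-1) c1.
exists F => //; split => // x.
pose G y := F (y + 2 * pi) - F y.
have dG : forall y, is_derive y (1 : R) G 0.
  move=> y; have dS : is_deriv (fun y : R => y + 2 * pi) (fun=> 1).
    move=> z; have h := @is_deriveD R R R id (cst (2 * pi)) z 1 _ _ (is_derive_id z 1) (is_derive_cst _ z 1).
    by rewrite addr0 in h.
  have dC := is_deriv_comp dS dF.
  have h := @is_deriveB R R R _ _ y 1 _ _ (dC y) (dF y).
  by apply: (is_derive_cast h); rewrite mulr1 pe subrr.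
have : G x = G 0 by exact: is_derive_0_is_cst.
rewrite /G add0r F0 FL subr0 => /eqP; rewrite subr_eq0 => /eqP.
exact.
Qed.

(** [bump] of a large multiple of [p] approximates the indicator of the set where [p] is positive,
    so it suffices to find functions that change sign at the cut point. Cut points left of 0 are
    moved to 0; for those beyond [L] the zero function serves. *)
Lemma ray_dense_intro (L : R) (E : (R -> R) -> Prop) : E (fun=> 0) ->
  (forall e, E e -> measurable_fun setT (e : mR -> R)) ->
  (forall x : R, 0 <= x < L -> exists p : nat -> R -> R,
    (forall m, E (fun t => bump (m.+1%:R * p m t))) /\
    forall t : R, 0 < t < L -> (t <= x -> forall m, p m t <= 0) /\
      (x < t -> exists2 l : R, 0 < l & (fun m => p m t) @ \oo --> l)) ->
  ray_dense (lam L) E.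
Proof.
move=> E0 mE H.
have ray (x : R) : exists e : nat -> R -> R,
    [/\ forall i, E (e i), forall i, measurable_fun setT (e i : mR -> R),
        forall i x, `|e i x| <= 1 &
        {ae lam L, forall t : mR, (fun i => e i t) @ \oo --> (\1_(`]x, +oo[%classic) (t : R) : R)}].
  pose x' := Num.max x 0.
  have [Lx|xL] := leP L x'.
    exists (fun _ _ => 0).
    split; [by []|by move=> i; exact: (mE _ E0)|by move=> ? ?; rewrite normr0|].
    apply: filterS (ae_lam L) => t /andP[t0 tL].
    rewrite indicE memNset; first exact: cvg_cst.
    rewrite /= in_itv/= andbT => xt; have := lt_le_trans tL Lx.
    by rewrite lt_max ltNge (ltW xt)/= ltNge (ltW t0).
  have x'0 : 0 <= x' < L by rewrite xL le_max lexx orbT.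
  have [p [Ep pP]] := H _ x'0.
  exists (fun m t => bump (m.+1%:R * p m t)); split; first exact: Ep.
  - by move=> m; exact: (mE _ (Ep m)).
  - by move=> m t; exact: bump_norm.
  apply: filterS (ae_lam L) => t tL; have [h1 h2] := pP t tL.
  rewrite indicE; have [tx|xt] := leP t x'.
    rewrite memNset.
      rewrite (_ : (fun _ => _) = cst 0); first exact: cvg_cst.
      apply/funext => m; apply: bump_le0.
      by rewrite mulr_ge0_le0// h1.
    rewrite /= in_itv/= andbT => xt; move: tx; rewrite /x' le_max leNgt xt/=.
    by case/andP: tL => t0 _; rewrite leNgt t0.
  rewrite mem_set; last by rewrite /= in_itv/= andbT (le_lt_trans _ xt)// le_max lexx.
  by have [l l0 pl] := h2 xt; exact: bump_cvg pl.
move=> A [->|[x ->]]; last exact: ray.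
have [e [e1 e2 e3 e4]] := ray (-1); exists e; split => //.
apply: filterS2 (ae_lam L) e4 => t /andP[t0 _].
by rewrite !indicE !mem_set//= in_itv/= andbT (lt_trans _ t0).
Qed.

Lemma smooth_affine (a b : R) : smooth (fun x => a * x + b).
Proof. by apply: smoothD; [exact/smoothZ/smooth_id|exact: smooth_cst]. Qed.

Lemma tbump_measurable (T : R) e : tbump T e -> measurable_fun setT (e : mR -> R).
Proof. by move=> [/smooth_measurable]. Qed.

Lemma pbump_measurable e : pbump e -> measurable_fun setT (e : mR -> R).
Proof. by move=> [/smooth_measurable]. Qed.

Lemma ray_dense_tbump (T : R) : 0 < T -> ray_dense (lam T) (tbump T).
Proof.
move=> T0; apply: ray_dense_intro.
- split; first exact: smooth_cst.
  by exists (T / 2), (T / 2); split => //; rewrite ?divr_gt0// ltr_pdivrMr// ltr_pMr// ltr1n.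
- exact: tbump_measurable.
move=> x /andP[x0 xT].
(* This margin tends to 0 and keeps the support inside the open interval. It is at most a third of
   [T - x], so that [x + d m] lies left of [T - d m]. *)
pose d m := (T - x) / m.+3%:R.
have d0 m : 0 < d m by rewrite divr_gt0 ?ltr0n// subr_gt0.
have d3 m : d m <= (T - x) / 3.
  rewrite /d ler_pM2l ?subr_gt0// lef_pV2 ?posrE ?ltr0n// ler_nat//.
have dc : d @ \oo --> 0.
  rewrite -[0](mulr0 (T - x)); apply: cvgM; first exact: cvg_cst.
  have h := @cvg_harmonic R; rewrite -(cvg_shiftn 2) in h.
  by apply: cvg_trans h; apply: near_eq_cvg; apply: nearW => m; rewrite /= addn2.
exists (fun m t => (t - (x + d m)) * (T - d m - t)); split.
  move=> m; split.
    apply: (@smooth_comp _ _ (@bump R)); last exact: smooth_bump.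
    apply: smoothZ; apply: smoothM.
      by apply: smoothB; [exact: smooth_id|exact: smooth_cst].
    by apply: smoothB; [exact: smooth_cst|exact: smooth_id].
  exists (x + d m), (T - d m); split.
  - by rewrite ltr_wpDl.
  - by rewrite ltrBlDr ltrDl.
  move=> t h; apply: bump_le0; apply: mulr_ge0_le0 => //.
  have := d3 m; have := d0 m; move/negP: h; rewrite negb_and -!ltNge => h h1 h2.
  case/orP: h => h; nra.
move=> t /andP[t0 tT]; split => [tx m|xt].
  have := d3 m; have := d0 m; nra.
exists ((t - x) * (T - t)); first by rewrite mulr_gt0// subr_gt0.
apply: cvgM.
  rewrite -[X in _ --> t - X]addr0; apply: cvgB; first exact: cvg_cst.
  by apply: cvgD => //; exact: cvg_cst.
rewrite -[X in _ --> X - t]subr0; apply: cvgB; last exact: cvg_cst.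
by apply: cvgB => //; exact: cvg_cst.
Qed.

(** Each sine of a half-angle changes sign under a shift by [2 * pi], so their product [p] is
    periodic; within the period it is positive exactly to the right of [x]. *)
Lemma ray_dense_pbump : ray_dense (lam (2 * pi)) pbump.
Proof.
apply: ray_dense_intro.
- exact: pbump_cst.
- exact: pbump_measurable.
move=> x /andP[x0 xp].
pose p (t : R) : R := sin ((t - x) / 2) * sin ((2 * pi - t) / 2).
have sp : smooth p.
  apply: smoothM.
    apply: (@smooth_comp _ (fun t => (t - x) / 2) (@sin R)); last exact: smooth_sin.
    rewrite (_ : (fun t => _) = fun t => 2^-1 * t + (- x / 2)); first exact: smooth_affine.
    by apply/funext => t; field.
  apply: (@smooth_comp _ (fun t => (2 * pi - t) / 2) (@sin R)); last exact: smooth_sin.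
  rewrite (_ : (fun t => _) = fun t => (- 2^-1) * t + pi); first exact: smooth_affine.
  by apply/funext => t; field.
have pp t : p (t + 2 * pi) = p t.
  rewrite /p (_ : (t + 2 * pi - x) / 2 = (t - x) / 2 + pi); last by field.
  rewrite (_ : (2 * pi - t) / 2 = (2 * pi - (t + 2 * pi)) / 2 + pi); last by field.
  by rewrite !sinDpi; ring.
exists (fun=> p); split.
  move=> m; split; last by move=> t; rewrite pp.
  apply: (@smooth_comp _ _ (@bump R)); last exact: smooth_bump.
  exact: smoothZ.
move=> t /andP[t0 tp].
have s2 : 0 < sin ((2 * pi - t) / 2) by apply: sin_gt0_pi; lra.
split => [tx m|xt].
  rewrite /p; apply: mulr_le0_ge0; last exact: ltW.
  have [->|tx'] := eqVneq t x; first by rewrite subrr mul0r sin0.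
  have {}tx : t < x by rewrite lt_neqAle tx'.
  have -> : (t - x) / 2 = - ((x - t) / 2) by field.
  by rewrite sinN oppr_le0 ltW// sin_gt0_pi//; lra.
exists (p t); last exact: cvg_cst.
by rewrite mulr_gt0// sin_gt0_pi//; lra.
Qed.

(** Approximants of the indicator of the whole line have integrals tending to [T], so one of them
    has a positive integral and can be normalised. *)
Lemma exists_chi (T : R) : 0 < T -> exists chi, [/\ tbump T chi,
  \int[lam T]_s chi s = 1 & exists M : R, forall x, `|chi x| <= M].
Proof.
move=> T0.
have [e [e1 e2 e3 e4]] := ray_dense_tbump T0 (raysT R).
have c : (fun n => \int[lam T]_x e n x) @ \oo --> \int[lam T]_x (1 : R).
  apply: (@Rintegral_dct _ mR R (lam T) _ _ (fun=> 1)) => //.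
  - exact: (intble_cst (fin_setT _)).
  - have F := ae_filter_ringOfSetsType (lam T).
    by apply: filterS e4 => x; rewrite indicT.
  - by apply: aeW => x n; exact: e3.
rewrite Rintegral_lam_cst// mul1r in c.
have [n hn] : exists n, 0 < \int[lam T]_x e n x.
  have [n hn] := filter_ex (@cvgr_gt R nat \oo _ _ T c 0 T0).
  by exists n.
have [sm [a [b [a0 bT h]]]] := e1 n.
exists (fun x => (\int[lam T]_x e n x)^-1 * e n x); split.
- split; first exact: smoothZ.
  by exists a, b; split => // t ht; rewrite h// mulr0.
- rewrite RintegralZl//; first by rewrite mulVf// gt_eqF.
  by apply: (@bounded_intble _ _ _ _ (fin_setT _) _ 1).
- exists (`|(\int[lam T]_x e n x)^-1| * 1) => x.
  by rewrite normrM ler_wpM2l.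
Qed.

End TestClasses.

(** * The cylinder *)

Section CompositionMeasurability.
Variable R : realType.

Lemma measurable_countable_comp d (X : measurableType d) (C : countType)
    (r : X -> C) (f : C -> R) :
  (forall c, measurable (r @^-1` [set c])) -> measurable_fun setT (f \o r).
Proof.
move=> mr _ B mB; rewrite setTI.
pose F n := if unpickle n is Some c then
  (if `[< B (f c) >] then r @^-1` [set c] else set0) else set0.
rewrite (_ : _ @^-1` _ = \bigcup_n F n).
  apply: bigcupT_measurable => n; rewrite /F; case: unpickle => // c.
  by case: ifP.
apply/seteqP; split=> [x /= Bx|x [n _]].
  exists (pickle (r x)) => //; rewrite /F pickleK.
  by case: ifPn => //; move/asboolPn.
by rewrite /F; case: unpickle => // c; case: ifPn => // /asboolP ? /= ->.
Qed.

Definition grid (m : nat) (t : R) : int := Num.floor (m.+1%:R * t).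

Lemma grid_close (m : nat) (t : R) : `|t - (grid m t)%:~R / m.+1%:R| <= m.+1%:R^-1.
Proof.
have m0 : 0 < m.+1%:R :> R by rewrite ltr0n.
have -> : t - (grid m t)%:~R / m.+1%:R = (m.+1%:R * t - (grid m t)%:~R) / m.+1%:R.
  by field; rewrite gt_eqF.
rewrite normrM normfV (gtr0_norm m0) -[leRHS]mul1r ler_pM2r ?invr_gt0//.
have h1 := floor_le (m.+1%:R * t); have h2 := floorD1_gt (m.+1%:R * t).
rewrite ger0_norm ?subr_ge0// lerBlDl; apply/ltW.
by move: h2; rewrite intrD.
Qed.

Lemma grid_fibre d (X : measurableType d) (h : X -> R) m (k : int) :
  measurable_fun setT h -> measurable [set x | grid m (h x) = k].
Proof.
move=> mh; have mg : measurable_fun setT (fun x => m.+1%:R * h x) by exact: measurable_funM.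
rewrite (_ : [set x | _] = (fun x => m.+1%:R * h x) @^-1` `[k%:~R, (k + 1)%:~R[%classic).
  by rewrite -[X in measurable X]setTI; apply: mg => //; exact: measurable_itv.
apply/seteqP; split => x /=; rewrite in_itv/=.
  by move=> <-; rewrite floor_le floorD1_gt.
by move=> h1; apply/eqP; rewrite /grid floor_eq.
Qed.

(* A continuous function of finitely many measurable reals is measurable: round
   the arguments, which makes them countably valued, and pass to the limit. *)
Lemma measurable_comp_continuous d (X : measurableType d) (N : nat)
    (g : 'rV[R]_N * R -> R) (u : X -> 'rV[R]_N) (h : X -> R) :
  continuous g -> (forall j, measurable_fun setT (fun x => u x ord0 j)) ->
  measurable_fun setT h -> measurable_fun setT (fun x => g (u x, h x)).
Proof.
move=> cg mu mh.
pose r m (x : X) : {ffun 'I_N -> int} * int := ([ffun j => grid m (u x ord0 j)], grid m (h x)).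
pose f m (c : {ffun 'I_N -> int} * int) : 'rV[R]_N * R :=
  (\row_j ((c.1 j)%:~R / m.+1%:R), c.2%:~R / m.+1%:R).
apply: (@measurable_fun_cvg _ _ _ _ (fun m x => g (f m (r m x)))).
  move=> m; apply: (@measurable_countable_comp _ _ _ (r m) (fun c => g (f m c))) => -[c k].
  rewrite (_ : _ @^-1` _ = (\bigcap_(j in [set: 'I_N]) [set x | grid m (u x ord0 j) = c j]) `&`
     [set x | grid m (h x) = k]).
    apply: measurableI; last exact: grid_fibre.
    by apply: fin_bigcap_measurable => // j _; exact: grid_fibre.
  apply/seteqP; split => [x [/= <- <-]|x /= [hj <-]].
    by split => // j _ /=; rewrite ffunE.
  by congr pair; apply/ffunP => j; rewrite ffunE; exact: hj.
move=> x _; apply: (@cvg_comp _ _ _ (fun m => f m (r m x)) g _ (nbhs (u x, h x))); last exact: cg.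
have m0 m : 0 < m.+1%:R :> R by rewrite ltr0n.
have small e : 0 < e -> \forall m \near \oo, m.+1%:R^-1 <= e :> R.
  move=> e0; exists (Num.truncn e^-1) => // m /= em.
  rewrite -[leRHS]invrK lef_pV2 ?posrE ?invr_gt0//.
  by apply: (le_trans (ltW (truncnS_gt _))); rewrite ler_nat ltnS.
have c1 : (fun m => (f m (r m x)).1) @ \oo --> u x.
  apply/cvgrPdist_le => e e0; near=> m.
  have me : m.+1%:R^-1 <= e by near: m; exact: small.
  rewrite /Num.Def.normr/= mx_normrE (bigmax_le _ (ltW e0))//= => -[i j] _ /=.
  rewrite !mxE ffunE (ord1 i); apply: le_trans me; exact: grid_close.
have c2 : (fun m => (f m (r m x)).2) @ \oo --> h x.
  apply/cvgrPdist_le => e e0; near=> m.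
  have me : m.+1%:R^-1 <= e by near: m; exact: small.
  by apply: le_trans me; exact: grid_close.
exact: (cvg_pair c1 c2).
Unshelve. all: by end_near.
Qed.

Lemma continuous_measurable2 (g : R * R -> R) : continuous g ->
  measurable_fun setT (g : measurableTypeR R * measurableTypeR R -> R).
Proof.
move=> cg; pose g' (w : 'rV[R]_1 * R) := g (w.1 ord0 ord0, w.2).
have cg' : continuous g'.
  move=> w; apply: (@continuous_comp _ _ _ (fun w : 'rV[R]_1 * R => (w.1 ord0 ord0, w.2)) g); last exact: cg.
  have c1 : (fun w : 'rV[R]_1 * R => w.1 ord0 ord0) @ w --> w.1 ord0 ord0.
    apply: (@continuous_comp _ _ _ fst (fun M : 'rV[R]_1 => M ord0 ord0) w).
      exact: cvg_fst.
    exact: coord_continuous.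
  have c2 : (fun w : 'rV[R]_1 * R => w.2) @ w --> w.2 by exact: cvg_snd.
  exact: (cvg_pair c1 c2).
have := @measurable_comp_continuous _ (measurableTypeR R * measurableTypeR R)%type 1 g'
  (fun z => \row_j z.1) snd cg'.
rewrite (_ : (fun x => _) = g); last by apply/funext => -[a b]; rewrite /g' /= mxE.
apply; last exact: measurable_snd.
by move=> j; rewrite (_ : (fun x => _) = fst); [exact: measurable_fst|apply/funext => z; rewrite mxE].
Qed.

End CompositionMeasurability.

(** * Tensor products as test functions *)

Section Tensors.
Variable R : realType.
Implicit Types (a b : R -> R) (z v : R * R).

(** Sums are included because a directional derivative of a product is a sum of two products. *)
Inductive tens : (R * R -> R) -> Prop :=
| tens_prod a b : smooth a -> smooth b -> tens (fun z => a z.1 * b z.2)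
| tens_add f g : tens f -> tens g -> tens (fun z => f z + g z).

Lemma is_derive_dir (a a' : R -> R) (x w : R) : is_deriv a a' ->
  is_derive x w a (w * a' x).
Proof.
move=> da; have [dx vx] := da x; have df : differentiable a x by exact/derivable1_diffP.
split; first exact: diff_derivable.
by rewrite deriveE// diff1E// derive1E vx.
Qed.

Lemma is_derive_fst a a' z v : is_deriv a a' ->
  is_derive z v (fun z : R * R => a z.1) (v.1 * a' z.1).
Proof. by move=> /is_derive_dir h; have [dx vx] := h z.1 v.1; split. Qed.

Lemma is_derive_snd a a' z v : is_deriv a a' ->
  is_derive z v (fun z : R * R => a z.2) (v.2 * a' z.2).
Proof. by move=> /is_derive_dir h; have [dx vx] := h z.2 v.2; split. Qed.

Lemma is_derive_tensor a a' b b' z v : is_deriv a a' -> is_deriv b b' ->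
  is_derive z v (fun z : R * R => a z.1 * b z.2)
    (v.1 * a' z.1 * b z.2 + v.2 * a z.1 * b' z.2).
Proof.
move=> da db.
have h := @is_deriveM R (R * R)%type _ _ z v _ _ (is_derive_fst z v da) (is_derive_snd z v db).
by apply: (is_derive_cast h); rewrite /GRing.scale/=; ring.
Qed.

Lemma tens_continuous f : tens f -> continuous f.
Proof.
elim=> {f} [a b sa sb|f g _ cf _ cg] z; last by apply: continuousD; [exact: cf|exact: cg].
apply: continuousM.
  by apply: continuous_comp; [exact: cvg_fst|exact: smooth_continuous].
by apply: continuous_comp; [exact: cvg_snd|exact: smooth_continuous].
Qed.

Lemma tens_deriv f v : tens f -> exists2 g, tens g & forall z, is_derive z v f (g z).
Proof.
elim=> {f} [a b sa sb|f g _ [f' tf df] _ [g' tg dg]].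
  have [a' sa' da] := smooth_deriv sa; have [b' sb' db] := smooth_deriv sb.
  exists (fun z => v.1 * a' z.1 * b z.2 + v.2 * a z.1 * b' z.2); last first.
    by move=> z; exact: is_derive_tensor.
  by apply: tens_add; apply: (@tens_prod (fun x => _ * _ x)) => //; exact: smoothZ.
exists (fun z => f' z + g' z); first exact: tens_add.
by move=> z; exact: (@is_deriveD R (R * R)%type R f g z v _ _ (df z) (dg z)).
Qed.

Lemma tens_Cinfty f : tens f -> Cinfty f.
Proof.
move=> tf k; elim: k f tf => [|k IH] f tf /=; split=> //; first exact: tens_continuous.
- exact: tens_continuous.
- move=> v; have [g tg dg] := tens_deriv v tf.
  split; first by move=> z; have [] := dg z.
  rewrite (_ : (fun z => _) = g); first exact: IH.
  by apply/funext => z; have [] := dg z.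
Qed.

Lemma test_fun_tensor (T : R) a b : tbump T a -> pbump b ->
  test_fun T (fun z => a z.1 * b z.2).
Proof.
move=> [sa [p [q [p0 qT hpq]]]] [sb pb]; split.
- by apply: tens_Cinfty; exact: tens_prod.
- by move=> x th /=; rewrite pb.
- by exists p, q; split => // t th h /=; rewrite hpq// mul0r.
Qed.

End Tensors.

Notation cylm T := ((lam T) \x (lam (2 * pi)))%E.

Section Cylinder.
Variables (R : realType) (T : R).
Local Notation mR := (measurableTypeR R).
Local Notation leb := (@lebesgue_measure R).

Lemma measurable_cylinder : measurable (cylinder T : set (mR * mR)).
Proof. by apply: measurableX; exact: measurable_itv. Qed.

(** Agreement on rectangles suffices. Integrals over the cylinder thereby become integrals for a
    product of two finite measures, the setting of the kernel operators. *)
Lemma area_restrict (A : set (mR * mR)) : measurable A ->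
  (cylm T) A = mrestr (@area R) measurable_cylinder A.
Proof.
move=> mA; apply: product_measure_unique => // B C mB mC.
transitivity (leb (B `&` [set` `[0%R, T]%R]) * leb (C `&` @circle R))%E; last first.
  by congr (_ * _)%E; apply/esym; exact: lamE.
rewrite /= /mrestr /cylinder -setXI /area.
have mI (L : R) : measurable (`[0, L]%classic : set mR) by exact: measurable_itv.
rewrite product_measure1E//; last 2 first.
- exact: (measurableI _ _ mB (mI T)).
- exact: (measurableI _ _ mC (mI (2 * pi))).
Qed.

Lemma cylm_fin : ((cylm T) setT < +oo)%E.
Proof. exact: prod_fin. Qed.

Lemma ae_cylm : {ae (cylm T), forall z : mR * mR, cylinder T z}.
Proof.
have h1 := ae_prod_fst (lam (2 * pi)) (ae_lam_cc T).
have h2 := ae_prod_snd (lam T) (ae_lam_cc (2 * pi)).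
by apply: filterS2 h1 h2 => z.
Qed.

Lemma integral_cylm (F : R * R -> \bar R) :
  measurable_fun setT (F : mR * mR -> \bar R) ->
  (\int[@area R]_(z in cylinder T) F z = \int[(cylm T)]_z F z)%E.
Proof.
move=> mF; have mC := measurable_cylinder.
transitivity (\int[(cylm T)]_(z in cylinder T) F z)%E.
  apply: eq_measure_integral => A mA AC; rewrite [RHS]area_restrict//.
  by rewrite /mrestr (setIidl AC).
rewrite integral_mkcond; apply: ae_eq_integral => //.
  by apply/(measurable_restrictT _ mC); exact: measurable_funTS.
have FP : Filter (nbhs (almost_everywhere (cylm T))).
  exact: (ae_filter_ringOfSetsType (lam T \x lam (2 * pi))%E).
by apply: (@filterS _ _ FP _ _ _ ae_cylm) => z zC _ /=; rewrite patchE mem_set.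
Qed.

Lemma Rintegral_cylm (F : R * R -> R) :
  measurable_fun setT (F : mR * mR -> R) ->
  \int[@area R]_(z in cylinder T) F z = \int[(cylm T)]_z F z.
Proof. by move=> mF; rewrite /Rintegral integral_cylm//; exact/measurable_EFinP. Qed.

End Cylinder.

(** * Integral representation of weakly differentiable functions *)

Section Representation.
Variable R : realType.
Local Notation mR := (measurableTypeR R).
Local Notation leb := (@lebesgue_measure R).

Lemma continuous_intble (L : R) (f : R -> R) : continuous f -> intble (lam L) f.
Proof.
move=> cf; have mf := continuous_measurable cf.
have /integrableP[_ foo] := continuous_intble_cc 0 L cf.
apply/integrableP; split; first exact/measurable_EFinP.
rewrite integral_lam//; apply: measurableT_comp => //.
exact/measurable_EFinP.
Qed.

Lemma continuous_sqint (L : R) (f : R -> R) : continuous f -> sqint (lam L) f.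
Proof.
move=> cf; split; first exact: continuous_measurable.
by apply: continuous_intble => x; apply: continuousM; exact: cf.
Qed.

(** [ind_le (x, s)] is the kernel of integration from the left end of the interval up to [x]. *)
Definition ind_le (z : mR * mR) : R := if z.2 <= z.1 then 1 else 0.

Lemma measurable_ind_le : measurable_fun setT ind_le.
Proof.
apply: measurable_fun_ifT => //.
by apply: measurable_fun_ler; [exact: measurable_snd|exact: measurable_fst].
Qed.

Lemma ind_le_norm z : `|ind_le z| <= 1.
Proof. by rewrite /ind_le; case: ifP; rewrite ?normr1 ?normr0. Qed.

Lemma lam_tail (L x' : R) (h : R -> R) : 0 <= x' <= L -> continuous h ->
  \int[lam L]_x (h x * ind_le (x, x')) = \int[leb]_(x in `[x', L]) h x.
Proof.
move=> /andP[x0 xL] ch; rewrite Rintegral_lam; last first.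
  apply: measurable_funM; first exact: continuous_measurable.
  exact: measurable_fun_pair1 measurable_ind_le.
rewrite [LHS]Rintegral_mkcond [RHS]Rintegral_mkcond; apply: eq_Rintegral => x _.
rewrite !patchE /ind_le/=.
have [xI|xI] := boolP (x \in [set` `[x', L]]).
  move: xI; rewrite inE/= in_itv/= => /andP[h1 h2].
  by rewrite mem_set ?h1 ?mulr1//= in_itv/= h2 (le_trans x0).
case: ifP => // xL'; move: xL'; rewrite inE/= in_itv/= => /andP[h1 h2].
case: ifP => h3; last by rewrite mulr0.
by move/negP: xI; case; rewrite inE/= in_itv/= h2 h3.
Qed.

Variables (L : R) (nu : {finite_measure set mR -> \bar R}).
Local Notation P := (lam L \x nu)%E.
Variables (E F : (R -> R) -> Prop) (chi : R -> R).
Hypotheses (Ec : forall e, E e -> smooth e) (Fc : forall e, F e -> sqint nu (e : mR -> R)).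
Hypotheses (F2 : forall e, F e -> sqint nu ((fun x => e x ^+ 2) : mR -> R)).
Hypotheses (dE : ray_dense (lam L) E) (dF : ray_dense nu F).
Hypotheses (chiS : smooth chi) (chiM : exists M : R, forall x, `|chi x| <= M).
Hypothesis Ep : has_primitives L E chi.

(** Averaging f(x) = f(r) + int_r^x f' over r with weight [chi] gives f as an integral of f against
    [ker1] plus an integral of f' against [ker2]; here [tail s] is the integral of [chi] over
    [s, L]. *)
Definition ker1 (w : mR * mR) : R := chi w.2.

Definition tail (x' : mR) : R := \int[lam L]_s (chi s * ind_le (s, x')).

Definition ker2 (w : mR * mR) : R := ind_le w - tail w.2.

Lemma ker1P : bounded_kernel ker1.
Proof.
split; last by have [M h] := chiM; exists M => z; exact: h.
apply: measurableT_comp; first exact: smooth_measurable.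
exact: measurable_snd.
Qed.

Lemma measurable_tail : measurable_fun setT tail.
Proof.
apply: (@measurable_Rintegral_fst _ _ mR mR R (lam L) (fun z => chi z.1 * ind_le z)).
apply: measurable_funM; last exact: measurable_ind_le.
apply: measurableT_comp; first exact: smooth_measurable.
exact: measurable_fst.
Qed.

Lemma intble_tail x' : intble (lam L) (fun s => chi s * ind_le (s, x')).
Proof.
apply: (@intble_dom _ mR R (lam L) _ (fun s => `|chi s|)).
- apply: measurable_funM; first exact: smooth_measurable.
  exact: measurable_fun_pair1 measurable_ind_le.
- by apply: integrable_norm; exact/continuous_intble/smooth_continuous.
- by move=> s; rewrite normrM ler_piMr// ind_le_norm.
Qed.

Lemma tail_bounded x' : `|tail x'| <= \int[lam L]_s `|chi s|.
Proof.
have ic : intble (lam L) chi by exact/continuous_intble/smooth_continuous.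
have h := @le_normr_Rintegral _ mR R (lam L) setT _ measurableT (intble_tail x').
apply: (le_trans h); apply: le_Rintegral => //.
- by apply: integrable_norm; exact: intble_tail.
- exact: (integrable_norm ic).
- by move=> s _; rewrite normrM ler_piMr// ind_le_norm.
Qed.

Lemma ker2P : bounded_kernel ker2.
Proof.
split; last first.
  exists (1 + \int[lam L]_s `|chi s|) => z.
  apply: (le_trans (ler_normB _ _)); apply: lerD; [exact: ind_le_norm|exact: tail_bounded].
apply: measurable_funB; first exact: measurable_ind_le.
apply: measurableT_comp; [exact: measurable_tail|exact: measurable_snd].
Qed.

Lemma sqint_tensor (a b : mR -> R) : smooth a -> sqint nu b ->
  sqint nu (fun x => b x ^+ 2) ->
  sqint (lam L \x nu)%E (fun z => a z.1 * b z.2).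
Proof.
move=> sa sb sb2; split.
  apply: measurable_funM.
    by apply: measurableT_comp; [exact: smooth_measurable|exact: measurable_fst].
  by apply: measurableT_comp; [exact: sb.1|exact: measurable_snd].
have ca : continuous (fun x => a x ^+ 2).
  by move=> x; apply: continuousM; exact: smooth_continuous.
have := sqintM (sqint_fst nu (continuous_sqint L ca)) (sqint_snd (lam L) sb2).
by apply: eq_integrable => // z _; rewrite /= exprMn.
Qed.

(** By [tensor_null] it suffices to test against [e z.1 * b z.2]. Moved to the test side, [ker1]
    turns [e] into [c * chi] with [c] the integral of [e], and [ker2] turns it into [- a], where [a]
    is the antiderivative of [e - c * chi] vanishing at [L]. The weak derivative identity for [a]
    then balances the terms. *)
Lemma kernel_rep (f g : mR * mR -> R) :
  sqint (lam L \x nu)%E f -> sqint (lam L \x nu)%E g ->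
  (forall a a' b, E a -> F b -> is_deriv a a' ->
    ip (lam L \x nu)%E f (fun z => a' z.1 * b z.2) =
    - ip (lam L \x nu)%E g (fun z => a z.1 * b z.2)) ->
  {ae (lam L \x nu)%E, forall z, f z = kerop (lam L) ker1 f z + kerop (lam L) ker2 g z}.
Proof.
move=> sf sg H.
have sK1 := sqint_kerop ker1P sf; have sK2 := sqint_kerop ker2P sg.
pose K := kerop (lam L) ker1 f + kerop (lam L) ker2 g.
have sK : sqint P K by exact: sqintD.
have sw : sqint P (f - K) by exact: sqintB.
have PF := prod_fin (lam L) nu.
suff h : {ae P, forall z, (f - K) z = 0}.
  apply: filterS h => z; rewrite -[X in X = 0]/(f z - (kerop (lam L) ker1 f z + kerop (lam L) ker2 g z)).
  by move=> h; apply/eqP; rewrite -subr_eq0; apply/eqP.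
apply: (tensor_null (sqint_intble PF sw) dE dF) => e b Ee Fb.
have se := Ec Ee; have sb := Fc Fb; have sb2 := F2 Fb.
have [a Ea [da aL]] := Ep Ee; have sa := Ec Ea.
pose c := \int[lam L]_s e s.
pose eb (z : mR * mR) := e z.1 * b z.2.
have s_eb : sqint P eb by exact: sqint_tensor.
have s_cb : sqint P (fun z => chi z.1 * b z.2) by exact: sqint_tensor.
have s_ab : sqint P (fun z => a z.1 * b z.2) by exact: sqint_tensor.
have ie : intble (lam L) e by exact/continuous_intble/smooth_continuous.
change (ip P (f - K) eb = 0).
rewrite (ipBl sf sK s_eb) (ipDl sK1 sK2 s_eb) ![ip _ (kerop _ _ _) _]ipC.
rewrite (kerop_adjoint ker1P s_eb sf) (kerop_adjoint ker2P s_eb sg).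
have -> : ip P (kerop (lam L) (ktr ker1) eb) f = c * ip P (fun z => chi z.1 * b z.2) f.
  rewrite -ipZl//; congr ip; apply/funext => z; rewrite /kerop /ktr /ker1/= /eb/=.
  rewrite [LHS](_ : _ = \int[lam L]_x ((chi z.1 * b z.2) * e x)).
    by rewrite RintegralZl// mulrC.
  by apply: eq_Rintegral => x _; ring.
have -> : ip P (kerop (lam L) (ktr ker2) eb) g = - ip P (fun z => a z.1 * b z.2) g.
  have -> : - ip P (fun z => a z.1 * b z.2) g = ip P (-1 *: (fun z => a z.1 * b z.2)) g.
    by rewrite ipZl// mulN1r.
  have s1 := sqint_kerop (ktrP ker2P) s_eb; have s2 := sqintZ (-1) s_ab.
  apply: ip_ae; [exact: s1.1|exact: s2.1|exact: sg.1|exact: sg.1| |exact: aeW].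
  apply: filterS (ae_prod_fst nu (ae_lam_cc L)) => -[x' y] /=.
  rewrite in_itv/= => xL.
  rewrite /kerop /ktr /eb /ker2/= fctE.
  have -> : -1 *: (a x' * b y) = (- a x') * b y by rewrite scaleN1r mulNr.
  have ii : intble (lam L) (fun x => e x * ind_le (x, x')).
    apply: (@intble_dom _ mR R (lam L) _ (fun s => `|e s|)).
    - apply: measurable_funM; first exact: smooth_measurable.
      exact: measurable_fun_pair1 measurable_ind_le.
    - exact: integrable_norm.
    - by move=> s; rewrite normrM ler_piMr// ind_le_norm.
  rewrite [LHS](_ : _ = \int[lam L]_x (b y * (e x * ind_le (x, x') - tail x' * e x))); last first.
    by apply: eq_Rintegral => x _; ring.
  rewrite RintegralZl//; last by apply: intbleB => //; exact: intbleZ.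
  rewrite mulrC; congr (_ * _).
  rewrite RintegralB//; last exact: intbleZ.
  rewrite RintegralZl// -/c.
  have -> : tail x' * c = \int[lam L]_x (c * (chi x * ind_le (x, x'))).
    by rewrite RintegralZl//; [rewrite mulrC|exact: intble_tail].
  rewrite -RintegralB//; last by apply: intbleZ; exact: intble_tail.
  rewrite [LHS](_ : _ = \int[lam L]_x ((e x - c * chi x) * ind_le (x, x'))); last first.
    by apply: eq_Rintegral => x _; ring.
  have cc : continuous (fun x => e x - c * chi x).
    by apply: smooth_continuous; apply: smoothB => //; exact: smoothZ.
  rewrite lam_tail// (FTC2_primitive _ cc da); last by case/andP: xL.
  by rewrite aL sub0r.
have := H a _ b Ea Fb da.
have -> : ip P f (fun z => (e z.1 - c * chi z.1) * b z.2) =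
    ip P f eb - c * ip P (fun z => chi z.1 * b z.2) f.
  rewrite ipC -(ipZl c s_cb sf) (ipC _ f eb) -ipBl//; last exact: sqintZ.
  by congr ip; apply/funext => z; rewrite /eb !fctE /GRing.scale/=; ring.
rewrite (ipC _ g) => h; rewrite opprD opprK addrA h; ring.
Qed.

End Representation.

(** * Weakly differentiable scalar functions on the cylinder *)

Section WeakTriples.
Variables (R : realType) (T : R).
Hypothesis T_gt0 : 0 < T.
Local Notation mR := (measurableTypeR R).
Local Notation P := (cylm T).
Implicit Types f g : mR * mR -> R.

(* Only tensor products serve as test functions here. *)
Definition wdiff f ft fh := [/\ sqint P f, sqint P ft, sqint P fh,
  forall a a' b, tbump T a -> pbump b -> is_deriv a a' ->
    ip P f (fun z => a' z.1 * b z.2) = - ip P ft (fun z => a z.1 * b z.2) &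
  forall a b b', tbump T a -> pbump b -> is_deriv b b' ->
    ip P f (fun z => a z.1 * b' z.2) = - ip P fh (fun z => a z.1 * b z.2)].

Lemma tbump_smooth e : tbump T e -> smooth e. Proof. by case. Qed.
Lemma pbump_smooth (e : R -> R) : pbump e -> smooth e. Proof. by case. Qed.

Lemma smooth_sqint (L : R) (e : R -> R) : smooth e -> sqint (lam L) e.
Proof. by move=> se; exact/continuous_sqint/smooth_continuous. Qed.

Lemma smooth_sqint2 (L : R) (e : R -> R) : smooth e -> sqint (lam L) (fun x => e x ^+ 2).
Proof. by move=> se; apply: smooth_sqint; exact: smoothM. Qed.

Lemma sqint_tensor_smooth a b : smooth a -> smooth b ->
  sqint P (fun z => a z.1 * b z.2).
Proof.
by move=> sa sb; apply: sqint_tensor => //; [exact: smooth_sqint|exact: smooth_sqint2].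
Qed.

(** The kernels are chosen before [f], since one pair has to serve a whole sequence. *)
Lemma rep_t : exists k1 k2 : mR * mR -> R, [/\ bounded_kernel k1, bounded_kernel k2 &
  forall f ft fh, wdiff f ft fh ->
    {ae P, forall z, f z = kerop (lam T) k1 f z + kerop (lam T) k2 ft z}].
Proof.
have [chi [tchi chi1 chiM]] := exists_chi T_gt0; have sc := tbump_smooth tchi.
exists (ker1 chi), (ker2 T chi); split; first exact: ker1P.
  exact: ker2P.
move=> f ft fh [sf sft _ wt _].
apply: (@kernel_rep R T (lam (2 * pi)) (tbump T) (@pbump R) chi).
- exact: tbump_smooth.
- by move=> e /pbump_smooth; exact: smooth_sqint.
- by move=> e /pbump_smooth; exact: smooth_sqint2.
- exact: ray_dense_tbump.
- exact: ray_dense_pbump.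
- exact: sc.
- exact: chiM.
- exact: has_primitives_tbump.
- exact: sf.
- exact: sft.
- by move=> a a' b ta pb da; exact: wt.
Qed.

Definition chi0 : R -> R := fun=> (2 * pi)^-1.

Lemma chi0_bounded : exists M : R, forall x, `|chi0 x| <= M.
Proof. by exists `|(2 * pi)^-1|. Qed.

Lemma ip_swap (f g : mR * mR -> R) : measurable_fun setT f -> measurable_fun setT g ->
  ip (lam (2 * pi) \x lam T)%E (f \o @pswap mR mR) (g \o @pswap mR mR) = ip P f g.
Proof.
move=> mf mg; have mfg : measurable_fun setT (fun z => f z * g z) by exact: measurable_funM.
exact: (Rintegral_swap (lam T) (lam (2 * pi)) mfg).
Qed.

Lemma rep_th f ft fh : wdiff f ft fh ->
  {ae P, forall z, f z = kerop2 (lam (2 * pi)) (ker1 chi0) f z +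
                         kerop2 (lam (2 * pi)) (ker2 (2 * pi) chi0) fh z}.
Proof.
move=> [sf _ sfh _ wh].
have := @kernel_rep R (2 * pi) (lam T) (@pbump R) (tbump T) chi0
  (@pbump_smooth) (fun e te => smooth_sqint T (tbump_smooth te))
  (fun e te => smooth_sqint2 T (tbump_smooth te)) (@ray_dense_pbump R)
  (@ray_dense_tbump R T T_gt0) (smooth_cst _) chi0_bounded (@has_primitives_pbump R)
  (f \o @pswap mR mR) (fh \o @pswap mR mR) (sqint_swap sf) (sqint_swap sfh).
move=> H; suff h : forall a a' b, pbump a -> tbump T b -> is_deriv a a' ->
    ip (lam (2 * pi) \x lam T)%E (f \o @pswap mR mR) (fun z => a' z.1 * b z.2) =
    - ip (lam (2 * pi) \x lam T)%E (fh \o @pswap mR mR) (fun z => a z.1 * b z.2).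
  by apply: filterS (ae_swap (H h)) => -[x y].
move=> {H} a a' b pa tb da.
have sa := pbump_smooth pa; have sb := tbump_smooth tb.
have sa' : continuous a'.
  have [a2 sa2 da2] := smooth_deriv sa.
  have -> : a' = a2; last exact: smooth_continuous.
  by apply/funext => x; have [_ <-] := da x; have [_ <-] := da2 x.
have ma' : measurable_fun setT (fun z : mR * mR => b z.1 * a' z.2).
  apply: measurable_funM.
    by apply: measurableT_comp; [exact: smooth_measurable|exact: measurable_fst].
  by apply: measurableT_comp; [exact: continuous_measurable|exact: measurable_snd].
have ma : measurable_fun setT (fun z : mR * mR => b z.1 * a z.2).
  exact: (sqint_tensor_smooth sb sa).1.
have -> : (fun z : mR * mR => a' z.1 * b z.2) = (fun z : mR * mR => b z.1 * a' z.2) \o @pswap mR mR.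
  by apply/funext => z; rewrite /= mulrC.
have -> : (fun z : mR * mR => a z.1 * b z.2) = (fun z : mR * mR => b z.1 * a z.2) \o @pswap mR mR.
  by apply/funext => z; rewrite /= mulrC.
by rewrite !ip_swap ?sf.1 ?sfh.1//; [exact: wh|exact: sfh.1|exact: sf.1].
Qed.

Lemma lam_setT (L : R) : 0 < L -> lam L setT = L%:E.
Proof.
move=> L0; rewrite lamE setTI.
by have := lebesgue_measure_itv `[0, L]; rewrite /= lte_fin L0 -EFinB subr0.
Qed.

Lemma ae_lam_cst (L : R) (Q : Prop) : 0 < L -> {ae lam L, forall x : mR, Q} -> Q.
Proof.
move=> L0 [N [mN N0 QN]]; apply: contrapT => nQ.
have NT : N = setT by apply/seteqP; split => // x _; exact: QN.
by move: N0; rewrite NT lam_setT// => -[L0']; rewrite L0' ltxx in L0.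
Qed.

Lemma ray_dense_bounded (m : {finite_measure set mR -> \bar R}) (E : (R -> R) -> Prop) :
  ray_dense m E -> ray_dense m (fun e => E e /\ forall x, `|e x| <= 1).
Proof. by move=> dE A rA; have [e [e1 e2 e3 e4]] := dE _ rA; exists e; split. Qed.

(** A test function of [t] alone has zero derivative in [th], so the mean of [fh] over the circle
    pairs to 0 with all of them. This is the weak form of f(t, 0) = f(t, 2 pi). *)
Lemma mean_zero f ft fh : wdiff f ft fh ->
  {ae lam T, forall t, \int[lam (2 * pi)]_y fh (t, y) = 0}.
Proof.
move=> [sf _ sfh _ wh]; have PF := prod_fin (lam T) (lam (2 * pi)).
have ifh := sqint_intble PF sfh.
have im := intble_Rintegral_snd ifh; have mm := intble_measurable im.
pose m (t : mR) := \int[lam (2 * pi)]_y fh (t, y).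
have iw : intble P (fun z => m z.1).
  apply/integrableP; split.
    by apply/measurable_EFinP; apply: measurableT_comp => //; exact: measurable_fst.
  have mabs : measurable_fun setT (fun z : mR * mR => `|m z.1|%:E).
    apply/measurable_EFinP; apply: measurableT_comp => //.
    by apply: measurableT_comp => //; exact: measurable_fst.
  rewrite (fubini_tonelli2 (fun z : mR * mR => `|m z.1|%:E))//.
  have iam := integrable_norm im.
  rewrite /fubini_G/= EFin_Rintegral// integral_cst//.
  apply: lte_mul_pinfty => //; last by rewrite -ge0_fin_numE ?fin_num_measure.
  by rewrite lee_fin Rintegral_ge0.
have : {ae P, forall z, m z.1 = 0}.
  (* Test functions bounded by 1 keep the products with the merely integrable [m] integrable. *)
  apply: (tensor_null iw (ray_dense_bounded (@ray_dense_tbump R T T_gt0))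
    (ray_dense_bounded (@ray_dense_pbump R))) => e b [te e1] [pb b1].
  have se := tbump_smooth te; have sb := pbump_smooth pb.
  have se1 := sqint_tensor_smooth se (smooth_cst 1).
  have iF := sqintM sfh se1.
  have h := wh e (fun=> 1) (fun=> 0) te (pbump_cst 1) (is_deriv_cst 1).
  have z0 : ip P fh (fun z => e z.1 * 1) = 0.
    have : ip P f (fun z => e z.1 * 0) = 0.
      rewrite /ip; under eq_Rintegral do rewrite !mulr0.
      by rewrite Rintegral_cst ?mul0r.
    by rewrite h => /eqP; rewrite oppr_eq0 => /eqP.
  have mt := (sqint_tensor_smooth se sb).1.
  have iE : intble P (fun z : mR * mR => m z.1 * (e z.1 * b z.2)).
    apply: (@intble_dom _ (mR * mR)%type R P _ (fun z => `|m z.1|)).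
    - by apply: measurable_funM => //; exact: intble_measurable iw.
    - exact: (integrable_norm iw).
    - by move=> z; rewrite !normrM ler_piMr// -[leRHS]mul1r ler_pM.
  rewrite (RFubini_snd iE).
  have iem : intble (lam T) (fun x : mR => e x * m x).
    apply: (@intble_dom _ mR R (lam T) _ (fun x => `|m x|)).
    - by apply: measurable_funM => //; exact: smooth_measurable.
    - exact: (integrable_norm im).
    - by move=> x; rewrite normrM ler_piMl.
  rewrite [LHS](_ : _ = \int[lam T]_x ((\int[lam (2 * pi)]_y b y) * (e x * m x))); last first.
    apply: eq_Rintegral => x _ /=.
    rewrite [LHS](_ : _ = \int[lam (2 * pi)]_y ((m x * e x) * b y)); last first.
      by apply: eq_Rintegral => y _; ring.
    rewrite RintegralZl//; first by ring.
    exact/continuous_intble/smooth_continuous.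
  rewrite RintegralZl// (_ : \int[lam T]_x (e x * m x) = 0) ?mulr0//.
  rewrite -[RHS]z0 /ip (RFubini_snd iF); apply: Rintegral_ae.
  - exact: intble_measurable iem.
  - exact: measurable_Rintegral_snd (intble_measurable iF).
  - apply: filterS (intble_section_snd ifh) => x ix /=.
    rewrite [RHS](_ : _ = \int[lam (2 * pi)]_y (e x * fh (x, y))).
      by rewrite RintegralZl.
    by apply: eq_Rintegral => y _; ring.
move=> /ae_prod_section; apply: filterS => t h.
exact: (@ae_lam_cst _ (m t = 0) (pi2_gt0 R) h).
Qed.

End WeakTriples.

(** * The periodic linear equation *)

Section PeriodicODE.
Variables (R : realType) (L : R).
Hypothesis L_gt0 : 0 < L.
Local Notation mR := (measurableTypeR R).
Local Notation leb := (@lebesgue_measure R).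
Local Notation mu := (lam L).

Lemma lam_fin : (mu setT < +oo)%E.
Proof. exact: fin_setT. Qed.

Lemma intble_bmul (f g : mR -> R) (M : R) : measurable_fun setT f ->
  (forall x, `|f x| <= M) -> intble mu g -> intble mu (fun x => f x * g x).
Proof.
move=> mf fM ig; have mg := intble_measurable ig.
apply: (@intble_dom _ mR R mu _ (fun x => M * `|g x|)).
- exact: measurable_funM.
- by apply: intbleZ; exact: (integrable_norm ig).
- by move=> x; rewrite normrM ler_wpM2r.
Qed.

Lemma ind_le_measurable (th : mR) : measurable_fun setT (fun s : mR => ind_le (th, s)).
Proof. by apply: (measurable_fun_pair2 th); exact: measurable_ind_le. Qed.

Lemma ind_le_measurable2 (r : mR) : measurable_fun setT (fun s : mR => ind_le (s, r)).
Proof. by apply: (measurable_fun_pair1 r); exact: measurable_ind_le. Qed.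

Lemma intble_ind (th : mR) (g : mR -> R) : intble mu g ->
  intble mu (fun s => ind_le (th, s) * g s).
Proof.
by apply: (@intble_bmul _ _ 1); [exact: ind_le_measurable|move=> s; exact: ind_le_norm].
Qed.

Lemma lam_segment (r th : R) (h : R -> R) : 0 <= r -> th <= L -> continuous h ->
  \int[mu]_s (ind_le (th, s) * ind_le (s, r) * h s) =
  ind_le (th, r) * \int[leb]_(s in `[r, th]) h s.
Proof.
move=> r0 thL ch; rewrite Rintegral_lam; last first.
  apply: measurable_funM; last exact: continuous_measurable.
  by apply: measurable_funM; [exact: ind_le_measurable|exact: ind_le_measurable2].
rewrite {3}/ind_le /=; case: (leP r th) => rth; last first.
  rewrite mul0r; transitivity (\int[leb]_(s in `[0, L]) (0 : R)); last first.
    by rewrite Rintegral_cst ?mul0r.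
  apply: eq_Rintegral => s _.
  rewrite /ind_le/=; case: ifP => h1; rewrite ?mul0r// mul1r.
  by case: ifP => h2; rewrite ?mul0r//; move: (le_trans h2 h1); rewrite leNgt rth.
rewrite mul1r [LHS]Rintegral_mkcond [RHS]Rintegral_mkcond; apply: eq_Rintegral => s _.
rewrite !patchE /ind_le/=.
have [sI|sI] := boolP (s \in [set` `[r, th]]).
  move: sI; rewrite inE/= in_itv/= => /andP[h1 h2].
  by rewrite mem_set ?h1 ?h2 ?mul1r//= in_itv/= (le_trans h2 thL) (le_trans r0 h1).
case: ifP => // _; case: ifP => h1; rewrite ?mul0r//.
case: ifP => h2; rewrite ?mulr0 ?mul0r//.
by move/negP: sI; case; rewrite inE/= in_itv/= h1 h2.
Qed.

(** On [[0, L]], the absolutely continuous function with value [A] at 0 and derivative [g]. *)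
Definition prim (A : R) (g : mR -> R) (s : mR) : R := A + \int[mu]_r (ind_le (s, r) * g r).

Lemma measurable_prim A g : measurable_fun setT g -> measurable_fun setT (prim A g).
Proof.
move=> mg; apply: measurable_funD => //.
apply: (@measurable_Rintegral_snd _ _ mR mR R mu (fun z => ind_le z * g z.2)).
apply: measurable_funM; first exact: measurable_ind_le.
by apply: measurableT_comp => //; exact: measurable_snd.
Qed.

Lemma prim_bounded A g s : intble mu g -> `|prim A g s| <= `|A| + \int[mu]_r `|g r|.
Proof.
move=> ig; apply: (le_trans (ler_normD _ _)); rewrite lerD2l.
have ii := intble_ind s ig.
apply: (le_trans (@le_normr_Rintegral _ mR R mu setT _ measurableT ii)).
apply: le_Rintegral => //.
- exact: (integrable_norm ii).
- exact: (integrable_norm ig).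
- by move=> r _; rewrite normrM ler_piMl// ind_le_norm.
Qed.

Lemma intble_prim A g : intble mu g -> intble mu (prim A g).
Proof.
move=> ig; apply: (@bounded_intble _ mR R mu lam_fin _ (`|A| + \int[mu]_r `|g r|)).
  exact: measurable_prim (intble_measurable ig).
by move=> s; exact: prim_bounded.
Qed.

(* Integration by parts against phi, for merely integrable g: this is Fubini. *)
Lemma prim_byparts (A : R) (g : mR -> R) (phi phi' : R -> R) (M : R) (th : R) :
  intble mu g -> is_deriv phi phi' -> continuous phi' ->
  (forall x, `|phi x| <= M) -> (forall x, `|phi' x| <= M) ->
  0 <= th <= L ->
  phi th * prim A g th - phi 0 * A =
  \int[mu]_s (ind_le (th, s) * (phi s * g s)) +
  \int[mu]_s (ind_le (th, s) * (phi' s * prim A g s)).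
Proof.
move=> ig dphi cphi' phiM phi'M /andP[th0 thL].
have mg := intble_measurable ig.
have mphi := continuous_measurable (is_deriv_continuous dphi).
have mphi' := continuous_measurable cphi'.
have iphi' : intble mu phi' by exact: (bounded_intble lam_fin mphi' phi'M).
have ipg : intble mu (fun s => phi s * g s) by exact: (intble_bmul mphi phiM ig).
pose G s := \int[mu]_r (ind_le (s, r) * g r).
have e1 : \int[mu]_s (ind_le (th, s) * (phi' s * prim A g s)) =
   A * \int[mu]_s (ind_le (th, s) * phi' s) + \int[mu]_s (ind_le (th, s) * (phi' s * G s)).
  have i1 := intbleZ A (intble_ind th iphi').
  have iG : intble mu G.
    have := intble_prim 0 ig; apply: eq_integrable => // s _ /=.
    by rewrite /prim add0r.
  have i2 := intble_ind th (intble_bmul mphi' phi'M iG).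
  rewrite -RintegralZl//; last exact: intble_ind.
  rewrite -RintegralD//; apply: eq_Rintegral => s _; rewrite /prim -/(G s); ring.
have e2 : \int[mu]_s (ind_le (th, s) * phi' s) = phi th - phi 0.
  rewrite -(FTC2_primitive th0 cphi' dphi) -[RHS]mul1r.
  have -> : 1 = ind_le (th, 0) :> R by rewrite /ind_le/= th0.
  rewrite -(lam_segment (lexx 0) thL cphi'); apply: Rintegral_ae.
  - by apply: measurable_funM => //; exact: ind_le_measurable.
  - apply: measurable_funM => //; apply: measurable_funM; first exact: ind_le_measurable.
    exact: ind_le_measurable2.
  - apply: filterS (ae_lam L) => s /andP[s0 _].
    by rewrite {3}/ind_le/= (ltW s0) mulr1.
(* Fubini: the double integral of [phi' s * g r] over 0 <= r <= s <= th is evaluated in [s]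
   first. *)
have e3 : \int[mu]_s (ind_le (th, s) * (phi' s * G s)) =
    \int[mu]_r (ind_le (th, r) * (phi th - phi r) * g r).
  pose H (w : mR * mR) := (ind_le (th, w.1) * phi' w.1) * (ind_le w * g w.2).
  have iH : intble (mu \x mu)%E H.
    have ig2 : intble (mu \x mu)%E (fun w => g w.2).
      apply/integrableP; split.
        by apply/measurable_EFinP; apply: measurableT_comp => //; exact: measurable_snd.
      have mabs : measurable_fun setT (fun z : mR * mR => `|g z.2|%:E).
        apply/measurable_EFinP; apply: measurableT_comp => //.
        by apply: measurableT_comp => //; exact: measurable_snd.
      rewrite (fubini_tonelli1 (fun z : mR * mR => `|g z.2|%:E))//.
      rewrite /fubini_F/= (EFin_Rintegral (integrable_norm ig)) integral_cst//.
      apply: lte_mul_pinfty; [|by []|exact: lam_fin].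
      by rewrite lee_fin; apply: Rintegral_ge0 => r _ /=.
    apply: (@intble_dom _ (mR * mR)%type R (mu \x mu)%E _ (fun w => M * `|g w.2|)).
    - apply: measurable_funM.
        apply: (@measurableT_comp _ _ _ _ _ _ (fun s : mR => ind_le (th, s) * phi' s)).
          by apply: measurable_funM => //; exact: ind_le_measurable.
        exact: measurable_fst.
      apply: measurable_funM; first exact: measurable_ind_le.
      exact: intble_measurable ig2.
    - by apply: intbleZ; exact: (integrable_norm ig2).
    - move=> w; rewrite !normrM.
      have := phi'M w.1; have := ind_le_norm (th, w.1); have := ind_le_norm w.
      move: (normr_ge0 (ind_le w)) (normr_ge0 (phi' w.1)) (normr_ge0 (g w.2)) (normr_ge0 (ind_le (th, w.1))).
      move: `|ind_le w| `|phi' w.1| `|g w.2| `|ind_le (th, w.1)| => a b c d a0 b0 c0 d0 a1 d1 bM.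
      by rewrite mulrA ler_wpM2r// (@le_trans _ _ (d * b))// ?ler_piMr ?mulr_ge0// (le_trans _ bM)// ler_piMl.
  transitivity (\int[(mu \x mu)%E]_w H w).
    rewrite (RFubini_snd iH); apply: eq_Rintegral => s _.
    by rewrite mulrA /G -RintegralZl//; exact: intble_ind.
  rewrite (RFubini_fst iH); apply: Rintegral_ae.
  - exact: measurable_Rintegral_fst (intble_measurable iH).
  - apply: measurable_funM => //; apply: measurable_funM; first exact: ind_le_measurable.
    exact: measurable_funB.
  - apply: filterS (ae_lam L) => r /andP[r0 rL].
    have h := lam_segment (ltW r0) thL cphi'.
    have [rth|rth] := leP r th.
      rewrite (FTC2_primitive rth cphi' dphi) in h; rewrite -h -RintegralZr//.
        by apply: eq_Rintegral => s _; rewrite /H/=; ring.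
      apply: (@intble_dom _ mR R mu _ (fun=> M)).
      - apply: measurable_funM => //; apply: measurable_funM; first exact: ind_le_measurable.
        exact: ind_le_measurable2.
      - exact: (intble_cst lam_fin).
      - move=> s; rewrite !normrM; apply: le_trans (phi'M s).
        by rewrite ler_piMl// mulr_ile1// ind_le_norm.
    have z : ind_le (th, r) = 0 :> R by rewrite /ind_le/= leNgt rth.
    rewrite z !mul0r; rewrite z mul0r in h.
    rewrite [LHS](_ : _ = \int[mu]_s (g r * (ind_le (th, s) * ind_le (s, r) * phi' s))); last first.
      by apply: eq_Rintegral => s _; rewrite /H/=; ring.
    rewrite RintegralZl ?h ?mulr0//.
    apply: (@intble_dom _ mR R mu _ (fun=> M)).
    - apply: measurable_funM => //; apply: measurable_funM; first exact: ind_le_measurable.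
      exact: ind_le_measurable2.
    - exact: (intble_cst lam_fin).
    - move=> s; rewrite !normrM; apply: le_trans (phi'M s).
      by rewrite ler_piMl// mulr_ile1// ind_le_norm.
rewrite e1 e2 e3.
have e4 : \int[mu]_r (ind_le (th, r) * (phi th - phi r) * g r) =
   phi th * G th - \int[mu]_s (ind_le (th, s) * (phi s * g s)).
  rewrite /G -RintegralZl//; last exact: intble_ind.
  rewrite -RintegralB//; last 2 first.
  - by apply: intbleZ; exact: intble_ind.
  - exact: intble_ind.
  by apply: eq_Rintegral => r _; ring.
by rewrite e4 /prim -/(G th); ring.
Qed.

End PeriodicODE.

Section RotatedODE.
Variables (R : realType) (L kappa : R).
Hypothesis L_gt0 : 0 < L.
Local Notation mR := (measurableTypeR R).
Local Notation mu := (lam L).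

(** This is how periodicity enters: a derivative of mean 0 brings the function back to its initial
    value. *)
Lemma prim_end A g : intble mu g -> \int[mu]_s g s = 0 -> prim L A g L = A.
Proof.
move=> ig g0; rewrite /prim -[RHS]addr0 -g0; congr (_ + _).
apply: Rintegral_ae.
- by apply: measurable_funM; [exact: ind_le_measurable|exact: intble_measurable ig].
- exact: intble_measurable ig.
- by apply: filterS (ae_lam L) => s /andP[_ sL]; rewrite /ind_le/= (ltW sL) mul1r.
Qed.

(* With phi = cos (kappa x), psi = sin (kappa x), the combination
   phi x + psi y is the real part of exp(-i kappa th) (x + i y), whose derivative
   is the rotated defect. *)
Lemma rotated_prim (A1 A2 : R) (g1 g2 : mR -> R) (phi psi : R -> R) (th : R) :
  intble mu g1 -> intble mu g2 ->
  is_deriv phi (fun x => - kappa * psi x) -> is_deriv psi (fun x => kappa * phi x) ->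
  (forall x, `|phi x| <= 1) -> (forall x, `|psi x| <= 1) -> 0 <= th <= L ->
  `|phi th * prim L A1 g1 th + psi th * prim L A2 g2 th - (phi 0 * A1 + psi 0 * A2)| <=
  \int[mu]_s `|g1 s + kappa * prim L A2 g2 s| + \int[mu]_s `|g2 s - kappa * prim L A1 g1 s|.
Proof.
move=> i1 i2 dphi dpsi phi1 psi1 thL; pose M := 1 + `|kappa|.
have cphi : continuous phi by exact: is_deriv_continuous dphi.
have cpsi : continuous psi by exact: is_deriv_continuous dpsi.
have mphi := continuous_measurable cphi; have mpsi := continuous_measurable cpsi.
have c1 : continuous (fun x => - kappa * psi x).
  by move=> x; apply: cvgM; [exact: cvg_cst|exact: cpsi].
have c2 : continuous (fun x => kappa * phi x).
  by move=> x; apply: cvgM; [exact: cvg_cst|exact: cphi].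
have le1M (x : R) : `|x| <= 1 -> `|x| <= M.
  by move=> h; rewrite (le_trans h)// /M lerDl.
have leKM (x : R) : `|x| <= 1 -> `|kappa * x| <= M.
  by move=> h; rewrite normrM /M (le_trans (ler_piMr _ h))// lerDr.
have leKM' (x : R) : `|x| <= 1 -> `|- kappa * x| <= M.
  by move=> h; rewrite mulNr normrN; exact: leKM.
set x := prim L A1 g1; set y := prim L A2 g2.
have ix : intble mu x by exact: intble_prim.
have iy : intble mu y by exact: intble_prim.
have e1 := @prim_byparts R L A1 g1 phi _ M th i1 dphi c1 (fun s => le1M _ (phi1 s))
  (fun s => leKM' _ (psi1 s)) thL.
have e2 := @prim_byparts R L A2 g2 psi _ M th i2 dpsi c2 (fun s => le1M _ (psi1 s))
  (fun s => leKM _ (phi1 s)) thL.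
rewrite -/x -/y in e1 e2.
pose f1 s := g1 s + kappa * y s; pose f2 s := g2 s - kappa * x s.
have if1 : intble mu f1 by apply: intbleD => //; exact: intbleZ.
have if2 : intble mu f2 by apply: intbleB => //; exact: intbleZ.
have mc1 := continuous_measurable c1; have mc2 := continuous_measurable c2.
have iF1 := intble_ind th (intble_bmul mphi phi1 if1).
have iF2 := intble_ind th (intble_bmul mpsi psi1 if2).
have -> : phi th * x th + psi th * y th - (phi 0 * A1 + psi 0 * A2) =
    \int[mu]_s (ind_le (th, s) * (phi s * f1 s)) +
    \int[mu]_s (ind_le (th, s) * (psi s * f2 s)).
  transitivity ((phi th * x th - phi 0 * A1) + (psi th * y th - psi 0 * A2)); first by ring.
  have j1 := intble_ind th (intble_bmul mphi phi1 i1).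
  have j2 := intble_ind th (intble_bmul mpsi psi1 i2).
  have j3 := intble_ind th (intble_bmul mc1 (fun s => leKM' _ (psi1 s)) ix).
  have j4 := intble_ind th (intble_bmul mc2 (fun s => leKM _ (phi1 s)) iy).
  rewrite e1 e2 addrACA.
  rewrite -!RintegralD//; [|exact: (intbleD j1 j2)|exact: (intbleD j3 j4)].
  by apply: eq_Rintegral => s _; rewrite /f1 /f2; ring.
have bd (p : R -> R) (f : mR -> R) : (forall s, `|p s| <= 1) -> intble mu f ->
    intble mu (fun s => ind_le (th, s) * (p s * f s)) ->
    `|\int[mu]_s (ind_le (th, s) * (p s * f s))| <= \int[mu]_s `|f s|.
  move=> p1 jf ip; apply: (le_trans (@le_normr_Rintegral _ mR R mu setT _ measurableT ip)).
  apply: le_Rintegral => //.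
  - exact: (integrable_norm ip).
  - exact: (integrable_norm jf).
  - move=> s _; rewrite !normrM mulrA ler_piMl// mulr_ile1//; exact: ind_le_norm.
by rewrite (le_trans (ler_normD _ _))// lerD// bd.
Qed.

Lemma is_deriv_cosM : is_deriv (fun x => cos (kappa * x)) (fun x => - kappa * sin (kappa * x)).
Proof.
move=> x; have h1 : is_derive x 1 (fun x => kappa * x) kappa.
  by apply: is_derive_cast (is_deriveZ _ _) _; rewrite /GRing.scale/= mulr1.
have := @is_derive1_comp R cos (fun x => kappa * x) x _ _ (is_derive_cos _) h1.
by move=> h; apply: is_derive_cast h _; ring.
Qed.

Lemma is_deriv_sinM : is_deriv (fun x => sin (kappa * x)) (fun x => kappa * cos (kappa * x)).
Proof.
move=> x; have h1 : is_derive x 1 (fun x => kappa * x) kappa.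
  by apply: is_derive_cast (is_deriveZ _ _) _; rewrite /GRing.scale/= mulr1.
have := @is_derive1_comp R sin (fun x => kappa * x) x _ _ (is_derive_sin _) h1.
by move=> h; apply: is_derive_cast h _; ring.
Qed.

Lemma is_deriv_NsinM : is_deriv (fun x => - sin (kappa * x)) (fun x => - kappa * cos (kappa * x)).
Proof.
move=> x; rewrite mulNr; exact: (@is_deriveN _ _ _ _ _ _ _ (is_deriv_sinM x)).
Qed.

(* the determinant of (rotation by kappa * L) - 1 *)
Definition rot_gap : R := (cos (kappa * L) - 1) ^+ 2 + sin (kappa * L) ^+ 2.

Hypothesis gap_gt0 : 0 < rot_gap.

Lemma norm_cos_le1 (x : R) : `|cos x| <= 1.
Proof. by rewrite ler_norml cos_geN1 cos_le1. Qed.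

Lemma norm_sin_le1 (x : R) : `|sin x| <= 1.
Proof. by rewrite ler_norml sin_geN1 sin_le1. Qed.

(** At [th = L] periodicity turns the rotated estimate into a bound on the rotation minus the
    identity applied to [(A1, A2)], and inverting that matrix costs [rot_gap]. With the initial
    values controlled, the same estimate at [th] bounds the rotated pair, and rotations preserve the
    sum of squares. *)
Lemma periodic_prim_bound (A1 A2 F : R) (g1 g2 : mR -> R) (th : R) :
  intble mu g1 -> intble mu g2 -> \int[mu]_s g1 s = 0 -> \int[mu]_s g2 s = 0 ->
  0 <= th <= L ->
  F = \int[mu]_s `|g1 s + kappa * prim L A2 g2 s| +
      \int[mu]_s `|g2 s - kappa * prim L A1 g1 s| ->
  prim L A1 g1 th ^+ 2 + prim L A2 g2 th ^+ 2 <= 8 * (1 + 3 / rot_gap) ^+ 2 * F ^+ 2.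
Proof.
move=> i1 i2 z1 z2 thL FE.
have b1 s := @rotated_prim A1 A2 g1 g2 _ _ s i1 i2 is_deriv_cosM is_deriv_sinM
  (fun=> norm_cos_le1 _) (fun=> norm_sin_le1 _).
have nN (x : R) : `|- sin (kappa * x)| <= 1 by rewrite normrN norm_sin_le1.
have dc : is_deriv (fun x => cos (kappa * x)) (fun x => kappa * - sin (kappa * x)).
  by move=> x; apply: is_derive_cast (is_deriv_cosM x) _; ring.
have b2 s := @rotated_prim A1 A2 g1 g2 _ _ s i1 i2 is_deriv_NsinM dc
  nN (fun=> norm_cos_le1 _).
have F0 : 0 <= F.
  by rewrite FE; apply: addr_ge0; apply: Rintegral_ge0 => s _; exact: normr_ge0.
move: (b1 L) (b2 L) (b1 th thL) (b2 th thL).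
rewrite -FE !(prim_end _ i1 z1) !(prim_end _ i2 z2) lexx (ltW L_gt0).
move=> /(_ isT) + /(_ isT).
rewrite mulr0 sin0 cos0 oppr0 !mul0r !mul1r !add0r !addr0.
have D := gap_gt0.
have : rot_gap = (cos (kappa * L) - 1) ^+ 2 + sin (kappa * L) ^+ 2 by [].
have := norm_cos_le1 (kappa * L); have := norm_sin_le1 (kappa * L).
have := cos2Dsin2 (kappa * th).
have := norm_cos_le1 (kappa * th); have := norm_sin_le1 (kappa * th).
move: F0 D; clear b1 b2 FE; move: (prim _ _ _ _) (prim _ _ _ _) (cos _) (sin _) (cos _) (sin _).
move: rot_gap => D y x C S c s F0 D0 s1 c1 cs S1 C1 DE a1 a2 p1 p2.
have D1 : D != 0 by rewrite gt_eqF.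
(* Cramer's rule for the rotation minus the identity, of determinant [D]. Its entries are at most 2
   and 1 in absolute value, hence the 3. *)
have k1 : `|D * A1| <= 3 * F.
  have -> : D * A1 = (C - 1) * (C * A1 + S * A2 - A1) - S * (- S * A1 + C * A2 - A2).
    by rewrite DE; ring.
  rewrite (le_trans (ler_normB _ _))// !normrM.
  have : `|C - 1| <= 2 by move: C1; rewrite !ler_norml; lra.
  move=> hC; have := ler_pM (normr_ge0 _) (normr_ge0 _) hC a1.
  have := ler_pM (normr_ge0 _) (normr_ge0 _) S1 a2; lra.
have k2 : `|D * A2| <= 3 * F.
  have -> : D * A2 = S * (C * A1 + S * A2 - A1) + (C - 1) * (- S * A1 + C * A2 - A2).
    by rewrite DE; ring.
  rewrite (le_trans (ler_normD _ _))// !normrM.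
  have : `|C - 1| <= 2 by move: C1; rewrite !ler_norml; lra.
  move=> hC; have := ler_pM (normr_ge0 _) (normr_ge0 _) hC a2.
  have := ler_pM (normr_ge0 _) (normr_ge0 _) S1 a1; lra.
have l1 : `|A1| <= 3 / D * F.
  by move: k1; rewrite normrM (gtr0_norm D0) mulrAC -ler_pdivlMl// mulrC [3 * F * _]mulrC.
have l2 : `|A2| <= 3 / D * F.
  by move: k2; rewrite normrM (gtr0_norm D0) mulrAC -ler_pdivlMl// mulrC [3 * F * _]mulrC.
pose G := (1 + 3 / D) * F.
have P1 : `|c * x + s * y| <= G.
  have := le_trans (ler_normD (c * x + s * y - A1) A1) (lerD p1 l1).
  by rewrite subrK (_ : G = F + 3 / D * F)// /G; ring.
have P2 : `|- s * x + c * y| <= G.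
  have := le_trans (ler_normD (- s * x + c * y - A2) A2) (lerD p2 l2).
  by rewrite subrK (_ : G = F + 3 / D * F)// /G; ring.
have -> : x ^+ 2 + y ^+ 2 = `|c * x + s * y| ^+ 2 + `|- s * x + c * y| ^+ 2.
  rewrite !real_normK ?num_real//.
  transitivity ((c ^+ 2 + s ^+ 2) * (x ^+ 2 + y ^+ 2)); first by rewrite cs mul1r.
  by ring.
have G0 : 0 <= G by rewrite (le_trans _ P1).
have -> : 8 * (1 + 3 / D) ^+ 2 * F ^+ 2 = 8 * G ^+ 2 by rewrite /G; ring.
have q1 := lerXn2r 2 (normr_ge0 _ : _ \is Num.nneg) (G0 : G \is Num.nneg) P1.
have q2 := lerXn2r 2 (normr_ge0 _ : _ \is Num.nneg) (G0 : G \is Num.nneg) P2.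
have := sqr_ge0 G; lra.
Qed.

Lemma sqr_norm1_le (f : mR -> R) : sqint mu f -> (\int[mu]_s `|f s|) ^+ 2 <= L * ip mu f f.
Proof.
move=> sf; have s1 := sqint_cst (lam_fin L) 1.
have := ip_CS (sqint_norm sf) s1.
have -> : ip mu (fun s => `|f s|) (fun=> 1) = \int[mu]_s `|f s|.
  by apply: eq_Rintegral => s _; rewrite mulr1.
have -> : ip mu (fun s => `|f s|) (fun s => `|f s|) = ip mu f f.
  by apply: eq_Rintegral => s _; rewrite -normrM ger0_norm// -expr2 sqr_ge0.
have -> : ip mu (fun=> 1) (fun=> 1) = L by rewrite /ip Rintegral_lam_cst// !mul1r.
by rewrite mulrC.
Qed.

(** In the constant, the last [L] comes from integrating the pointwise bound and [2 * L] from
    passing from the L^1 norms of the two defects to their L^2 norms. *)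
Lemma periodic_ode_bound (A1 A2 : R) (g1 g2 x y : mR -> R) :
  sqint mu g1 -> sqint mu g2 -> sqint mu x -> sqint mu y ->
  \int[mu]_s g1 s = 0 -> \int[mu]_s g2 s = 0 ->
  {ae mu, forall s, x s = prim L A1 g1 s} -> {ae mu, forall s, y s = prim L A2 g2 s} ->
  let f1 := fun s => g1 s + kappa * y s in
  let f2 := fun s => g2 s - kappa * x s in
  \int[mu]_s (x s ^+ 2 + y s ^+ 2) <=
  (8 * (1 + 3 / rot_gap) ^+ 2 * (2 * L) * L) * \int[mu]_s (f1 s ^+ 2 + f2 s ^+ 2).
Proof.
move=> s1 s2 sx sy z1 z2 xE yE; cbv zeta.
have i1 := sqint_intble (lam_fin L) s1; have i2 := sqint_intble (lam_fin L) s2.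
set X := prim L A1 g1 in xE; set Y := prim L A2 g2 in yE.
have mX : measurable_fun setT X by exact: measurable_prim (intble_measurable i1).
have mY : measurable_fun setT Y by exact: measurable_prim (intble_measurable i2).
have sX : sqint mu X.
  by apply: (sqint_ae mX sx); apply: filterS xE => s ->.
have sY : sqint mu Y.
  by apply: (sqint_ae mY sy); apply: filterS yE => s ->.
pose f1 := g1 + kappa *: Y; pose f2 := g2 - kappa *: X.
have sf1 : sqint mu f1 by exact/sqintD/sqintZ.
have sf2 : sqint mu f2 by exact/sqintB/sqintZ.
have -> : \int[mu]_s (x s ^+ 2 + y s ^+ 2) = \int[mu]_s (X s ^+ 2 + Y s ^+ 2).
  apply: Rintegral_ae.
  - by apply: measurable_funD; apply: measurable_funX; [exact: sx.1|exact: sy.1].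
  - by apply: measurable_funD; apply: measurable_funX.
  - by apply: filterS2 xE yE => s -> ->.
have -> : \int[mu]_s ((g1 s + kappa * y s) ^+ 2 + (g2 s - kappa * x s) ^+ 2) =
    \int[mu]_s (f1 s ^+ 2 + f2 s ^+ 2).
  apply: Rintegral_ae.
  - apply: measurable_funD; apply: measurable_funX.
      by apply: measurable_funD; [exact: s1.1|apply: measurable_funM => //; exact: sy.1].
    by apply: measurable_funB; [exact: s2.1|apply: measurable_funM => //; exact: sx.1].
  - by apply: measurable_funD; apply: measurable_funX; [exact: sf1.1|exact: sf2.1].
  - by apply: filterS2 xE yE => s -> ->.
pose F := \int[mu]_s `|f1 s| + \int[mu]_s `|f2 s|.
pose K := 8 * (1 + 3 / rot_gap) ^+ 2.
have bd s : 0 <= s <= L -> X s ^+ 2 + Y s ^+ 2 <= K * F ^+ 2.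
  by move=> sL; exact: (periodic_prim_bound i1 i2 z1 z2 sL).
have iXY : intble mu (fun s => X s ^+ 2 + Y s ^+ 2) by exact: intbleD sX.2 sY.2.
have K0 : 0 <= K by rewrite /K mulr_ge0// sqr_ge0.
have le1 : \int[mu]_s (X s ^+ 2 + Y s ^+ 2) <= K * F ^+ 2 * L.
  rewrite -(Rintegral_lam_cst _ L_gt0).
  (* The bound is known on [[0, L]] only, while integrals are compared over the whole line.
     Truncation changes the integrand on a null set and makes the bound hold everywhere. *)
  rewrite [leLHS](_ : _ = \int[mu]_s Num.min (X s ^+ 2 + Y s ^+ 2) (K * F ^+ 2)); last first.
    apply: Rintegral_ae.
    - exact: intble_measurable iXY.
    - by apply: measurable_minr => //; exact: intble_measurable iXY.
    - apply: filterS (ae_lam L) => s /andP[s0 sL].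
      by rewrite min_l// bd// !ltW.
  apply: le_Rintegral => //.
  - apply: (@intble_dom _ mR R mu _ (fun s => X s ^+ 2 + Y s ^+ 2)) => //.
      by apply: measurable_minr => //; exact: intble_measurable iXY.
    move=> s; rewrite ger0_norm ?ge_min ?lexx// le_min addr_ge0 ?sqr_ge0//=.
    by rewrite mulr_ge0// sqr_ge0.
  - exact: (intble_cst (lam_fin L)).
  - by move=> s _; rewrite ge_min lexx orbT.
apply: (le_trans le1).
have -> : \int[mu]_s (f1 s ^+ 2 + f2 s ^+ 2) = ip mu f1 f1 + ip mu f2 f2.
  by rewrite RintegralD//; [exact: sf1.2|exact: sf2.2].
have h1 := sqr_norm1_le sf1; have h2 := sqr_norm1_le sf2.
have FF : F ^+ 2 <= 2 * L * (ip mu f1 f1 + ip mu f2 f2).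
  move: h1 h2; rewrite /F; move: (\int[mu]_s `|f1 s|) (\int[mu]_s `|f2 s|) => a b h1 h2.
  have := sqr_ge0 (a - b); have := sqrrD a b; have := sqrrB a b.
  move: ((a - b) ^+ 2) ((a + b) ^+ 2) => p q; lra.
rewrite -/K (_ : K * (2 * L) * L * _ = K * (2 * L * (ip mu f1 f1 + ip mu f2 f2)) * L).
  by rewrite ler_wpM2r ?ler_wpM2l// ltW.
by ring.
Qed.

End RotatedODE.

(** * The linear equation on almost every circle *)

Section WeakODE.
Variables (R : realType) (T : R).
Hypothesis T_gt0 : 0 < T.
Local Notation mR := (measurableTypeR R).
Local Notation P := (cylm T).
Local Notation nu := (lam (2 * pi)).

(** In the representation of [f] by kernels in [th], the terms that do not involve [th] make up the
    constant [A]. *)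
Lemma wdiff_section_prim (f ft fh : mR * mR -> R) : wdiff T f ft fh ->
  {ae lam T, forall t, exists A,
     {ae nu, forall th, f (t, th) = prim (2 * pi) A (fun s => fh (t, s)) th}}.
Proof.
move=> W; have [sf _ sfh _ _] := W.
have ifh := intble_section_snd (sqint_intble (prod_fin _ _) sfh).
have ifp := ae_prod_section (rep_th T_gt0 W).
have sc : smooth (@chi0 R) by exact: smooth_cst.
apply: filterS2 ifh ifp => t ih h; pose tl := tail (2 * pi) (@chi0 R).
exists (\int[nu]_s (chi0 s * f (t, s)) - \int[nu]_s (tl s * fh (t, s))).
apply: filterS h => th ->; rewrite /prim -addrA; congr (_ + _).
have it : intble nu (fun s => tl s * fh (t, s)).
  apply: (intble_bmul _ _ ih); first exact: measurable_tail.
  exact: tail_bounded.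
rewrite addrC -RintegralB//; last exact: intble_ind.
by apply: eq_Rintegral => s _; rewrite /ker2/= mulrBl.
Qed.

Variable kappa : R.
Hypothesis gap_gt0 : 0 < rot_gap (2 * pi) kappa.

(** For u = x + i y and c = i kappa, the two combinations on the right are the real and imaginary
    parts of u_theta - c u. The bound on each circle is integrated over [t]. *)
Lemma wdiff_rot_bound : exists2 K : R, 0 <= K & forall x xt xh y yt yh : mR * mR -> R,
  wdiff T x xt xh -> wdiff T y yt yh ->
  ip P x x + ip P y y <=
  K * (ip P (xh + kappa *: y) (xh + kappa *: y) + ip P (yh - kappa *: x) (yh - kappa *: x)).
Proof.
pose K := 8 * (1 + 3 / rot_gap (2 * pi) kappa) ^+ 2 * (2 * (2 * pi)) * (2 * pi).
have K0 : 0 <= K.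
  rewrite /K; have := sqr_ge0 (1 + 3 / rot_gap (2 * pi) kappa); move: (_ ^+ 2) => q q0.
  by rewrite !mulr_ge0// pi_ge0.
exists K => // x xt xh y yt yh Wx Wy.
have [sx _ sxh _ _] := Wx; have [sy _ syh _ _] := Wy.
pose f1 := xh + kappa *: y; pose f2 := yh - kappa *: x.
have s1 : sqint P f1 by exact/sqintD/sqintZ.
have s2 : sqint P f2 by exact/sqintB/sqintZ.
have ixy : intble P (fun z => x z ^+ 2 + y z ^+ 2) by exact: intbleD sx.2 sy.2.
have iff : intble P (fun z => f1 z ^+ 2 + f2 z ^+ 2) by exact: intbleD s1.2 s2.2.
have e1 : ip P x x + ip P y y = \int[P]_z (x z ^+ 2 + y z ^+ 2).
  by rewrite RintegralD//; [exact: sx.2|exact: sy.2].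
have e2 : ip P f1 f1 + ip P f2 f2 = \int[P]_z (f1 z ^+ 2 + f2 z ^+ 2).
  by rewrite RintegralD//; [exact: s1.2|exact: s2.2].
rewrite -/f1 -/f2 e1 e2 (RFubini_snd ixy) (RFubini_snd iff).
have iX := intble_Rintegral_snd ixy; have iF := intble_Rintegral_snd iff.
rewrite -RintegralZl//.
rewrite [leLHS](_ : _ = \int[lam T]_t Num.min (\int[nu]_th (x (t, th) ^+ 2 + y (t, th) ^+ 2))
   (K * \int[nu]_th (f1 (t, th) ^+ 2 + f2 (t, th) ^+ 2))); last first.
  apply: Rintegral_ae.
  - exact: intble_measurable iX.
  - apply: measurable_minr; first exact: intble_measurable iX.
    by apply: measurable_funM => //; exact: intble_measurable iF.
  have sec (f : mR * mR -> R) : sqint P f -> {ae lam T, forall t, sqint nu (fun s => f (t, s))}.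
    by move=> /sqint_swap/ae_sqint_section_fst.
  have px := wdiff_section_prim Wx; have py := wdiff_section_prim Wy.
  have zx := mean_zero T_gt0 Wx; have zy := mean_zero T_gt0 Wy.
  have b1 := sec _ sx; have b2 := sec _ sy; have b3 := sec _ sxh; have b4 := sec _ syh.
  have F : Filter (nbhs (almost_everywhere (lam T))) by exact: ae_filter_ringOfSetsType.
  have I p q := @filterI _ _ F p q.
  have Q := I _ _ px (I _ _ py (I _ _ zx (I _ _ zy (I _ _ b1 (I _ _ b2 (I _ _ b3 b4)))))).
  apply: (@filterS _ _ F _ _ _ Q) => t [[A1 p1] [[A2 p2] [q1 [q2 [r1 [r2 [r3 r4]]]]]]].
  rewrite min_l//.
  exact: (periodic_ode_bound (pi2_gt0 R) gap_gt0 r3 r4 r1 r2 q1 q2 p1 p2).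
apply: le_Rintegral => //.
- apply: (@intble_dom _ mR R (lam T) _
    (fun t => \int[nu]_th (x (t, th) ^+ 2 + y (t, th) ^+ 2))) => //.
    apply: measurable_minr; first exact: intble_measurable iX.
    by apply: measurable_funM => //; exact: intble_measurable iF.
  have R0 (f g : mR -> R) : 0 <= \int[nu]_th (f th ^+ 2 + g th ^+ 2).
    by apply: Rintegral_ge0 => th _; rewrite addr_ge0 ?sqr_ge0.
  move=> t; rewrite ger0_norm ?ge_min ?lexx// le_min R0/= mulr_ge0//; exact: R0.
- exact: intbleZ.
- by move=> t _; rewrite ge_min lexx orbT.
Qed.

End WeakODE.

(** * Families of square-integrable functions and Sobolev maps *)

(** The fractional part [f] of [kappa] lies strictly between 0 and 1, so [sin (f * pi)] is positive
    and the cosine of [2 * pi * kappa] differs from 1. *)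
Lemma rot_gap_gt0 (R : realType) (kappa : R) :
  ~ (exists k : int, kappa = k%:~R) -> 0 < rot_gap (2 * pi) kappa.
Proof.
move=> nk; apply: ltr_pwDl; last exact: sqr_ge0.
rewrite exprn_even_gt0//= subr_eq0.
pose k := Num.floor kappa; pose f := kappa - k%:~R.
have f0 : 0 < f.
  rewrite subr_gt0 lt_neqAle floor_le andbT; apply/eqP => kk.
  by apply: nk; exists k.
have f1 : f < 1 by rewrite ltrBlDl -[X in _ + X]/(1%:~R) -intrD floorD1_gt.
have perN (n : nat) (a : R) : cos (a + 2 * pi * n%:R) = cos a.
  by rewrite mulr_natr -(periodicn (@cosD2pi R) n a) mulr_natl.
have -> : cos (kappa * (2 * pi)) = cos (f * (2 * pi)).
  rewrite {f0 f1}/f; move: k => [] n.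
    rewrite -(perN n ((kappa - n%:~R) * (2 * pi))); congr cos.
    by rewrite pmulrn; ring.
  rewrite -(perN n.+1 (kappa * (2 * pi))); congr cos.
  by rewrite NegzE mulrNz pmulrn; ring.
have -> : f * (2 * pi) = (f * pi) *+ 2 by rewrite mulr2n; ring.
rewrite cos_mulr2n; have : 0 < sin (f * pi).
  by apply: sin_gt0_pi; rewrite mulr_gt0 ?pi_gt0//= -[ltRHS]mul1r ltr_pM2r ?pi_gt0.
move=> s0; have := exprn_gt0 2 s0; have := cos2Dsin2 (f * pi).
move: (cos _ ^+ 2) (sin _ ^+ 2) => p q pq q0; apply/eqP; lra.
Qed.

(** * Finite families of square-integrable functions *)

Section Family.
Context d (X : measurableType d) (R : realType).
Variable mu : {measure set X -> \bar R}.
Hypothesis mu_fin : (mu setT < +oo)%E.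
Variable J : finType.
Implicit Types F G : J -> X -> R.

Definition fam_sqint F := forall j, sqint mu (F j).

Definition fam_ip F G := \sum_j ip mu (F j) (G j).

Lemma fam_sqintD F G : fam_sqint F -> fam_sqint G -> fam_sqint (F + G).
Proof. by move=> sF sG j; exact: sqintD. Qed.

Lemma fam_sqintZ a F : fam_sqint F -> fam_sqint (a *: F).
Proof. by move=> sF j; exact: sqintZ. Qed.

Lemma fam_sqint0 : fam_sqint 0.
Proof. by move=> j; exact: (sqint_cst mu_fin 0). Qed.

Lemma fam_ipC F G : fam_ip F G = fam_ip G F.
Proof. by apply: eq_bigr => j _; exact: ipC. Qed.

Lemma fam_ipDl F G H : fam_sqint F -> fam_sqint G -> fam_sqint H ->
  fam_ip (F + G) H = fam_ip F H + fam_ip G H.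
Proof. by move=> sF sG sH; rewrite -big_split; apply: eq_bigr => j _; exact: ipDl. Qed.

Lemma fam_ipZl a F H : fam_sqint F -> fam_sqint H -> fam_ip (a *: F) H = a * fam_ip F H.
Proof. by move=> sF sH; rewrite mulr_sumr; apply: eq_bigr => j _; exact: ipZl. Qed.

Lemma fam_ip_ge0 F : fam_sqint F -> 0 <= fam_ip F F.
Proof. by move=> sF; apply: sumr_ge0 => j _; exact: ip_ge0. Qed.

Lemma le_fam_ip F j : fam_sqint F -> ip mu (F j) (F j) <= fam_ip F F.
Proof.
move=> sF; rewrite /fam_ip (bigD1 j)//= lerDl; apply: sumr_ge0 => i _; exact: ip_ge0.
Qed.

Definition fam_CS := semi_inner_CS fam_sqintD fam_sqintZ fam_ipC fam_ipDl fam_ipZl fam_ip_ge0.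
Definition fam_normB := semi_inner_normB fam_sqintD fam_sqintZ fam_ipC fam_ipDl fam_ipZl.
Definition fam_ipBl := semi_innerBl fam_sqintZ fam_ipDl fam_ipZl.
Definition fam_sqintB := semi_closedB fam_sqintD fam_sqintZ.

Lemma fam_normD_le F G : fam_sqint F -> fam_sqint G ->
  fam_ip (F + G) (F + G) <= 2 * (fam_ip F F + fam_ip G G).
Proof.
move=> sF sG; have sFG := fam_sqintD sF sG; have := fam_ip_ge0 (fam_sqintB sF sG).
rewrite (fam_normB sF sG) fam_ipDl// (fam_ipC F (F + G)) (fam_ipC G (F + G)) !fam_ipDl//.
rewrite (fam_ipC G F); move: (fam_ip F F) (fam_ip F G) (fam_ip G G) => a b c; lra.
Qed.

Lemma fam_normN F : fam_sqint F -> fam_ip (- F) (- F) = fam_ip F F.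
Proof.
move=> sF; rewrite -scaleN1r fam_ipZl//; last exact: fam_sqintZ.
by rewrite fam_ipC fam_ipZl// !mulN1r opprK.
Qed.

Lemma fam_normB_le F G : fam_sqint F -> fam_sqint G ->
  fam_ip (F - G) (F - G) <= 2 * (fam_ip F F + fam_ip G G).
Proof.
move=> sF sG; rewrite -(fam_normN sG); apply: fam_normD_le => //.
by rewrite -scaleN1r; exact: fam_sqintZ.
Qed.

Lemma fam_cvg0_CS (F_ : nat -> J -> X -> R) G : (forall i, fam_sqint (F_ i)) ->
  fam_sqint G -> (fun i => fam_ip (F_ i) (F_ i)) @ \oo --> 0 ->
  (fun i => fam_ip (F_ i) G) @ \oo --> 0.
Proof.
move=> sF sG F0.
apply: (@sqr_cvg0 _ _ (fun i => fam_ip (F_ i) (F_ i) * fam_ip G G)).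
  by move=> i; exact: fam_CS.
by rewrite -[X in _ --> X](mul0r (fam_ip G G)); apply: cvgM; [exact: F0|exact: cvg_cst].
Qed.

Lemma fam_complete (u : nat -> J -> X -> R) : (forall i, fam_sqint (u i)) ->
  (forall e : R, 0 < e -> exists N, forall i j, (N <= i)%N -> (N <= j)%N ->
     fam_ip (u i - u j) (u i - u j) <= e) ->
  exists2 w, fam_sqint w & forall e : R, 0 < e -> exists N, forall i, (N <= i)%N ->
     fam_ip (u i - w) (u i - w) <= e.
Proof.
move=> su cu.
have W j : {w : X -> R | sqint mu w /\ forall e : R, 0 < e ->
    exists N, forall i, (N <= i)%N -> ip mu (u i j - w) (u i j - w) <= e}.
  apply: cid; have [|e e0|w sw cw] := @sqint_complete _ _ _ _ mu_fin (fun i => u i j).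
  - by move=> i; exact: su.
  - have [N h] := cu e e0; exists N => a b Na Nb.
    exact: le_trans (le_fam_ip j (fam_sqintB (su a) (su b))) (h a b Na Nb).
  - by exists w.
exists (fun j => sval (W j)); first by move=> j; have [] := svalP (W j).
move=> e e0; have e1 : 0 < e / (#|J|.+1)%:R by rewrite divr_gt0.
have NN j : {N : nat | forall i, (N <= i)%N ->
    ip mu (u i j - sval (W j)) (u i j - sval (W j)) <= e / (#|J|.+1)%:R}.
  by apply: cid; have [_ h] := svalP (W j); exact: h.
exists (\max_j sval (NN j)) => i iN.
apply: (@le_trans _ _ (\sum_(j : J) e / (#|J|.+1)%:R)).
  by apply: ler_sum => j _; apply: (svalP (NN j)); rewrite (leq_trans _ iN)// leq_bigmax.
rewrite sumr_const -[leLHS]mulr_natr -mulrA ler_piMr ?(ltW e0)// mulrC ler_pdivrMr// mul1r.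
by rewrite ler_nat.
Qed.

Definition fam_approx_riesz :=
  approx_riesz fam_sqintD fam_sqintZ fam_ipC fam_ipDl fam_ipZl fam_ip_ge0.

Definition fam_weak_compact :=
  weak_seq_compact fam_sqintD fam_sqintZ fam_ipC fam_ipDl fam_ipZl fam_ip_ge0 fam_complete.

End Family.

Section RintegralSum.
Context d (X : measurableType d) (R : realType).
Variable mu : {measure set X -> \bar R}.

Lemma intble_sum (I : Type) (r : seq I) (f : I -> X -> R) : (forall i, intble mu (f i)) ->
  intble mu (fun x => \sum_(i <- r) f i x).
Proof.
move=> fi; elim: r => [|i r IH].
  have h : intble mu (fun=> 0 : R) by exact: integrable0.
  by apply: eq_integrable h => // x _; rewrite /= big_nil.
by apply: eq_integrable (intbleD (fi i) IH) => // x _; rewrite /= big_cons.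
Qed.

Lemma Rintegral_sum (I : Type) (r : seq I) (f : I -> X -> R) : (forall i, intble mu (f i)) ->
  \int[mu]_x (\sum_(i <- r) f i x) = \sum_(i <- r) \int[mu]_x f i x.
Proof.
move=> fi; elim: r => [|i r IH].
  rewrite big_nil; under eq_Rintegral do rewrite big_nil.
  by rewrite /Rintegral integral0.
rewrite big_cons; under eq_Rintegral do rewrite big_cons.
by rewrite RintegralD//; [rewrite IH|exact: intble_sum].
Qed.

Lemma fam_ipE (J : finType) (F G : J -> X -> R) : fam_sqint mu F -> fam_sqint mu G ->
  intble mu (fun x => \sum_j F j x * G j x) /\
  fam_ip mu F G = \int[mu]_x (\sum_j F j x * G j x).
Proof.
move=> sF sG; have i j : intble mu (fun x => F j x * G j x) by exact: sqintM.
by split; [exact: intble_sum|rewrite Rintegral_sum].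
Qed.

End RintegralSum.

(** * Vector-valued maps as families of components *)

Section Components.
Variables (R : realType) (T : R) (n : nat).
Local Notation mR := (measurableTypeR R).
Local Notation P := (cylm T).
Local Notation V := 'rV[R]_(n + n).
Implicit Types f g h : R * R -> V.

(* Extension by zero off the cylinder, hence measurable on the whole plane. *)
Definition cmp f (j : 'I_(n + n)) : mR * mR -> R := (fun z => f z ord0 j) \_ (cylinder T).

Lemma cmp_in f j z : cylinder T z -> cmp f j z = f z ord0 j.
Proof. by move=> cz; rewrite /cmp patchE mem_set. Qed.

Lemma cmpE f g j z : (cylinder T z -> f z ord0 j = g z ord0 j) -> cmp f j z = cmp g j z.
Proof. by move=> fg; rewrite /cmp !patchE; case: ifPn => // /set_mem/fg. Qed.

Lemma cmpB f g : cmp (fun z => f z - g z) = cmp f - cmp g.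
Proof.
apply/funext => j; apply/funext => z; rewrite !fctE /cmp !patchE.
by case: ifP; rewrite ?subr0// !mxE.
Qed.

Lemma cyl_integral (F : R * R -> R) (F' : mR * mR -> R) : intble P F' ->
  (forall z, cylinder T z -> F z = F' z) ->
  (\int[@area R]_(z in cylinder T) (F z)%:E = (\int[P]_z F' z)%:E)%E.
Proof.
move=> iF FF'; rewrite -EFin_Rintegral// -integral_cylm.
  by apply: eq_integral => z /set_mem cz; rewrite FF'.
exact: measurable_int iF.
Qed.

Lemma cyl_Rintegral (F : R * R -> R) (F' : mR * mR -> R) : measurable_fun setT F' ->
  (forall z, cylinder T z -> F z = F' z) ->
  \int[@area R]_(z in cylinder T) F z = \int[P]_z F' z.
Proof.
move=> iF FF'; rewrite -Rintegral_cylm//.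
by apply: eq_Rintegral => z /set_mem cz; rewrite FF'.
Qed.

Lemma L2_cmp f : L2 (@area R) (cylinder T) f <-> fam_sqint P (cmp f).
Proof.
have mC := @measurable_cylinder R T.
have mj j : measurable_fun (cylinder T : set (mR * mR)) (fun z => f z ord0 j) <->
    measurable_fun setT (cmp f j) by exact: measurable_restrictT.
split=> [[mf foo] j|sf].
  have mc k : measurable_fun setT (cmp f k) by apply/mj.
  split=> //; pose G z := \sum_k cmp f k z ^+ 2.
  have mG : measurable_fun setT G by apply: measurable_sum => k; exact: measurable_funX.
  have G0 z : 0 <= G z by apply: sumr_ge0 => k _; exact: sqr_ge0.
  apply: (@intble_dom _ _ _ _ _ G); first exact: measurable_funX.
    apply: ge0_intble => //; apply: le_lt_trans foo.
    rewrite -integral_cylm; last exact/measurable_EFinP.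
    rewrite le_eqVlt; apply/orP; left; apply/eqP; apply: eq_integral => z /set_mem cz.
    by congr EFin; apply: eq_bigr => k _; rewrite cmp_in.
  move=> z; rewrite ger0_norm ?sqr_ge0// /G (bigD1 j)//= lerDl.
  by apply: sumr_ge0 => k _; exact: sqr_ge0.
split=> [j|]; first by apply/mj; exact: (sf j).1.
have [i _] := fam_ipE sf sf.
rewrite (cyl_integral i) ?ltry// => z cz.
by apply: eq_bigr => j _; rewrite cmp_in.
Qed.

Lemma edot_cmp f g z : cylinder T z -> edot (f z) (g z) = \sum_j cmp f j z * cmp g j z.
Proof. by move=> cz; apply: eq_bigr => j _; rewrite !cmp_in. Qed.

Lemma esqnorm2_cmp f g : fam_sqint P (cmp f) -> fam_sqint P (cmp g) ->
  (\int[@area R]_(z in cylinder T) (esqnorm (f z) + esqnorm (g z))%:E =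
   (fam_ip P (cmp f) (cmp f) + fam_ip P (cmp g) (cmp g))%:E)%E.
Proof.
move=> sf sg; have [i1 ->] := fam_ipE sf sf; have [i2 ->] := fam_ipE sg sg.
rewrite -RintegralD//; apply: cyl_integral; first exact: intbleD.
by move=> z cz; rewrite /esqnorm !edot_cmp.
Qed.

Lemma esqnorm3_cmp f g h :
  fam_sqint P (cmp f) -> fam_sqint P (cmp g) -> fam_sqint P (cmp h) ->
  (\int[@area R]_(z in cylinder T) (esqnorm (f z) + esqnorm (g z) + esqnorm (h z))%:E =
   (fam_ip P (cmp f) (cmp f) + fam_ip P (cmp g) (cmp g) + fam_ip P (cmp h) (cmp h))%:E)%E.
Proof.
move=> sf sg sh; have [i1 ->] := fam_ipE sf sf; have [i2 ->] := fam_ipE sg sg.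
have [i3 ->] := fam_ipE sh sh; have i12 := intbleD i1 i2.
rewrite -RintegralD// -RintegralD//; apply: cyl_integral; first exact: intbleD.
by move=> z cz; rewrite /esqnorm !edot_cmp.
Qed.

Lemma edot3_cmp f f' g g' h h' :
  fam_sqint P (cmp f) -> fam_sqint P (cmp g) -> fam_sqint P (cmp h) ->
  fam_sqint P (cmp f') -> fam_sqint P (cmp g') -> fam_sqint P (cmp h') ->
  \int[@area R]_(z in cylinder T) (edot (f z) (f' z) + edot (g z) (g' z) + edot (h z) (h' z)) =
  fam_ip P (cmp f) (cmp f') + fam_ip P (cmp g) (cmp g') + fam_ip P (cmp h) (cmp h').
Proof.
move=> sf sg sh sf' sg' sh'; have [i1 ->] := fam_ipE sf sf'; have [i2 ->] := fam_ipE sg sg'.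
have [i3 ->] := fam_ipE sh sh'; have i12 := intbleD i1 i2.
rewrite -RintegralD// -RintegralD//; apply: cyl_Rintegral.
  exact: intble_measurable (intbleD i12 i3).
by move=> z cz; rewrite !edot_cmp.
Qed.

Lemma sqrte_EFin (x : R) : 0 <= x -> (x%:E `^ 2^-1)%E = (Num.sqrt x)%:E.
Proof. by move=> x0; rewrite poweR_EFin powR12_sqrt. Qed.

Lemma L21norm_of_cmp f g h :
  fam_sqint P (cmp f) -> fam_sqint P (cmp g) -> fam_sqint P (cmp h) ->
  L21norm_of T f g h = (Num.sqrt (fam_ip P (cmp f) (cmp f) + fam_ip P (cmp g) (cmp g) +
     fam_ip P (cmp h) (cmp h)))%:E.
Proof.
move=> sf sg sh; rewrite /L21norm_of esqnorm3_cmp// sqrte_EFin//.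
by rewrite !addr_ge0// fam_ip_ge0.
Qed.

End Components.

(** * Sobolev maps as families closed under weak limits *)

Section SobolevFamily.
Variables (R : realType) (T : R) (n : nat).
Local Notation mR := (measurableTypeR R).
Local Notation P := (cylm T).
Local Notation I := 'I_(n + n).
Local Notation J := (I + I + I)%type.
Implicit Types (F G : J -> mR * mR -> R) (u w : L21 T n).

(** The function is bounded on the compact cylinder, outside of which the measure vanishes, so it is
    compared with its restriction. *)
Lemma continuous_sqint2 (g : R * R -> R) : continuous g -> sqint P g.
Proof.
move=> cg; have mg := continuous_measurable2 cg.
have cC : compact (cylinder T) by apply: compact_setX; exact: segment_compact.
have [M gM] : exists M : R, forall z, cylinder T z -> `|g z| <= M.
  have := compact_bounded (continuous_compact (continuous_subspaceT cg) cC).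
  move=> [M [_ h]]; exists (M + 1) => z cz; apply: h; first by rewrite ltrDl.
  by exists z.
have mC := @measurable_cylinder R T.
apply: (@sqint_ae _ (mR * mR)%type R P g (g \_ (cylinder T)) mg).
  apply: (@sqint_bounded _ (mR * mR)%type R P (cylm_fin T) _ (Num.max M 0)).
    by apply/(measurable_restrictT _ mC); exact: measurable_funTS.
  move=> z; rewrite patchE; case: ifPn => [/set_mem/gM h|_]; last first.
    by rewrite normr0 le_max lexx orbT.
  by rewrite le_max h.
have FP : Filter (nbhs (almost_everywhere P)) by exact: ae_filter_ringOfSetsType.
by apply: (@filterS _ _ FP _ _ _ (ae_cylm T)) => z cz; rewrite patchE mem_set.
Qed.

Definition weak_pair (v : R * R) (f g : mR * mR -> R) := forall phi, test_fun T phi ->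
  ip P f ('D_v phi) = - ip P g phi.

Lemma test_fun_sqint phi : test_fun T phi -> sqint P phi.
Proof. by move=> [c _ _]; apply: continuous_sqint2; exact: (c 0).1. Qed.

Lemma test_fun_derive_sqint phi v : test_fun T phi -> sqint P ('D_v phi).
Proof.
by move=> [c _ _]; apply: continuous_sqint2; have [_ /(_ v)[_ []]] := c 1.
Qed.

Lemma weak_deriv_cmp v (f g : R * R -> 'rV[R]_(n + n)) :
  fam_sqint P (cmp T f) -> fam_sqint P (cmp T g) ->
  weak_deriv T v f g <-> forall j, weak_pair v (cmp T f j) (cmp T g j).
Proof.
move=> sf sg.
have e phi j : test_fun T phi ->
    \int[@area R]_(z in cylinder T) (f z ord0 j * 'D_v phi z) = ip P (cmp T f j) ('D_v phi) /\
    \int[@area R]_(z in cylinder T) (g z ord0 j * phi z) = ip P (cmp T g j) phi.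
  move=> tp; split; apply: cyl_Rintegral.
  - by apply: measurable_funM; [exact: (sf j).1|exact: (test_fun_derive_sqint _ tp).1].
  - by move=> z cz; rewrite cmp_in.
  - by apply: measurable_funM; [exact: (sg j).1|exact: (test_fun_sqint tp).1].
  - by move=> z cz; rewrite cmp_in.
split=> [h j phi tp|h phi tp j]; have [e1 e2] := e phi j tp.
  by rewrite -e1 -e2 h.
by rewrite e1 e2 h.
Qed.

(* A family indexed by three copies of the coordinates encodes a map together
   with its two weak derivatives. *)
Definition weak_family F := fam_sqint P F /\ forall k,
  weak_pair (e_t R) (F (inl (inl k))) (F (inl (inr k))) /\
  weak_pair (e_th R) (F (inl (inl k))) (F (inr k)).

Definition emb3 (f ft fth : R * R -> 'rV[R]_(n + n)) : J -> mR * mR -> R := fun j =>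
  match j with
  | inl (inl k) => cmp T f k
  | inl (inr k) => cmp T ft k
  | inr k => cmp T fth k
  end.

Definition emb u := emb3 u (L21dt u) (L21dth u).

Lemma emb_sqint u : fam_sqint P (emb u).
Proof.
by move=> [[k|k]|k]; [exact: (L2_cmp T _).1 (L21val_L2 u) k|
  exact: (L2_cmp T _).1 (L21dt_L2 u) k|exact: (L2_cmp T _).1 (L21dth_L2 u) k].
Qed.

Lemma cmp_val_sqint u : fam_sqint P (cmp T u).
Proof. by move=> k; exact: (emb_sqint u (inl (inl k))). Qed.

Lemma cmp_dt_sqint u : fam_sqint P (cmp T (L21dt u)).
Proof. by move=> k; exact: (emb_sqint u (inl (inr k))). Qed.

Lemma cmp_dth_sqint u : fam_sqint P (cmp T (L21dth u)).
Proof. by move=> k; exact: (emb_sqint u (inr k)). Qed.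

Lemma emb_weak_family u : weak_family (emb u).
Proof.
split=> [|k]; first exact: emb_sqint.
have s0 := cmp_val_sqint u; have s1 := cmp_dt_sqint u; have s2 := cmp_dth_sqint u.
split; first exact: (weak_deriv_cmp _ s0 s1).1 (L21dt_weak u) k.
exact: (weak_deriv_cmp _ s0 s2).1 (L21dth_weak u) k.
Qed.

Lemma fam_ip3 (F G : J -> mR * mR -> R) : fam_ip P F G =
  fam_ip P (fun k => F (inl (inl k))) (fun k => G (inl (inl k))) +
  fam_ip P (fun k => F (inl (inr k))) (fun k => G (inl (inr k))) +
  fam_ip P (fun k => F (inr k)) (fun k => G (inr k)).
Proof. by rewrite /fam_ip !big_sumType. Qed.

Lemma L21dot_emb u (v : L21 T n) : L21dot u v = fam_ip P (emb u) (emb v).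
Proof.
rewrite fam_ip3 /= /L21dot; apply: edot3_cmp.
- exact: cmp_val_sqint.
- exact: cmp_dt_sqint.
- exact: cmp_dth_sqint.
- exact: cmp_val_sqint.
- exact: cmp_dt_sqint.
- exact: cmp_dth_sqint.
Qed.

Lemma L21norm_emb u : L21norm u = (Num.sqrt (fam_ip P (emb u) (emb u)))%:E.
Proof.
rewrite fam_ip3 /=; apply: L21norm_of_cmp.
- exact: cmp_val_sqint.
- exact: cmp_dt_sqint.
- exact: cmp_dth_sqint.
Qed.

Lemma L21dist_emb u (v : L21 T n) :
  L21dist u v = (Num.sqrt (fam_ip P (emb u - emb v) (emb u - emb v)))%:E.
Proof.
have s3 := fam_sqintB (emb_sqint u) (emb_sqint v).
rewrite fam_ip3 /L21dist L21norm_of_cmp; first by rewrite !cmpB.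
- by rewrite cmpB => k; exact: (s3 (inl (inl k))).
- by rewrite cmpB => k; exact: (s3 (inl (inr k))).
- by rewrite cmpB => k; exact: (s3 (inr k)).
Qed.

(** Equality holds almost everywhere because [emb] vanishes off the cylinder, where [F] is
    arbitrary. *)
Lemma weak_family_L21 F : weak_family F ->
  exists w, forall j, {ae P, forall z, emb w j z = F j z}.
Proof.
move=> [sF wF].
pose f z : 'rV[R]_(n + n) := \row_k F (inl (inl k)) z.
pose ft z : 'rV[R]_(n + n) := \row_k F (inl (inr k)) z.
pose fth z : 'rV[R]_(n + n) := \row_k F (inr k) z.
have mC := @measurable_cylinder R T.
have FP : Filter (nbhs (almost_everywhere P)) by exact: ae_filter_ringOfSetsType.
have ae (G : I -> mR * mR -> R) k :
    {ae P, forall z, cmp T (fun z => \row_k G k z) k z = G k z}.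
  by apply: (@filterS _ _ FP _ _ _ (ae_cylm T)) => z cz; rewrite cmp_in// mxE.
have mc (G : I -> mR * mR -> R) k : measurable_fun setT (G k) ->
    measurable_fun setT (cmp T (fun z => \row_k G k z) k).
  move=> mG; apply/(measurable_restrictT _ mC); apply: measurable_funTS.
  by rewrite (_ : (fun z => _) = G k)//; apply/funext => z; rewrite mxE.
have sc (G : I -> mR * mR -> R) : fam_sqint P G -> fam_sqint P (cmp T (fun z => \row_k G k z)).
  by move=> sG k; apply: (sqint_ae _ (sG k)); [apply: mc; exact: (sG k).1|exact: ae].
have s0 : fam_sqint P (cmp T f) by apply: sc => k; exact: sF.
have s1 : fam_sqint P (cmp T ft) by apply: sc => k; exact: sF.
have s2 : fam_sqint P (cmp T fth) by apply: sc => k; exact: sF.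
have ww v (G H : I -> mR * mR -> R) : fam_sqint P G -> fam_sqint P H ->
    (forall k, weak_pair v (G k) (H k)) ->
    forall k, weak_pair v (cmp T (fun z => \row_k G k z) k) (cmp T (fun z => \row_k H k z) k).
  move=> sG sH w k phi tp; have tv := test_fun_derive_sqint v tp.
  have t0 := test_fun_sqint tp.
  rewrite (@ip_ae _ (mR * mR)%type R P _ (G k) _ ('D_v phi)) ?w//.
  - congr (- _); apply: ip_ae; [exact: (sH k).1|exact: (sc _ sH k).1|exact: t0.1|exact: t0.1| |].
      by apply: (@filterS _ _ FP _ _ _ (ae H k)) => z ->.
    exact: aeW.
  - exact: (sc _ sG k).1.
  - exact: (sG k).1.
  - exact: tv.1.
  - exact: tv.1.
  - exact: aeW.
have w1 : weak_deriv T (e_t R) f ft.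
  by apply/weak_deriv_cmp => //; apply: ww => k; [exact: sF|exact: sF|exact: (wF k).1].
have w2 : weak_deriv T (e_th R) f fth.
  by apply/weak_deriv_cmp => //; apply: ww => k; [exact: sF|exact: sF|exact: (wF k).2].
exists (MkL21 ((L2_cmp T f).2 s0) ((L2_cmp T ft).2 s1) ((L2_cmp T fth).2 s2) w1 w2).
by move=> [[k|k]|k]; exact: ae.
Qed.

Lemma weak_pair0 v : weak_pair v 0 0.
Proof.
move=> phi _; rewrite /ip; under eq_Rintegral do rewrite mul0r.
by under [in RHS]eq_Rintegral do rewrite mul0r; rewrite Rintegral_cst// mul0r oppr0.
Qed.

Lemma weak_family0 : weak_family 0.
Proof. by split=> [|k]; [exact: fam_sqint0 (cylm_fin T) _|split; exact: weak_pair0]. Qed.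

Lemma weak_pairD v f g f' g' : sqint P f -> sqint P g -> sqint P f' -> sqint P g' ->
  weak_pair v f f' -> weak_pair v g g' -> weak_pair v (f + g) (f' + g').
Proof.
move=> s1 s2 s3 s4 w1 w2 phi tp; have t0 := test_fun_sqint tp.
have tv := test_fun_derive_sqint v tp.
by rewrite !ipDl// w1// w2// opprD.
Qed.

Lemma weak_pairZ v a f f' : sqint P f -> sqint P f' ->
  weak_pair v f f' -> weak_pair v (a *: f) (a *: f').
Proof.
move=> s1 s2 w1 phi tp; have t0 := test_fun_sqint tp.
have tv := test_fun_derive_sqint v tp.
by rewrite !ipZl// w1// mulrN.
Qed.

Lemma weak_familyD F G : weak_family F -> weak_family G -> weak_family (F + G).
Proof.
move=> [sF wF] [sG wG]; split=> [|k]; first exact: fam_sqintD.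
split; apply: weak_pairD; [exact: sF|exact: sG|exact: sF|exact: sG|exact: (wF k).1|
  exact: (wG k).1|exact: sF|exact: sG|exact: sF|exact: sG|exact: (wF k).2|exact: (wG k).2].
Qed.

Lemma weak_familyZ a F : weak_family F -> weak_family (a *: F).
Proof.
move=> [sF wF]; split=> [|k]; first exact: fam_sqintZ.
by split; apply: weak_pairZ; [exact: sF|exact: sF|exact: (wF k).1|
  exact: sF|exact: sF|exact: (wF k).2].
Qed.

Definition single (j : J) (g : mR * mR -> R) : J -> mR * mR -> R :=
  fun i => if i == j then g else 0.

Lemma single_sqint j g : sqint P g -> fam_sqint P (single j g).
Proof.
move=> sg i; rewrite /single; case: ifP => // _; exact: (sqint_cst (cylm_fin T) 0).
Qed.

Lemma fam_ip_single F j g : fam_ip P F (single j g) = ip P (F j) g.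
Proof.
rewrite /fam_ip (bigD1 j)//= big1 ?addr0; first by rewrite /single eqxx.
move=> i /negbTE ij; rewrite /single ij /ip; under eq_Rintegral do rewrite mulr0.
by rewrite Rintegral_cst// mul0r.
Qed.

(** Each weak derivative identity equates pairings with fixed square-integrable functions, hence
    survives weak limits. *)
Lemma weak_family_limit (F_ : nat -> J -> mR * mR -> R) F : fam_sqint P F ->
  (forall i, weak_family (F_ i)) ->
  (forall G, fam_sqint P G -> (fun i => fam_ip P (F_ i) G) @ \oo --> fam_ip P F G) ->
  weak_family F.
Proof.
move=> sF wF cF; split=> // k.
have cv j g : sqint P g -> (fun i => ip P (F_ i j) g) @ \oo --> ip P (F j) g.
  move=> sg; have := cF _ (single_sqint j sg); rewrite fam_ip_single.
  rewrite (_ : (fun i => fam_ip _ _ _) = fun i => ip P (F_ i j) g)//.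
  by apply/funext => i; rewrite fam_ip_single.
have key v j1 j2 : (forall i, weak_pair v (F_ i j1) (F_ i j2)) -> weak_pair v (F j1) (F j2).
  move=> wi phi tp; apply: (cvgr_fmap_unique (cv j1 _ (test_fun_derive_sqint v tp))).
  rewrite (_ : (fun i => _) = (fun i => - ip P (F_ i j2) phi)).
    by apply: cvgN; apply: cv; exact: test_fun_sqint.
  by apply/funext => i; exact: wi.
by split; apply: key => i; [exact: ((wF i).2 k).1|exact: ((wF i).2 k).2].
Qed.

Lemma weak_family_wdiff F k : weak_family F ->
  wdiff T (F (inl (inl k))) (F (inl (inr k))) (F (inr k)).
Proof.
move=> [sF wF]; split; [exact: sF|exact: sF|exact: sF| |].
- move=> a a' b ta pb da; have [b' _ db] := smooth_deriv pb.1.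
  rewrite -(wF k).1; last exact: test_fun_tensor.
  apply: eq_Rintegral => z _; congr (_ * _).
  have dt := is_derive_tensor z (e_t R) da db.
  by rewrite (derive_val (is_derive := dt))/= mul1r !mul0r addr0.
- move=> a b b' ta pb db; have [a' _ da] := smooth_deriv ta.1.
  rewrite -(wF k).2; last exact: test_fun_tensor.
  apply: eq_Rintegral => z _; congr (_ * _).
  have dt := is_derive_tensor z (e_th R) da db.
  by rewrite (derive_val (is_derive := dt))/= mul1r !mul0r add0r.
Qed.

End SobolevFamily.

Lemma cvg0_approx (R : realType) (x : nat -> R) :
  (forall e : R, 0 < e -> exists y : nat -> R, y @ \oo --> 0 /\ forall i, `|x i| <= y i + e) ->
  x @ \oo --> 0.
Proof.
move=> h; apply/cvgr0Pnorm_le => e e0; have [|y [y0 xy]] := h (e / 2); first by rewrite divr_gt0.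
have e2 : 0 < e / 2 by rewrite divr_gt0.
have [N _ hN] := (cvgr0Pnorm_le _).1 y0 (e / 2) e2.
exists N => // i Ni; apply: (le_trans (xy i)); have := hN i Ni => /= yi.
by have := le_trans (ler_norm _) yi; lra.
Qed.

Lemma sum_cvg0 (R : realType) (J : finType) (x : nat -> J -> R) :
  (forall j, (fun i => x i j) @ \oo --> 0) -> (fun i => \sum_j x i j) @ \oo --> 0.
Proof.
move=> x0; elim: (index_enum J) => [|j r IH].
  rewrite (_ : (fun i => _) = fun=> 0); first exact: cvg_cst.
  by apply/funext => i; rewrite big_nil.
rewrite (_ : (fun i => _) = fun i => x i j + \sum_(j <- r) x i j); last first.
  by apply/funext => i; rewrite big_cons.
by rewrite -[X in _ --> X]addr0; apply: cvgD; [exact: x0|exact: IH].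
Qed.

(** * Weak convergence and weak compactness in L^2_1 *)

Section WeakConvergence.
Variables (R : realType) (T : R) (n : nat).
Hypothesis T_gt0 : 0 < T.
Local Notation mR := (measurableTypeR R).
Local Notation P := (cylm T).
Local Notation I := 'I_(n + n).
Local Notation J := (I + I + I)%type.

Section Limit.
Variables (u : nat -> L21 T n) (w : L21 T n) (M : R).
Hypothesis uw : weakly_converges u w.
Hypothesis uM : forall i, fam_ip P (emb (u i)) (emb (u i)) <= M.

(* G need not come from an element of L^2_1, but on the subspace of weak
   families the functional <-, G> is approximated by pairings with such
   elements. *)
Lemma weakly_converges_L2 (G : J -> mR * mR -> R) : fam_sqint P G ->
  (fun i => fam_ip P (emb (u i) - emb w) G) @ \oo --> 0.
Proof.
move=> sG; pose D i := emb (u i) - emb w.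
have wD i : weak_family T (D i).
  rewrite /D -scaleN1r; apply: weak_familyD; first exact: emb_weak_family.
  exact/weak_familyZ/emb_weak_family.
have sD i : fam_sqint P (D i) by exact: (wD i).1.
have lM F : weak_family T F -> fam_ip P F G ^+ 2 <= fam_ip P G G * fam_ip P F F.
  by move=> wF; have := fam_CS wF.1 sG; rewrite [leRHS]mulrC.
have [p [Sp hp]] : exists p : nat -> J -> mR * mR -> R, (forall k, weak_family T (p k)) /\
    forall k F, weak_family T F ->
      (fam_ip P (p k) F - fam_ip P F G) ^+ 2 <= k.+1%:R^-1 * fam_ip P F F.
  apply: (@fam_approx_riesz _ _ _ P J (@weak_family R T n) (fun F => fam_ip P F G)
    (fam_ip P G G)).
  - exact: weak_family0.
  - by move=> F H; exact: weak_familyD.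
  - by move=> a F; exact: weak_familyZ.
  - by move=> F [].
  - by move=> F H [sF _] [sH _]; exact: fam_ipDl.
  - by move=> a F [sF _]; exact: fam_ipZl.
  - exact: lM.
pose M' := 2 * (M + fam_ip P (emb w) (emb w)).
have DM i : fam_ip P (D i) (D i) <= M'.
  apply: (le_trans (fam_normB_le (emb_sqint (u i)) (emb_sqint w))).
  by rewrite ler_wpM2l// lerD2r.
have pc k : (fun i => fam_ip P (p k) (D i)) @ \oo --> 0.
  (* An element of L^2_1 agreeing with [p k] almost everywhere makes the weak convergence hypothesis
     applicable. *)
  have [v hv] := weak_family_L21 (Sp k).
  have ev i : fam_ip P (p k) (D i) = L21dot (u i) v - L21dot w v.
    rewrite !L21dot_emb -(fam_ipBl (emb_sqint (u i)) (emb_sqint w) (emb_sqint v)).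
    rewrite fam_ipC; apply: eq_bigr => j _; apply: ip_ae.
    - exact: (sD i j).1.
    - exact: (sD i j).1.
    - exact: ((Sp k).1 j).1.
    - exact: (emb_sqint v j).1.
    - exact: aeW.
    - have FP : Filter (nbhs (almost_everywhere P)) by exact: ae_filter_ringOfSetsType.
      by apply: (@filterS _ _ FP _ _ _ (hv j)) => z ->.
  rewrite (funext ev) -[X in _ --> X](subrr (L21dot w v)).
  by apply: cvgB; [exact: uw|exact: cvg_cst].
have M'0 : 0 <= M' by apply: le_trans (fam_ip_ge0 (sD 0%N)) (DM 0%N).
apply: (@sqr_cvg0 _ _ (fun i => fam_ip P (D i) G ^+ 2)) => //.
apply: cvg0_approx => e e0.
(* Since [b ^+ 2 <= 2 * a ^+ 2 + 2 * (a - b) ^+ 2], the index must make twice the error of [p k] at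
   most [e]. *)
pose k := Num.truncn ((2 * M' + 1) / e).
have kk : 2 * (k.+1%:R^-1 * M') <= e.
  have h : (2 * M' + 1) / e < k.+1%:R by exact: truncnS_gt.
  rewrite mulrCA -ler_pdivlMl ?invr_gt0// invrK mulrC -ler_pdivrMr//.
  apply: le_trans (ltW h); rewrite ler_pM2r ?invr_gt0//; lra.
exists (fun i => 2 * fam_ip P (p k) (D i) ^+ 2); split.
  rewrite -[X in _ --> X](mulr0 2); apply: cvgM; first exact: cvg_cst.
  rewrite -[X in _ --> X](mulr0 0); apply: cvgM; exact: pc.
move=> i; rewrite ger0_norm ?sqr_ge0//.
have h1 := hp k (D i) (wD i).
have h2 : k.+1%:R^-1 * fam_ip P (D i) (D i) <= k.+1%:R^-1 * M' by rewrite ler_wpM2l// invr_ge0.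
move: h1 h2 kk; move: (fam_ip P (p k) (D i)) (fam_ip P (D i) G) (_ * fam_ip P _ _) (_ * M') => a b c d.
by have := sqr_ge0 (2 * a - b); nra.
Qed.

Lemma weak_bound i : fam_ip P (emb (u i) - emb w) (emb (u i) - emb w) <=
  2 * (M + fam_ip P (emb w) (emb w)).
Proof.
apply: (le_trans (fam_normB_le (emb_sqint (u i)) (emb_sqint w))).
by rewrite ler_wpM2l// lerD2r.
Qed.

Lemma weakly_converges_strong_L2 :
  (fun i => fam_ip P (cmp T (u i) - cmp T w) (cmp T (u i) - cmp T w)) @ \oo --> 0.
Proof.
pose D i := emb (u i) - emb w.
have wD i : weak_family T (D i).
  rewrite /D -scaleN1r; apply: weak_familyD; first exact: emb_weak_family.
  exact/weak_familyZ/emb_weak_family.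
have sD i : fam_sqint P (D i) by exact: (wD i).1.
have c0 j g : sqint P g -> (fun i => ip P (D i j) g) @ \oo --> 0.
  move=> sg; have := weakly_converges_L2 (single_sqint j sg).
  by under eq_fun do rewrite fam_ip_single.
have DM i j : ip P (D i j) (D i j) <= 2 * (M + fam_ip P (emb w) (emb w)).
  exact: le_trans (le_fam_ip j (sD i)) (weak_bound i).
have [k1 [k2 [bk1 bk2 rep1]]] := rep_t T_gt0.
have cb : exists M : R, forall x, `|@chi0 R x| <= M by exact: chi0_bounded.
have bl1 : bounded_kernel (ker1 (@chi0 R)) by apply: ker1P => //; exact: smooth_cst.
have bl2 : bounded_kernel (ker2 (2 * pi) (@chi0 R)) by apply: ker2P; exact: smooth_cst.
have each k : (fun i => ip P (D i (inl (inl k))) (D i (inl (inl k)))) @ \oo --> 0.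
  apply: (@rellich _ _ _ _ R (lam T) (lam (2 * pi)) _ _ bl1 bl2 (fun i => D i (inl (inl k)))
    (fun i => D i (inr k)) _ _ _ (fun i => DM i _) (fun i => DM i _) _ _ _ k1 k2
    (fun i => D i (inl (inr k)))) => //.
  - by move=> i; exact: sD.
  - by move=> i; exact: sD.
  - by move=> g; exact: c0.
  - by move=> g; exact: c0.
  - by move=> i; exact: rep_th (weak_family_wdiff k (wD i)).
  - by move=> i; exact: sD.
  - by move=> i; exact: rep1 (weak_family_wdiff k (wD i)).
rewrite (_ : (fun i => _) = fun i => \sum_k ip P (D i (inl (inl k))) (D i (inl (inl k))))//.
exact: sum_cvg0.
Qed.

End Limit.

(** The abstract weak limit is only a family of L^2 functions; closedness of weak derivatives makes
    it an element of L^2_1. *)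
Lemma bounded_weak_compact (u : nat -> L21 T n) (M : R) :
  (forall i, fam_ip P (emb (u i)) (emb (u i)) <= M) ->
  exists s : nat -> nat, {homo s : i j / (i < j)%N} /\
    exists w : L21 T n, weakly_converges (u \o s) w.
Proof.
move=> uM; have [s [sinc [F sF cF]]] := fam_weak_compact (cylm_fin T) (@fam_sqint0 _ _ _ P (cylm_fin T) J)
  (fun i => emb_sqint (u i)) uM.
exists s; split=> //.
have wF : weak_family T F.
  by apply: (weak_family_limit sF _ cF) => i; exact: emb_weak_family.
have [w hw] := weak_family_L21 wF; exists w => v.
rewrite (_ : (fun i => _) = fun i => fam_ip P (emb (u (s i))) (emb v)); last first.
  by apply/funext => i; rewrite L21dot_emb.
rewrite L21dot_emb; have -> : fam_ip P (emb w) (emb v) = fam_ip P F (emb v).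
  apply: eq_bigr => j _; apply: ip_ae; [exact: (emb_sqint w j).1|exact: (sF j).1|
    exact: (emb_sqint v j).1|exact: (emb_sqint v j).1|exact: hw|exact: aeW].
by apply: cF; exact: emb_sqint.
Qed.

End WeakConvergence.

(** * The nonlinear term and the energy *)

Section CompactSupport.
Variables (R : realType) (N : nat).

(** Only [z] ranges over the compact set while [y] is free, so one of the two points may leave the
    support of the perturbation. *)
Lemma compact_slice_unif_continuous (g : 'rV[R]_N * R -> R) (A : set ('rV[R]_N * R)) (e : R) :
  compact A -> continuous g -> 0 < e ->
  exists2 d : R, 0 < d & forall z, A z -> forall y : 'rV[R]_N,
    (forall j, `|z.1 ord0 j - y ord0 j| < d) -> `|g z - g (y, z.2)| <= e.
Proof.
move=> cA cg e0.
pose Q (d : R) (z : 'rV[R]_N * R) := forall y : 'rV[R]_N,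
    (forall j, `|z.1 ord0 j - y ord0 j| < d) -> `|g z - g (y, z.2)| <= e.
have := (compact_near_coveringP A).1 cA R (0^'+ : set_system R) Q _.
case=> [z0 Az0|r /= r0 hr]; last first.
  have r2 : 0 < r / 2 by rewrite divr_gt0.
  exists (r / 2) => // z Az; apply: (hr (r / 2)) => //=.
  by rewrite /ball/= sub0r normrN gtr0_norm// ltr_pdivrMr// ltr_pMr// ltr1n.
have e2 : 0 < e / 2 by rewrite divr_gt0.
have /cvgrPdist_lt/(_ (e / 2) e2)/nbhs_ballP[r /= r0 hr] := cg z0.
have r2 : 0 < r / 2 by rewrite divr_gt0.
exists (ball z0 (r / 2), [set d | d < r / 2]); first split => /=.
- exact: nbhsx_ballx.
- by near=> d; near: d; exact: nbhs_right_lt.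
move=> [z d] [/= [bz1 bz2] dr] y hy.
have h1 : `|g z0 - g z| < e / 2.
  apply: hr; split; [apply: le_ball bz1|apply: le_ball bz2];
    by rewrite ler_pdivrMr// ler_pMr// ler1n.
have h2 : `|g z0 - g (y, z.2)| < e / 2.
  apply: hr; split => /=; last by apply: le_ball bz2; rewrite ler_pdivrMr// ler_pMr// ler1n.
  rewrite (_ : r = r / 2 + r / 2); last by field.
  apply: (ball_triangle bz1); split => // i j; rewrite (ord1 i).
  exact: lt_trans (hy j) dr.
have := ler_distD (g z0) (g z) (g (y, z.2)); rewrite (distrC (g z) (g z0)); lra.
Unshelve. all: by end_near.
Qed.

Variables (m : nat) (Xc : 'rV[R]_N * R -> 'rV[R]_m).
Hypothesis Xc_cont : continuous Xc.
Hypothesis Xc_supp : exists K : set 'rV[R]_N,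
  compact K /\ forall x th, ~ K x -> Xc (x, th) = 0.

Lemma Xc_coord_continuous j : continuous (fun z => Xc z ord0 j).
Proof.
move=> z; apply: (@continuous_comp _ _ _ Xc (fun v : 'rV[R]_m => v ord0 j)).
  exact: Xc_cont.
exact: coord_continuous.
Qed.

Lemma Xc_bounded (L : R) : exists2 M : R, 0 <= M &
  forall x th j, 0 <= th <= L -> `|Xc (x, th) ord0 j| <= M.
Proof.
have [K [cK XK]] := Xc_supp.
have cKL : compact (K `*` `[0, L]) by apply: compact_setX => //; exact: segment_compact.
have bj j : {M : R | forall z, (K `*` `[0, L]) z -> `|Xc z ord0 j| <= M}.
  apply: cid; have ck := continuous_subspaceT (Xc_coord_continuous (j := j)).
  have [M [_ h]] := compact_bounded (continuous_compact (ck _) cKL).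
  exists (M + 1) => z cz; apply: h; first by rewrite ltrDl.
  by exists z.
exists (\sum_j `|sval (bj j)|); first exact: sumr_ge0.
move=> x th j thL; have [Kx|nKx] := pselect (K x); last first.
  by rewrite XK// mxE normr0 sumr_ge0.
rewrite (bigD1 j)//=; apply: ler_wpDr; first exact: sumr_ge0.
by apply: le_trans (ler_norm _); apply: (svalP (bj j)); split => //=; rewrite in_itv.
Qed.

(** Nearby points are covered by uniform continuity, which costs [e]. If some coordinates differ by
    at least [d], the difference of values is at most [2 * M], so its square is at most
    [4 * M ^+ 2 / d ^+ 2] times the squared distance. This carries strong L^2 convergence over to
    the perturbation. *)
Lemma Xc_approx_lipschitz (L e : R) : 0 < e -> exists2 C : R, 0 <= C &
  forall x y th j, 0 <= th <= L -> (Xc (x, th) ord0 j - Xc (y, th) ord0 j) ^+ 2 <=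
    e + C * \sum_k (x ord0 k - y ord0 k) ^+ 2.
Proof.
move=> e0; have [K [cK XK]] := Xc_supp.
have [M M0 XM] := Xc_bounded L.
have cKL : compact (K `*` `[0, L]) by apply: compact_setX => //; exact: segment_compact.
have s0 : 0 < Num.sqrt e by rewrite sqrtr_gt0.
have dj j : {d : R | 0 < d /\ forall z, (K `*` `[0, L]) z -> forall y : 'rV[R]_N,
    (forall k, `|z.1 ord0 k - y ord0 k| < d) ->
    `|Xc z ord0 j - Xc (y, z.2) ord0 j| <= Num.sqrt e}.
  apply: cid; have [d d0 hd] := compact_slice_unif_continuous cKL (Xc_coord_continuous (j := j)) s0.
  by exists d.
pose C := \sum_j (4 * M ^+ 2 / sval (dj j) ^+ 2).
have C0 j : 0 <= 4 * M ^+ 2 / sval (dj j) ^+ 2.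
  by rewrite mulr_ge0 ?invr_ge0 ?sqr_ge0// mulr_ge0// sqr_ge0.
exists C; first by apply: sumr_ge0 => j _; exact: C0.
move=> x y th j thL; have [d0 hd] := svalP (dj j); set d := sval (dj j) in d0 hd.
have S0 : 0 <= \sum_k (x ord0 k - y ord0 k) ^+ 2 by apply: sumr_ge0 => k _; exact: sqr_ge0.
have [close|/existsNP[k]] := pselect (forall k, `|x ord0 k - y ord0 k| < d); last first.
  move/negP; rewrite -leNgt => dk.
  apply: ler_wpDl; first exact: ltW.
  apply: (@le_trans _ _ (4 * M ^+ 2)).
    have := XM x th j thL; have := XM y th j thL; rewrite !ler_norml.
    move: (Xc (x, th) ord0 j) (Xc (y, th) ord0 j) => a b /andP[h1 h2] /andP[h3 h4]; nra.
  apply: (@le_trans _ _ (4 * M ^+ 2 / d ^+ 2 * d ^+ 2)).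
    by rewrite divfK// gt_eqF// exprn_gt0.
  apply: ler_pM; rewrite ?C0 ?sqr_ge0//.
    by rewrite /C (bigD1 j)//= lerDl; apply: sumr_ge0 => i _; exact: C0.
  rewrite (bigD1 k)//=; apply: ler_wpDr; first by apply: sumr_ge0 => i _; exact: sqr_ge0.
  rewrite -[leRHS]real_normK ?num_real//.
  by apply: lerXn2r; rewrite ?nnegrE ?normr_ge0 ?(ltW d0).
apply: ler_wpDr; first by apply: mulr_ge0 => //; apply: sumr_ge0 => i _; exact: C0.
have aux (a b : R) : `|a - b| <= Num.sqrt e -> (a - b) ^+ 2 <= e.
  move=> h; rewrite -(sqr_sqrtr (ltW e0)) -[leLHS]real_normK ?num_real//.
  by apply: lerXn2r; rewrite ?nnegrE ?normr_ge0 ?(ltW s0).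
apply: aux; have [Kx|nKx] := pselect (K x).
  by apply: (hd (x, th)); [split => //=; rewrite in_itv|exact: close].
have [Ky|nKy] := pselect (K y); last first.
  by rewrite !XK// subrr normr0 ltW.
rewrite distrC; apply: (hd (y, th)); first by split => //=; rewrite in_itv.
by move=> k /=; rewrite distrC; exact: close.
Qed.

End CompactSupport.

(** * The energy in terms of components *)

Section Energy.
Variables (R : realType) (T : R) (n : nat) (c : R[i]).
Variable Xc : 'rV[R]_(n + n) * R -> 'rV[R]_(n + n).
Hypothesis c_imag : complex.Re c = 0.
Hypothesis Xc_cont : continuous Xc.
Hypothesis Xc_supp : compactly_supported Xc.
Local Notation mR := (measurableTypeR R).
Local Notation P := (cylm T).
Local Notation I := 'I_(n + n).
Local Notation J := (I + I + I)%type.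
Local Notation kappa := (complex.Im c).
Implicit Types (F G : I -> mR * mR -> R) (u w : L21 T n).

(* Multiplication by the imaginary number c. *)
Definition rotate F : I -> mR * mR -> R := fun j =>
  match fintype.split j with
  | inl k => - kappa *: F (rshift n k)
  | inr k => kappa *: F (lshift n k)
  end.

Lemma rotate_sqint F : fam_sqint P F -> fam_sqint P (rotate F).
Proof. by move=> sF j; rewrite /rotate; case: fintype.split => k; exact: sqintZ. Qed.

Lemma rotateB F G : rotate (F - G) = rotate F - rotate G.
Proof.
apply/funext => j; apply/funext => z; rewrite !fctE /rotate.
by case: fintype.split => k; rewrite !fctE /GRing.scale/=; ring.
Qed.

Lemma rotate_lshift F k : rotate F (lshift n k) = - kappa *: F (rshift n k).
Proof. by rewrite /rotate (unsplitK (inl k)). Qed.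

Lemma rotate_rshift F k : rotate F (rshift n k) = kappa *: F (lshift n k).
Proof. by rewrite /rotate (unsplitK (inr k)). Qed.

Lemma rotate_norm F : fam_sqint P F -> fam_ip P (rotate F) (rotate F) = kappa ^+ 2 * fam_ip P F F.
Proof.
move=> sF; rewrite /fam_ip !big_split_ord/= [RHS]mulrDr !mulr_sumr addrC.
by congr (_ + _); apply: eq_bigr => k _; rewrite ?rotate_lshift ?rotate_rshift
  (ipZl _ (sF _) (sqintZ _ (sF _))) ipC (ipZl _ (sF _) (sF _)); ring.
Qed.

Lemma cmp_cplx_scale (f : R * R -> 'rV[R]_(n + n)) :
  cmp T (fun z => cplx_scale c (f z)) = rotate (cmp T f).
Proof.
apply/funext => j; apply/funext => z; rewrite /cmp /rotate patchE.
case: split_ordP => k ->; rewrite fctE patchE; case: ifP => _; rewrite ?scaler0//.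
  by rewrite /cplx_scale row_mxEl !mxE c_imag /GRing.scale/=; ring.
by rewrite /cplx_scale row_mxEr !mxE c_imag /GRing.scale/=; ring.
Qed.

Definition perturbation u := cmp T (fun z => Xc (u z, z.2)).

Lemma perturbation_bounded : exists M : R, forall u j z, `|perturbation u j z| <= M.
Proof.
have [M M0 h] := Xc_bounded Xc_cont Xc_supp (2 * pi).
exists M => u j [t th]; rewrite /perturbation /cmp patchE; case: ifPn => [/set_mem cz|_].
  by apply: h; case: cz => _ /=; rewrite /circle/= in_itv.
by rewrite normr0.
Qed.

Lemma perturbation_sqint u : fam_sqint P (perturbation u).
Proof.
have [M hM] := perturbation_bounded => j.
apply: (@sqint_bounded _ (mR * mR)%type R P (cylm_fin T) _ M) => //.
(* [u] is measurable on the cylinder only; its extension by 0 is measurable on the plane and yields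
   the same perturbation on the cylinder. *)
pose U z : 'rV[R]_(n + n) := \row_k cmp T u k z.
have -> : perturbation u j = cmp T (fun z => Xc (U z, z.2)) j.
  apply/funext => z; apply: cmpE => cz; congr (Xc (_, _) _ _).
  by apply/rowP => k; rewrite mxE cmp_in.
have mC := @measurable_cylinder R T.
apply/(measurable_restrictT _ mC); apply: measurable_funTS.
apply: (measurable_comp_continuous (Xc_coord_continuous Xc_cont (j := j))).
  move=> k; rewrite (_ : (fun z => _) = cmp T u k); first exact: (cmp_val_sqint u k).1.
  by apply/funext => z; rewrite mxE.
exact: measurable_snd.
Qed.

(** The components of u_theta - X_H(u, theta), cut off outside the cylinder. *)
Definition defect u := cmp T (L21dth u) - rotate (cmp T u) - perturbation u.

Lemma defectE u : cmp T (fun z => L21dth u z - hvf c Xc (u z, z.2)) = defect u.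
Proof.
rewrite cmpB /defect -addrA -opprD; congr (_ - _).
rewrite -cmp_cplx_scale; apply/funext => j; apply/funext => z.
by rewrite !fctE /perturbation /cmp !patchE; case: ifP; rewrite ?addr0// mxE.
Qed.

Lemma defect_sqint u : fam_sqint P (defect u).
Proof.
apply: fam_sqintB; last exact: perturbation_sqint.
by apply: fam_sqintB; [exact: cmp_dth_sqint|exact/rotate_sqint/cmp_val_sqint].
Qed.

Definition renergy u : R := 2^-1 *
  (fam_ip P (cmp T (L21dt u)) (cmp T (L21dt u)) + fam_ip P (defect u) (defect u)).

Lemma energyE u : energy (hvf c Xc) u = (renergy u)%:E.
Proof.
rewrite /energy (esqnorm2_cmp (cmp_dt_sqint u)) ?defectE; last exact: defect_sqint.
by rewrite -EFinM.
Qed.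

Lemma renergy_ge0 u : 0 <= renergy u.
Proof.
by rewrite mulr_ge0 ?invr_ge0// addr_ge0// fam_ip_ge0//;
  [exact: cmp_dt_sqint|exact: defect_sqint].
Qed.

Lemma perturbation_norm : exists2 M : R, 0 <= M &
  forall u, fam_ip P (perturbation u) (perturbation u) <= M.
Proof.
have [M hM] := perturbation_bounded.
have m0 : 0 <= fine (P setT) by exact: fine_ge0.
exists (\sum_(j < n + n) M ^+ 2 * fine (P setT)).
  by apply: sumr_ge0 => j _; rewrite mulr_ge0// sqr_ge0.
move=> u; apply: ler_sum => j _.
rewrite -(@Rintegral_cst _ (mR * mR)%type R P setT measurableT).
apply: le_Rintegral => //.
- exact: (sqintM (perturbation_sqint u j) (perturbation_sqint u j)).
- exact: (intble_cst (cylm_fin T)).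
- move=> z _; rewrite -expr2 -[leLHS]real_normK ?num_real//.
  have M0 : 0 <= M by exact: le_trans (hM u j z).
  by apply: lerXn2r; rewrite ?nnegrE.
Qed.

End Energy.

Lemma extract_subsequence (Q : nat -> Prop) : (forall N, exists i, (N <= i)%N /\ Q i) ->
  exists s : nat -> nat, {homo s : i j / (i < j)%N} /\ forall k, Q (s k).
Proof.
move=> h; have [f fP] := choice h.
pose s := fix s k := match k with 0%N => f 0%N | k'.+1 => f (s k').+1 end.
exists s; split; last by case=> [|k]; exact: (fP _).2.
by apply: homo_ltn => [|i]; [exact: ltn_trans|exact: (fP (s i).+1).1].
Qed.

Lemma le_limn_einf (R : realType) (u : nat -> \bar R) (l : \bar R) N :
  (forall k, (N <= k)%N -> (l <= u k)%E) -> (l <= limn_einf u)%E.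
Proof.
move=> ul; rewrite limn_einf_lim; apply: lime_ge; first exact: is_cvg_einfs.
exists N => // k /= Nk; apply: le_ereal_inf_tmp => _ [m /= km <-].
by apply: ul; exact: leq_trans km.
Qed.

(** * The three conclusions from an a priori L^2 estimate *)

Section Core.
Variables (R : realType) (T : R) (n : nat) (c : R[i]).
Hypothesis T_gt0 : 0 < T.
Variable Xc : 'rV[R]_(n + n) * R -> 'rV[R]_(n + n).
Hypothesis c_imag : complex.Re c = 0.
Hypothesis Xc_cont : continuous Xc.
Hypothesis Xc_supp : compactly_supported Xc.
Local Notation mR := (measurableTypeR R).
Local Notation P := (cylm T).
Local Notation I := 'I_(n + n).
Local Notation J := (I + I + I)%type.
Local Notation kappa := (complex.Im c).
Local Notation f := (defect c Xc).
Local Notation g := (perturbation Xc).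
Local Notation En := (renergy c Xc).
Implicit Types (F G : I -> mR * mR -> R) (u w : L21 T n).

(* Q is the trace bound when c is in iZ, and True otherwise. *)
Variable Q : L21 T n -> Prop.
Hypothesis apriori : exists2 K : R, 0 <= K &
  forall u, Q u -> fam_ip P (cmp T u) (cmp T u) <= K * (En u + 1).

Lemma fam_norm3_le F G (H : I -> mR * mR -> R) :
  fam_sqint P F -> fam_sqint P G -> fam_sqint P H ->
  fam_ip P (F + G + H) (F + G + H) <=
    4 * (fam_ip P F F + fam_ip P G G + fam_ip P H H).
Proof.
move=> sF sG sH; apply: (le_trans (fam_normD_le (fam_sqintD sF sG) sH)).
have := fam_normD_le sF sG; have := fam_ip_ge0 sH; lra.
Qed.

Lemma dth_defect u : cmp T (L21dth u) = f u + rotate c (cmp T u) + g u.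
Proof. by rewrite /defect addrAC subrK subrK. Qed.

Lemma energy_bound : exists2 K : R, 0 <= K &
  forall u, Q u -> fam_ip P (emb u) (emb u) <= K * (En u + 1).
Proof.
have [K K0 hK] := apriori; have [M M0 hM] := perturbation_norm T Xc_cont Xc_supp.
(* [K] accounts for u and 2 for u_t, whose squared norm is at most twice the energy. The sum u_theta
   = f + c u + g costs four times the bounds [2], [kappa ^+ 2 * K] and [M] of its terms. *)
exists (K + 2 + 4 * (2 + kappa ^+ 2 * K + M)).
  have : 0 <= kappa ^+ 2 * K by rewrite mulr_ge0// sqr_ge0.
  lra.
move=> u Qu; have h1 := hK u Qu; have h2 := hM u.
have su := cmp_val_sqint u; have st := cmp_dt_sqint u.
have sf := defect_sqint c Xc_cont Xc_supp u.
have sg := perturbation_sqint Xc_cont Xc_supp u.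
rewrite fam_ip3 /=.
have h3 := fam_norm3_le sf (rotate_sqint c su) sg.
rewrite -dth_defect (rotate_norm c su) in h3.
have h4 := fam_ip_ge0 st; have h5 := fam_ip_ge0 sf.
have E : En u = 2^-1 * (fam_ip P (cmp T (L21dt u)) (cmp T (L21dt u)) + fam_ip P (f u) (f u)) by [].
have E0 : 0 <= En u by exact: renergy_ge0.
have k1 : kappa ^+ 2 * fam_ip P (cmp T u) (cmp T u) <= kappa ^+ 2 * (K * (En u + 1)).
  by rewrite ler_wpM2l ?sqr_ge0.
have k2 : 0 <= M * En u by exact: mulr_ge0.
move: E E0 h1 h2 h3 h4 h5 k1 k2.
have -> : kappa ^+ 2 * (K * (En u + 1)) = kappa ^+ 2 * K * (En u + 1) by ring.
move: (fam_ip P (cmp T u) _) (fam_ip P (cmp T (L21dt u)) _) (fam_ip P (cmp T (L21dth u)) _)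
  (fam_ip P (f u) _) (fam_ip P (g u) _) (En u) (kappa ^+ 2) => a b d e' g' E q.
move: (q * K) => p ED E0 h1 h2 h3 h4 h5 k1 k2; lra.
Qed.

Lemma core_bounded (u : nat -> L21 T n) (C : R) : (forall i, Q (u i)) ->
  (forall i, En (u i) <= C) -> exists M : R, forall i, fam_ip P (emb (u i)) (emb (u i)) <= M.
Proof.
move=> Qu uC; have [K K0 hK] := energy_bound; exists (K * (C + 1)) => i.
by apply: (le_trans (hK _ (Qu i))); rewrite ler_wpM2l// lerD2r.
Qed.

Lemma core_compact (u : nat -> L21 T n) (C : R) : (forall i, Q (u i)) ->
  (forall i, (energy (hvf c Xc) (u i) < C%:E)%E) ->
  uniformly_bounded u /\ weakly_precompact (range u).
Proof.
move=> Qu uC; have [i|M hM] := @core_bounded u C Qu.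
  by have := uC i; rewrite energyE// lte_fin => /ltW.
split.
  exists (Num.sqrt M) => i; rewrite L21norm_emb lee_fin.
  by apply: ler_wsqrtr; exact: hM.
move=> v hv; apply: (bounded_weak_compact (M := M)) => i.
by have [k _ <-] := hv i; exact: hM.
Qed.

Section Limit.
Variables (u : nat -> L21 T n) (w : L21 T n) (C : R).
Hypothesis uw : weakly_converges u w.
Hypothesis Qu : forall i, Q (u i).
Hypothesis uC : forall i, En (u i) <= C.

Let S i := fam_ip P (cmp T (u i) - cmp T w) (cmp T (u i) - cmp T w).

Lemma cvg_L2 : S @ \oo --> 0.
Proof. by have [M hM] := core_bounded Qu uC; exact: weakly_converges_strong_L2 uw hM. Qed.

Let sduw i : fam_sqint P (cmp T (u i) - cmp T w).
Proof. by apply: fam_sqintB; exact: cmp_val_sqint. Qed.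

Let sg (v : L21 T n) : fam_sqint P (g v). Proof. exact: perturbation_sqint. Qed.
Let sf (v : L21 T n) : fam_sqint P (f v). Proof. exact: defect_sqint. Qed.

Lemma cvg_perturbation : (fun i => fam_ip P (g (u i) - g w) (g (u i) - g w)) @ \oo --> 0.
Proof.
have m0 : 0 <= fine (P setT) by exact: fine_ge0.
apply: cvg0_approx => e e0.
(* An error [e / (m + 1)] per point and component, integrated and summed over the components, stays
   below [e]. *)
pose m := (n + n)%:R * fine (P setT) : R.
have m0' : 0 <= m by rewrite mulr_ge0.
have [|C' C0 hC] := @Xc_approx_lipschitz _ _ _ _ Xc_cont Xc_supp (2 * pi) (e / (m + 1)).
  by rewrite divr_gt0// ltr_wpDl.
exists (fun i => (n + n)%:R * C' * S i); split.
  rewrite -[X in _ --> X](mulr0 ((n + n)%:R * C')); apply: cvgM; [exact: cvg_cst|exact: cvg_L2].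
move=> i; have sd := fam_sqintB (sg (u i)) (sg w).
rewrite ger0_norm ?fam_ip_ge0//.
have [iS SE] := fam_ipE (sduw i) (sduw i).
have one j : ip P ((g (u i) - g w) j) ((g (u i) - g w) j) <=
    C' * S i + e / (m + 1) * fine (P setT).
  rewrite [leRHS]addrC -(@Rintegral_cst _ (mR * mR)%type R P setT measurableT) /S SE.
  have i1 := intble_cst (cylm_fin T) (e / (m + 1)); have i2 := intbleZ C' iS.
  rewrite -RintegralZl// -RintegralD//; apply: le_Rintegral => //.
  - exact: (sqintM (sd j) (sd j)).
  - exact: intbleD.
  - move=> [t th] _; rewrite !fctE -expr2 /perturbation /cmp patchE.
    case: ifPn => [/set_mem cz|cz].
      have thL : 0 <= th <= 2 * pi by case: cz => _ /=; rewrite /circle/= in_itv.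
      have := hC (u i (t, th)) (w (t, th)) th j thL.
      rewrite patchE mem_set//= => h; apply: (le_trans h); rewrite lerD2l ler_wpM2l//.
      by apply: ler_sum => k _; rewrite !fctE !patchE !mem_set// expr2.
    rewrite patchE (negbTE cz) subr0 expr0n/= addr_ge0//.
      by rewrite divr_ge0 ?(ltW e0)// addr_ge0.
    by apply: mulr_ge0 => //; apply: sumr_ge0 => k _; rewrite -expr2 sqr_ge0.
apply: (@le_trans _ _ (\sum_(j < n + n) (C' * S i + e / (m + 1) * fine (P setT)))).
  by apply: ler_sum => j _; exact: one.
rewrite sumr_const card_ord -[leLHS]mulr_natl mulrDr mulrA lerD2l.
have -> : (n + n)%:R * (e / (m + 1) * fine (P setT)) = e * (m / (m + 1)) by rewrite /m; ring.
by rewrite ler_piMr ?(ltW e0)// ler_pdivrMr ?mul1r ?lerDl// ltr_wpDl.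
Qed.

Lemma cvg_rotate : (fun i => fam_ip P (rotate c (cmp T (u i) - cmp T w))
  (rotate c (cmp T (u i) - cmp T w))) @ \oo --> 0.
Proof.
rewrite (_ : (fun i => _) = fun i => kappa ^+ 2 * S i); last first.
  by apply/funext => i; exact: rotate_norm.
rewrite -[X in _ --> X](mulr0 (kappa ^+ 2)); apply: cvgM; [exact: cvg_cst|exact: cvg_L2].
Qed.

Let dt (v : L21 T n) := cmp T (L21dt v).
Let sdt (v : L21 T n) : fam_sqint P (dt v). Proof. exact: cmp_dt_sqint. Qed.
Let ddth i := cmp T (L21dth (u i)) - cmp T (L21dth w).
Let sddth i : fam_sqint P (ddth i).
Proof. by apply: fam_sqintB; exact: cmp_dth_sqint. Qed.

Lemma defect_diff i : f (u i) - f w =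
  ddth i - rotate c (cmp T (u i) - cmp T w) - (g (u i) - g w).
Proof.
rewrite rotateB /defect /ddth; apply/funext => j; apply/funext => z.
by rewrite !fctE; ring.
Qed.

Let A i := fam_ip P (dt (u i) - dt w) (dt w) + fam_ip P (f (u i) - f w) (f w).

(** In [f (u i) - f w] the part coming from u_theta converges weakly and the two others strongly,
    and all are paired with the fixed [f w]. *)
Lemma cvg_pairing : A @ \oo --> 0.
Proof.
have [M hM] := core_bounded Qu uC.
have s0 : fam_sqint P (0 : I -> mR * mR -> R) by exact: (@fam_sqint0 _ _ _ P (cylm_fin T) I).
have z0 F : fam_ip P F 0 = 0.
  by rewrite /fam_ip big1// => j _; rewrite /ip; under eq_Rintegral do rewrite mulr0;
    rewrite Rintegral_cst// mul0r.
have cv F G : fam_sqint P F -> fam_sqint P G ->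
    (fun i => fam_ip P (dt (u i) - dt w) F + fam_ip P (ddth i) G) @ \oo --> 0.
  move=> sF sG.
  pose H : J -> mR * mR -> R := fun j => match j with
    | inl (inl k) => 0 | inl (inr k) => F k | inr k => G k end.
  have sH : fam_sqint P H by move=> [[k|k]|k]; [exact: s0|exact: sF|exact: sG].
  have := weakly_converges_L2 uw hM sH.
  rewrite (_ : (fun i => fam_ip P (emb (u i) - emb w) H) =
    fun i => fam_ip P (dt (u i) - dt w) F + fam_ip P (ddth i) G)//.
  by apply/funext => i; rewrite fam_ip3 z0 add0r.
have r0 := fam_cvg0_CS (fun i => rotate_sqint c (sduw i)) (sf w) cvg_rotate.
have g0 := fam_cvg0_CS (fun i => fam_sqintB (sg (u i)) (sg w)) (sf w) cvg_perturbation.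
have h := cvgB (cvgB (cv _ _ (sdt w) (sf w)) r0) g0.
rewrite !subr0 in h; have AE i : A i = fam_ip P (dt (u i) - dt w) (dt w) + fam_ip P (ddth i) (f w) -
    fam_ip P (rotate c (cmp T (u i) - cmp T w)) (f w) - fam_ip P (g (u i) - g w) (f w).
  have sr := rotate_sqint c (sduw i); have sp := fam_sqintB (sg (u i)) (sg w).
  rewrite /A defect_diff (fam_ipBl (fam_sqintB (sddth i) sr) sp (sf w)).
  by rewrite (fam_ipBl (sddth i) sr (sf w)) !addrA.
by rewrite (funext AE); exact: h.
Qed.

Let N i := fam_ip P (dt (u i) - dt w) (dt (u i) - dt w) +
  fam_ip P (f (u i) - f w) (f (u i) - f w).

(** The energy is half the squared norm of the pair (u_t, f(u)), so it expands exactly around [w]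
    although [f] is nonlinear in [u]. Semicontinuity drops the nonnegative [N i]; strong convergence
    solves for it. *)
Lemma energy_expand i : En (u i) = En w + A i + 2^-1 * N i.
Proof.
rewrite /renergy /A /N (fam_normB (sdt (u i)) (sdt w)) (fam_normB (sf (u i)) (sf w)).
rewrite (fam_ipBl (sdt (u i)) (sdt w) (sdt w)) (fam_ipBl (sf (u i)) (sf w) (sf w)).
by rewrite -/(dt (u i)) -/(dt w); field.
Qed.

Lemma N_ge0 i : 0 <= N i.
Proof. by rewrite addr_ge0// fam_ip_ge0//; exact: fam_sqintB. Qed.

Lemma core_lsc : En w <= C.
Proof.
have h : (fun i => En w + A i) @ \oo --> En w.
  by rewrite -[X in _ --> X]addr0; apply: cvgD; [exact: cvg_cst|exact: cvg_pairing].
apply: (cvgr_le_cst h) => i; apply: le_trans (uC i).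
by rewrite energy_expand lerDl mulr_ge0 ?invr_ge0// N_ge0.
Qed.

(** Convergence of the energies forces [N] to 0, that is, strong convergence of u_t and of the
    defect; u_theta is recovered by adding back the two strongly convergent terms. *)
Lemma core_strong : (fun i => En (u i)) @ \oo --> En w -> strongly_converges u w.
Proof.
move=> Ew; have cN : N @ \oo --> 0.
  rewrite (_ : N = fun i => 2 * (En (u i) - En w - A i)); last first.
    by apply/funext => i; rewrite energy_expand; field.
  rewrite -[X in _ --> X](mulr0 2); apply: cvgM; first exact: cvg_cst.
  have -> : 0 = En w - En w - 0 by ring.
  by apply: cvgB; [apply: cvgB; [exact: Ew|exact: cvg_cst]|exact: cvg_pairing].
pose D i := fam_ip P (emb (u i) - emb w) (emb (u i) - emb w).
have sD i : fam_sqint P (emb (u i) - emb w) by apply: fam_sqintB; exact: emb_sqint.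
have cD : D @ \oo --> 0.
  pose B i := S i + N i + 4 * (N i + kappa ^+ 2 * S i +
    fam_ip P (g (u i) - g w) (g (u i) - g w)).
  have cB : B @ \oo --> 0.
    rewrite (_ : 0 = 0 + 0 + 4 * (0 + kappa ^+ 2 * 0 + 0)); last by ring.
    apply: cvgD; first by apply: cvgD; [exact: cvg_L2|exact: cN].
    apply: cvgM; first exact: cvg_cst.
    apply: cvgD; last exact: cvg_perturbation.
    by apply: cvgD; [exact: cN|apply: cvgM; [exact: cvg_cst|exact: cvg_L2]].
  apply: (@squeeze_cvgr _ _ _ _ (fun=> 0) B); [|exact: cvg_cst|exact: cB].
  apply: nearW => i; rewrite fam_ip_ge0//=.
  have -> : D i = S i + fam_ip P (dt (u i) - dt w) (dt (u i) - dt w) + fam_ip P (ddth i) (ddth i).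
    by rewrite /D fam_ip3.
  have h1 := fam_ip_ge0 (fam_sqintB (sdt (u i)) (sdt w)).
  have h2 := fam_ip_ge0 (fam_sqintB (sf (u i)) (sf w)).
  have sr := rotate_sqint c (sduw i); have sp := fam_sqintB (sg (u i)) (sg w).
  have h3 := fam_norm3_le (fam_sqintB (sf (u i)) (sf w)) sr sp.
  have e : f (u i) - f w + rotate c (cmp T (u i) - cmp T w) + (g (u i) - g w) = ddth i.
    by rewrite defect_diff addrAC subrK subrK.
  rewrite e rotate_norm// in h3; rewrite -/(S i) in h3; rewrite /B /N; move: h1 h2 h3.
  move: (fam_ip P (dt (u i) - dt w) _) (fam_ip P (f (u i) - f w) _) (fam_ip P (ddth i) _).
  by move: (fam_ip P (g (u i) - g w) _) (S i) (kappa ^+ 2) => b y s q a d h1 h2 h3; lra.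
rewrite /strongly_converges (_ : (fun i => _) = EFin \o (fun i => Num.sqrt (D i))); last first.
  by apply/funext => i; rewrite L21dist_emb.
apply: cvg_EFin; first exact: nearW.
rewrite -[X in _ --> X]sqrtr0; apply: (@cvg_comp _ _ _ D (@Num.sqrt R) _ (nbhs (0 : R))) => //.
exact: sqrt_continuous.
Qed.

End Limit.

Lemma weakly_converges_sub (u : nat -> L21 T n) w (s : nat -> nat) :
  {homo s : i j / (i < j)%N} -> weakly_converges u w -> weakly_converges (u \o s) w.
Proof.
move=> hs uw v; apply: (@cvg_comp _ _ _ s (fun i => L21dot (u i) v) _ \oo); last exact: uw.
have le k : (k <= s k)%N.
  by elim: k => // k IH; apply: (leq_ltn_trans IH); exact: hs.
by move=> A [N _ NA]; exists N => // k /= Nk; apply: NA; exact: leq_trans Nk (le k).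
Qed.

(** If the inequality failed, a subsequence would have energies at most some [C] below that of [w].
    It is bounded in L^2_1 by the a priori estimate, and [core_lsc] contradicts the choice of
    [C]. *)
Lemma core_liminf (u : nat -> L21 T n) w : (forall i, Q (u i)) -> weakly_converges u w ->
  (energy (hvf c Xc) w <= limn_einf (fun i => energy (hvf c Xc) (u i)))%E.
Proof.
move=> Qu uw; rewrite leNgt; apply/negP => lt.
rewrite energyE// in lt.
have [C lC Cw] : exists2 C : R,
    (limn_einf (fun i => energy (hvf c Xc) (u i)) < C%:E)%E & C < En w.
  move: lt; case: (limn_einf _) => [r||] //.
    rewrite lte_fin => rw; exists ((r + En w) / 2); rewrite ?lte_fin; lra.
  by move=> _; exists (En w - 1); rewrite ?ltNyr//; lra.
have [N|s [hs sC]] := @extract_subsequence (fun i => En (u i) <= C).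
  apply: contrapT => /forallNP h; move: lC; rewrite ltNge => /negP; apply.
  apply: (@le_limn_einf _ _ _ N) => k Nk; rewrite energyE// lee_fin.
  have := h k; rewrite not_andP => -[//|/negP]; by rewrite -ltNge => /ltW.
have := core_lsc (weakly_converges_sub hs uw) (fun i => Qu (s i)) sC.
by rewrite leNgt Cw.
Qed.

(** Convergent energies are bounded from some index on, and strong convergence is not affected by
    dropping the terms before it. *)
Lemma core_strong_convergence (u : nat -> L21 T n) w : (forall i, Q (u i)) ->
  weakly_converges u w ->
  (fun i => energy (hvf c Xc) (u i)) @ \oo --> energy (hvf c Xc) w -> strongly_converges u w.
Proof.
move=> Qu uw Ew.
have cE : (fun i => En (u i)) @ \oo --> En w.
  move: Ew; rewrite energyE// (_ : (fun i => _) = fun i => (En (u i))%:E).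
    by move=> /fine_cvg.
  by apply/funext => i; rewrite energyE.
have [N _ hN] : \forall i \near \oo, En (u i) <= En w + 1.
  by apply: (@cvgr_le R nat \oo _ _ (En w) cE); rewrite ltrDl.
pose s i := (i + N)%N.
have hs : {homo s : i j / (i < j)%N} by move=> i j ij; rewrite /s ltn_add2r.
have h := @core_strong (u \o s) w (En w + 1) (weakly_converges_sub hs uw) (fun i => Qu (s i)).
have {}h := h (fun i => hN _ (leq_addl _ _)).
rewrite /strongly_converges -(cvg_shiftn N); apply: h.
by rewrite (cvg_shiftn N (fun i => En (u i))).
Qed.

End Core.

(** * A priori estimates *)

Section NonInteger.
Variables (R : realType) (T : R) (n : nat) (c : R[i]).
Hypothesis T_gt0 : 0 < T.
Variable Xc : 'rV[R]_(n + n) * R -> 'rV[R]_(n + n).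
Hypothesis Xc_cont : continuous Xc.
Hypothesis Xc_supp : compactly_supported Xc.
Local Notation mR := (measurableTypeR R).
Local Notation P := (cylm T).
Local Notation kappa := (complex.Im c).

Lemma apriori_noninteger : ~ (exists k : int, kappa = k%:~R) ->
  exists2 K : R, 0 <= K & forall u : L21 T n,
    fam_ip P (cmp T u) (cmp T u) <= K * (renergy c Xc u + 1).
Proof.
move=> /rot_gap_gt0 gap; have [K K0 hK] := wdiff_rot_bound T_gt0 gap.
have [M M0 hM] := perturbation_norm T Xc_cont Xc_supp.
(* Here u_theta - c u is the defect plus the perturbation, so its squared norm is at most twice the
   sum of [2 * renergy c Xc u] and [M]. *)
exists (K * 2 * (2 + M)); first by rewrite !mulr_ge0// addr_ge0.
move=> u; pose G := cmp T (L21dth u) - rotate c (cmp T u).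
have sf := defect_sqint c Xc_cont Xc_supp u.
have sg := perturbation_sqint Xc_cont Xc_supp u.
have st := cmp_dt_sqint u.
have h1 : fam_ip P (cmp T u) (cmp T u) <= K * fam_ip P G G.
  rewrite /fam_ip !big_split_ord/= -!big_split/= mulr_sumr; apply: ler_sum => k _.
  have W j := weak_family_wdiff j (emb_weak_family u).
  have := hK _ _ _ _ _ _ (W (lshift n k)) (W (rshift n k)).
  have -> : G (lshift n k) = cmp T (L21dth u) (lshift n k) + kappa *: cmp T u (rshift n k).
    by rewrite -[X in _ + X]opprK -scaleNr -rotate_lshift.
  have -> : G (rshift n k) = cmp T (L21dth u) (rshift n k) - kappa *: cmp T u (lshift n k).
    by rewrite -rotate_rshift.
  by [].
have GE : G = defect c Xc u + perturbation Xc u by rewrite /defect subrK.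
have h2 : fam_ip P G G <= 2 * (2 * renergy c Xc u + M).
  rewrite GE; apply: (le_trans (fam_normD_le sf sg)); rewrite ler_wpM2l// lerD//.
  by rewrite /renergy mulrA mulfV// mul1r lerDr fam_ip_ge0.
have E0 : 0 <= renergy c Xc u by exact: renergy_ge0.
apply: (le_trans h1); rewrite -!mulrA ler_wpM2l//; apply: (le_trans h2).
by rewrite ler_wpM2l//; have := mulr_ge0 M0 E0; lra.
Qed.

End NonInteger.

(** * Control of a map by its values at t = 0 *)

Section SliceFTC.
Variables (R : realType) (T : R).
Hypothesis T_gt0 : 0 < T.
Local Notation mR := (measurableTypeR R).
Local Notation P := (cylm T).
Local Notation nu := (lam (2 * pi)).

(** The fundamental theorem on [[0, t]], then Cauchy-Schwarz against the indicator [p] of that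
    interval, whose squared norm is at most [T]. *)
Lemma ftc_sqr_bound (h h' : R -> R) (t : R) : is_deriv h h' -> continuous h' -> 0 <= t <= T ->
  h t ^+ 2 <= 2 * h 0 ^+ 2 + 2 * T * ip (lam T) h' h'.
Proof.
move=> dh ch /andP[t0 tT]; have e := lam_segment (lexx 0) tT ch.
have FT := FTC2_primitive t0 ch dh.
pose p s : R := ind_le (t, s) * ind_le (s, 0).
have p1 s : `|p s| <= 1 by rewrite normrM mulr_ile1// ind_le_norm.
have mp : measurable_fun setT (p : mR -> R).
  by apply: measurable_funM; [exact: ind_le_measurable|exact: ind_le_measurable2].
have sp : sqint (lam T) p by exact: (@sqint_bounded _ mR R _ (fin_setT _) _ 1).
have sh : sqint (lam T) h' by exact: continuous_sqint.
have ht : h t = h 0 + ip (lam T) p h'.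
  by rewrite /ip /p e FT /ind_le/= t0 mul1r addrC subrK.
have pp : ip (lam T) p p <= T.
  rewrite -[leRHS]mul1r -(Rintegral_lam_cst 1 T_gt0); apply: le_Rintegral => //.
  - exact: (sqintM sp sp).
  - exact: (intble_cst (fin_setT _)).
  - move=> s _; apply: (le_trans (ler_norm _)); rewrite normrM mulr_ile1//; exact: p1.
have cs := ip_CS sp sh.
have := ler_wpM2r (ip_ge0 sh) pp; rewrite ht.
move: cs; move: (ip (lam T) p h') (ip (lam T) p p) (ip (lam T) h' h') (h 0) => a b d x.
by move=> h1 h2; have := sqr_ge0 (x - a); lra.
Qed.

Lemma slice_bound (V Vt : R * R -> R) : continuous V -> continuous Vt ->
  (forall th, is_deriv (fun s => V (s, th)) (fun s => Vt (s, th))) ->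
  ip P V V <= 2 * T * ip nu (fun th => V (0, th)) (fun th => V (0, th)) +
              2 * T ^+ 2 * ip P Vt Vt.
Proof.
move=> cV cVt dV; have sV := continuous_sqint2 T cV; have sVt := continuous_sqint2 T cVt.
have slice0 (W : R * R -> R) (a : R) : continuous W -> continuous (fun y => W (a, y)).
  by move=> cW y; apply: (@cvg_comp _ _ _ (fun y => (a, y)) W _ (nbhs (a, y)));
    [exact: (cvg_pair (cvg_cst _) cvg_id)|exact: cW].
have slice1 (W : R * R -> R) (a : R) : continuous W -> continuous (fun x => W (x, a)).
  by move=> cW y; apply: (@cvg_comp _ _ _ (fun x => (x, a)) W _ (nbhs (y, a)));
    [exact: (cvg_pair cvg_id (cvg_cst _))|exact: cW].
have s0 : sqint nu (fun th => V (0, th)) by exact/continuous_sqint/slice0.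
have iV := sqintM sV sV; have iVt := sqintM sVt sVt; have i0 := sqintM s0 s0.
have jV := intble_Rintegral_fst iV; have jVt := intble_Rintegral_fst iVt.
rewrite /ip (RFubini_fst iV) (RFubini_fst iVt) -!RintegralZl//.
have k0 := intbleZ (2 * T) i0; have kt := intbleZ (2 * T ^+ 2) jVt.
rewrite -RintegralD//; apply: le_Rintegral => //.
  exact: intbleD.
move=> th _.
pose B := 2 * V (0, th) ^+ 2 + 2 * T * \int[lam T]_x (Vt (x, th) * Vt (x, th)).
have bd t : 0 <= t <= T -> V (t, th) ^+ 2 <= B.
  by move=> tT; apply: (ftc_sqr_bound (dV th) (slice1 _ _ cVt) tT).
have sVth : sqint (lam T) (fun x => V (x, th)) by exact/continuous_sqint/slice1.
have -> : 2 * T * (V (0, th) * V (0, th)) +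
    2 * T ^+ 2 * \int[lam T]_x (Vt (x, th) * Vt (x, th)) = B * T by rewrite /B; ring.
rewrite -(Rintegral_lam_cst B T_gt0).
rewrite [leLHS](_ : _ = \int[lam T]_x Num.min (V (x, th) * V (x, th)) B); last first.
  apply: Rintegral_ae.
  - exact: intble_measurable (sqintM sVth sVth).
  - by apply: measurable_minr => //; exact: intble_measurable (sqintM sVth sVth).
  - apply: filterS (ae_lam T) => s /andP[h0 hT].
    by rewrite min_l// -expr2 bd// !ltW.
have iB := intble_cst (fin_setT (lam T)) B.
have B0 : 0 <= B by apply: le_trans (sqr_ge0 (V (0, th))) (bd 0 _); rewrite lexx ltW.
apply: le_Rintegral => //.
- apply: (@intble_dom _ mR R (lam T) _ (fun=> B)) => //.
    by apply: measurable_minr => //; exact: intble_measurable (sqintM sVth sVth).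
  move=> s; rewrite ger0_norm ?ge_min ?lexx ?orbT// le_min B0 andbT.
  by rewrite -expr2 sqr_ge0.
- by move=> s _; rewrite ge_min lexx orbT.
Qed.

End SliceFTC.

Lemma half_power_lt (R : realType) (x : \bar R) (C : R) : (0 <= x)%E ->
  (x `^ 2^-1 < C%:E)%E -> (x <= (C ^+ 2)%:E)%E.
Proof.
case: x => [r|_|//]; last by rewrite poweRyr// invr_eq0 pnatr_eq0.
rewrite lee_fin => r0; rewrite sqrte_EFin// lte_fin lee_fin => sC.
rewrite -(sqr_sqrtr r0); apply: lerXn2r; rewrite ?nnegrE ?sqrtr_ge0 ?(ltW sC)//.
exact: le_trans (sqrtr_ge0 r) (ltW sC).
Qed.

(** * The a priori estimate from the trace *)

Section Trace.
Variables (R : realType) (T : R) (n : nat) (c : R[i]).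
Hypothesis T_gt0 : 0 < T.
Variable Xc : 'rV[R]_(n + n) * R -> 'rV[R]_(n + n).
Hypothesis Xc_cont : continuous Xc.
Hypothesis Xc_supp : compactly_supported Xc.
Local Notation mR := (measurableTypeR R).
Local Notation P := (cylm T).
Local Notation nu := (lam (2 * pi)).
Local Notation leb := (@lebesgue_measure R).
Implicit Types v : R * R -> 'rV[R]_(n + n).

Lemma coord_cont (Y : topologicalType) (v : Y -> 'rV[R]_(n + n)) j :
  continuous v -> continuous (fun z => v z ord0 j).
Proof.
move=> cv z; apply: (@continuous_comp _ _ _ v (fun x : 'rV[R]_(n + n) => x ord0 j)).
  exact: cv.
exact: coord_continuous.
Qed.

Lemma cmp_continuous v : continuous v -> fam_sqint P (cmp T v) /\
  fam_ip P (cmp T v) (cmp T v) =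
  \sum_j ip P (fun z => v z ord0 j) (fun z => v z ord0 j).
Proof.
move=> cv; have sj j := continuous_sqint2 T (coord_cont (j := j) cv).
have FP : Filter (nbhs (almost_everywhere P)) by exact: ae_filter_ringOfSetsType.
have ae j : {ae P, forall z, cmp T v j z = v z ord0 j}.
  by apply: (@filterS _ _ FP _ _ _ (ae_cylm T)) => z cz; rewrite cmp_in.
have mc j : measurable_fun setT (cmp T v j).
  apply/(measurable_restrictT _ (@measurable_cylinder R T)); apply: measurable_funTS.
  exact: (sj j).1.
split=> [j|]; first exact: sqint_ae (mc j) (sj j) (ae j).
by apply: eq_bigr => j _; apply: ip_ae; [exact: mc|exact: (sj j).1|exact: mc|exact: (sj j).1| |].
Qed.

Lemma is_deriv_coord v j th : Ck 1 v ->
  is_deriv (fun s => v (s, th) ord0 j) (fun s => 'D_(e_t R) v (s, th) ord0 j).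
Proof.
move=> [_ /(_ (e_t R))[dv _]] s; pose f z := v z ord0 j.
have df : derivable f (s, th) (e_t R) by apply: ((derivable_mxP _ _ _).1 (dv (s, th))).
have E : (fun h : R => h^-1 *: (((fun s => v (s, th) ord0 j) \o shift s) (h *: (1 : R)) -
    v (s, th) ord0 j)) = (fun h => h^-1 *: ((f \o shift (s, th)) (h *: e_t R) - f (s, th))).
  apply/funext => h /=; congr (_ *: (_ - _)); rewrite /f; congr (v (_, _) _ _).
  by rewrite /= scaler0 add0r.
split; first by rewrite /derivable E.
by rewrite (derive_mx (dv (s, th))) mxE /derive E.
Qed.

Lemma smooth_trace_bound v : Ck 1 v ->
  fam_ip P (cmp T v) (cmp T v) <=
  2 * T * fam_ip nu (fun j th => v (0, th) ord0 j) (fun j th => v (0, th) ord0 j) +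
  2 * T ^+ 2 * fam_ip P (cmp T ('D_(e_t R) v)) (cmp T ('D_(e_t R) v)).
Proof.
move=> Cv; have [cv /(_ (e_t R))[_ [cvt _]]] := Cv.
rewrite (cmp_continuous cv).2 (cmp_continuous cvt).2 !mulr_sumr -big_split/=.
apply: ler_sum => j _.
apply: (slice_bound T_gt0 (coord_cont (j := j) cv) (coord_cont (j := j) cvt)) => th.
exact: is_deriv_coord.
Qed.

Lemma circle_integral v : continuous v ->
  (\int[leb]_(th in @circle R) (esqnorm (v (0, th)))%:E =
   (fam_ip nu (fun j th => v (0, th) ord0 j) (fun j th => v (0, th) ord0 j))%:E)%E.
Proof.
move=> cv; have s0 j : sqint nu (fun th : mR => v (0, th) ord0 j).
  apply: continuous_sqint => y.
  apply: (@cvg_comp _ _ _ (fun y => (0, y)) (fun z => v z ord0 j) _ (nbhs ((0 : R), y))).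
    exact: (cvg_pair (cvg_cst _) cvg_id).
  exact: (@coord_cont _ v j cv (0, y)).
have [i ->] := fam_ipE s0 s0.
by rewrite -EFin_Rintegral// integral_lam//; exact: measurable_int i.
Qed.

Lemma esqnormD_le (x y : 'rV[R]_(n + n)) : esqnorm x <= 2 * esqnorm y + 2 * esqnorm (x - y).
Proof.
rewrite /esqnorm /edot !mulr_sumr -big_split/=; apply: ler_sum => j _; rewrite !mxE.
by move: (x ord0 j) (y ord0 j) => a b; have := sqr_ge0 (a - 2 * b); lra.
Qed.

(** A single smooth approximation suffices, at distance less than 1 from [u] in L^2_1 and less than
    1 from the trace at [t = 0]. The slice estimate applies to it, and the errors of size 1 go into
    the constant. *)
Lemma apriori_trace (C : R) : exists2 K : R, 0 <= K & forall u : L21 T n, trace0_norm_lt u C ->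
    fam_ip P (cmp T u) (cmp T u) <= K * (renergy c Xc u + 1).
Proof.
(* With squared norms |.|^2 and w the approximation: |u|^2 <= 2 (|w|^2 + 1), |w|^2 <= 2 T (2 C^2 +
   2) + 2 T^2 |w_t|^2, and |w_t|^2 <= 2 (1 + 2 E). *)
exists (4 * T * (2 * C ^+ 2 + 2) + 16 * T ^+ 2 + 8 * T ^+ 2 + 4).
  have := sqr_ge0 C; have := sqr_ge0 T; move: (C ^+ 2) (T ^+ 2) => a b b0 a0.
  have := mulr_ge0 (ltW T_gt0) a0; have := T_gt0; lra.
move=> u [g [[[mg gfin] [v [Cv vu vg]]] gC]].
have lt1 (F : nat -> \bar R) : F @ \oo --> 0%E -> \forall k \near \oo, (F k < 1%:E)%E.
  move=> F0; apply: (F0 [set y | (y < 1%:E)%E]); apply: open_nbhs_nbhs.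
  split; first exact: open_ereal_lt_ereal.
  by rewrite /= lte_fin.
have [k [k1 k2]] := filter_ex (filterI (lt1 _ vu) (lt1 _ vg)).
have C1 := (Cv k).1 1%N; move: (v k) C1 k1 k2 => {vu vg Cv lt1}w C1 k1 k2.
have [cw h] := C1; have [_ [cwt _]] := h (e_t R); have [_ [cwth _]] := h (e_th R).
have [sw _] := cmp_continuous cw; have [swt _] := cmp_continuous cwt.
have [swth _] := cmp_continuous cwth.
have su := cmp_val_sqint u; have st := cmp_dt_sqint u; have sth := cmp_dth_sqint u.
have d0 := fam_sqintB sw su; have d1 := fam_sqintB swt st; have d2 := fam_sqintB swth sth.
have [n0 n1] : fam_ip P (cmp T w - cmp T u) (cmp T w - cmp T u) <= 1 /\
    fam_ip P (cmp T ('D_(e_t R) w) - cmp T (L21dt u)) (cmp T ('D_(e_t R) w) - cmp T (L21dt u)) <= 1.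
  move: k1; rewrite L21norm_of_cmp ?cmpB// lte_fin => h1.
  have := fam_ip_ge0 d0; have := fam_ip_ge0 d1; have := fam_ip_ge0 d2; move: h1.
  move: (fam_ip _ _ _) (fam_ip _ _ _) (fam_ip _ _ _) => z y x h1 z0 y0 x0.
  have : x + y + z <= 1.
    rewrite -[X in X <= _]sqr_sqrtr ?addr_ge0// expr_le1// ?ltW//.
  by split; lra.
have B0 : fam_ip nu (fun j th => w (0, th) ord0 j) (fun j th => w (0, th) ord0 j) <=
    2 * C ^+ 2 + 2.
  have mC : measurable (@circle R : set mR) by exact: measurable_itv.
  have mw j : measurable_fun (@circle R : set mR) (fun th : mR => w (0, th) ord0 j).
    apply: measurable_funTS; apply: continuous_measurable => y.
    apply: (@cvg_comp _ _ _ (fun y => (0, y)) (fun z => w z ord0 j) _ (nbhs ((0 : R), y))).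
      exact: (cvg_pair (cvg_cst _) cvg_id).
    exact: (@coord_cont _ w j cw (0, y)).
  have esq0 (x : 'rV[R]_(n + n)) : 0 <= esqnorm x.
    by apply: sumr_ge0 => j _; rewrite -expr2 sqr_ge0.
  have mg2 : measurable_fun (@circle R : set mR) (fun th : mR => (2 * esqnorm (g th))%:E).
    apply/measurable_EFinP; apply: measurable_funM => //.
    by apply: measurable_sum => j; apply: measurable_funM; exact: mg.
  have mwg : measurable_fun (@circle R : set mR) (fun th : mR => (2 * esqnorm (w (0, th) - g th))%:E).
    apply/measurable_EFinP; apply: measurable_funM => //.
    apply: measurable_sum => j; apply: measurable_funM; under eq_fun do rewrite !mxE;
      by apply: measurable_funB; [exact: mw|exact: mg].
  have h1 : (\int[leb]_(th in @circle R) (esqnorm (g th))%:E <= (C ^+ 2)%:E)%E.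
    by apply: half_power_lt gC; apply: integral_ge0 => x _; rewrite lee_fin.
  have h2 : (\int[leb]_(th in @circle R) (esqnorm (w (0, th) - g th))%:E <= (1 ^+ 2)%:E)%E.
    by apply: half_power_lt k2; apply: integral_ge0 => x _; rewrite lee_fin.
  rewrite -lee_fin -circle_integral//.
  apply: (@le_trans _ _ (\int[leb]_(th in @circle R)
      ((2 * esqnorm (g th))%:E + (2 * esqnorm (w (0, th) - g th))%:E))%E).
    apply: ge0_le_integral => //.
    - by move=> x _; rewrite lee_fin.
    - apply/measurable_EFinP; apply: measurable_sum => j.
      by apply: measurable_funM; exact: mw.
    - exact: emeasurable_funD.
    - by move=> x _; rewrite -EFinD lee_fin esqnormD_le.
  rewrite ge0_integralD//; last 2 first.
  - by move=> x _; rewrite lee_fin mulr_ge0.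
  - by move=> x _; rewrite lee_fin mulr_ge0.
  have Z (F : mR -> R) : measurable_fun (@circle R : set mR) F -> (forall x, 0 <= F x) ->
      (\int[leb]_(th in @circle R) (2 * F th)%:E = 2%:E * \int[leb]_(th in @circle R) (F th)%:E)%E.
    move=> mF F0; rewrite -ge0_integralZl//; first exact/measurable_EFinP.
    by move=> x _; rewrite lee_fin.
  rewrite EFinD leeD//.
    rewrite Z//; last by apply: measurable_sum => j; apply: measurable_funM; exact: mg.
    by rewrite EFinM lee_wpmul2l.
  rewrite Z//; last first.
    apply: measurable_sum => j; apply: measurable_funM; under eq_fun do rewrite !mxE;
      by apply: measurable_funB; [exact: mw|exact: mg].
  by rewrite -[X in (_ <= X%:E)%E]mulr1 -[X in (_ <= (_ * X)%:E)%E](expr1n _ 2) EFinM lee_wpmul2l.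
have S := smooth_trace_bound C1.
have E1 : fam_ip P (cmp T u) (cmp T u) <= 2 * (fam_ip P (cmp T w) (cmp T w) + 1).
  have -> : cmp T u = cmp T w - (cmp T w - cmp T u) by rewrite opprB addrC subrK.
  apply: (le_trans (fam_normB_le sw d0)).
  by rewrite ler_wpM2l// lerD2l.
have E2 : fam_ip P (cmp T ('D_(e_t R) w)) (cmp T ('D_(e_t R) w)) <=
    2 * (1 + fam_ip P (cmp T (L21dt u)) (cmp T (L21dt u))).
  rewrite -[X in fam_ip P X _](subrK (cmp T (L21dt u))).
  rewrite -[X in fam_ip P _ X](subrK (cmp T (L21dt u))).
  apply: (le_trans (fam_normD_le d1 st)).
  by rewrite ler_wpM2l// lerD2r.
have E3 : fam_ip P (cmp T (L21dt u)) (cmp T (L21dt u)) <= 2 * renergy c Xc u.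
  rewrite /renergy mulrA mulfV// mul1r lerDl fam_ip_ge0//; exact: defect_sqint.
have E0 : 0 <= renergy c Xc u by exact: renergy_ge0.
have p1 := ler_wpM2l (ltW T_gt0) B0; have p2 := ler_wpM2l (sqr_ge0 T) E2.
have p3 := ler_wpM2l (sqr_ge0 T) E3.
have p4 := mulr_ge0 (sqr_ge0 T) E0.
have p5 := mulr_ge0 (mulr_ge0 (ltW T_gt0) (sqr_ge0 C)) E0.
have p6 := mulr_ge0 (ltW T_gt0) E0.
have p7 := sqr_ge0 T.
move: S E1 E0 p1 p2 p3 p4 p5 p6 p7.
move: (fam_ip P (cmp T (L21dt u)) (cmp T (L21dt u))) => xt.
move: (fam_ip P (cmp T ('D_(e_t R) w)) (cmp T ('D_(e_t R) w))) => yt.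
move: (fam_ip P (cmp T u) (cmp T u)) (fam_ip P (cmp T w) (cmp T w)) (fam_ip nu _ _) => x y b.
by move: (renergy c Xc u) (T ^+ 2) (C ^+ 2) => E T2 C2 S E1 E0 p1 p2 p3 p4 p5 p6 p7; lra.
Qed.

End Trace.

Theorem theorem5 (R : realType) (n : nat) (T : R) (T_gt0 : 0 < T)
    (c : R[i]) (c_imag : complex.Re c = 0)
    (Xc : 'rV[R]_(n + n) * R -> 'rV[R]_(n + n))
    (Xc_per : periodic2 Xc) (Xc_C1 : Ck 1 Xc)
    (Xc_supp : compactly_supported Xc) :
  let E : L21 T n -> \bar R := energy (hvf c Xc) in
  let c_in_iZ := exists k : int, c = (0 +i* k%:~R)%C in
  (~ c_in_iZ ->
    [/\ forall (u : nat -> L21 T n) (C : R),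
          (forall i, (E (u i) < C%:E)%E) ->
          uniformly_bounded u /\ weakly_precompact (range u),
        forall (u : nat -> L21 T n) (w : L21 T n),
          weakly_converges u w ->
          (E w <= limn_einf (fun i => E (u i)))%E &
        forall (u : nat -> L21 T n) (w : L21 T n),
          weakly_converges u w ->
          (fun i => E (u i)) @ \oo --> E w ->
          strongly_converges u w]) /\
  (c_in_iZ ->
    [/\ forall (u : nat -> L21 T n) (C' C : R),
          (forall i, trace0_norm_lt (u i) C') ->
          (forall i, (E (u i) < C%:E)%E) ->
          uniformly_bounded u /\ weakly_precompact (range u),
        forall (u : nat -> L21 T n) (w : L21 T n) (C' : R),
          (forall i, trace0_norm_lt (u i) C') ->
          weakly_converges u w ->
          (E w <= limn_einf (fun i => E (u i)))%E &
        forall (u : nat -> L21 T n) (w : L21 T n) (C' : R),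
          (forall i, trace0_norm_lt (u i) C') ->
          weakly_converges u w ->
          (fun i => E (u i)) @ \oo --> E w ->
          strongly_converges u w]).
Proof.
move=> E c_in_iZ; have Xc_cont : continuous Xc := Xc_C1.1.
split=> [c_nZ|_].
  (* In this case the side condition [Q] is taken to be [True]. *)
  have apriori : exists2 K : R, 0 <= K & forall u : L21 T n, True ->
      fam_ip (cylm T) (cmp T u) (cmp T u) <= K * (renergy c Xc u + 1).
    have nk : ~ (exists k : int, complex.Im c = k%:~R).
      move=> [k ck]; apply: c_nZ; exists k.
      by case: (c) ck c_imag => a b /= -> ->.
    have [K K0 hK] := apriori_noninteger T_gt0 Xc_cont Xc_supp nk.
    by exists K.
  split=> [u C uC|u w uw|u w uw Ew].
  - exact: (core_compact c_imag Xc_cont Xc_supp apriori (fun=> I) uC).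
  - exact: (core_liminf T_gt0 c_imag Xc_cont Xc_supp apriori (fun=> I) uw).
  - exact: (core_strong_convergence T_gt0 c_imag Xc_cont Xc_supp apriori (fun=> I) uw Ew).
(* Here [Q] is the trace bound; the resulting constant depends on [C'], which is fixed along a
   sequence. *)
have apriori C := apriori_trace c T_gt0 Xc_cont Xc_supp C.
split=> [u C' C uC' uC|u w C' uC' uw|u w C' uC' uw Ew].
- exact: (core_compact c_imag Xc_cont Xc_supp (apriori C') uC' uC).
- exact: (core_liminf T_gt0 c_imag Xc_cont Xc_supp (apriori C') uC' uw).
- exact: (core_strong_convergence T_gt0 c_imag Xc_cont Xc_supp (apriori C') uC' uw Ew).
Qed.
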